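(* Consider the algorithm described in the context, applied to $\min_{x\in\mathbb{R}^d} h(x)$. Suppose that every $f_i$ is $L$-smooth for some $L>0$, that every $f_i$ is convex, that $f=\frac1n\sum_{i=1}^n f_i$ is $\mu$-strongly convex for some $\mu>0$, and that the sampling assumption (i)-(iii) in the context holds. Let $x^\ast$ denote the minimizer of $h$. If the step size is $\alpha=\frac{R}{2L(36d+R)}$, then for every positive integer $K$, \[ \mathbb{E}\big[\|x_K-x^\ast\|_2^2\big]\le (1-\kappa)^K\Big[\|x_0-x^\ast\|_2^2+\frac{8dR}{L^2 n\sigma(36d+R)^2}\|J_0-\nabla F(x^\ast)\|_F^2\Big]+\sum_{k=1}^{K}(1-\kappa)^{K-k}C_1(\beta_{k-1}), \] where $\kappa=\min\big\{\frac{\mu R}{4L(36d+R)},\frac{\sigma}{4}\big\}$ and \[ C_1(\beta)=\frac{\beta^2 dR\,\big(d(32\mu\nu+36L\sigma^2+\mu R\sigma^2)+LR\sigma^2\big)}{4\mu\sigma^2(36d+R)^2}. \]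
   Context: Setting. $n,d\ge 1$ are integers, $[n]=\{1,\dots,n\}$; $f_1,\dots,f_n:\mathbb{R}^d\to\mathbb{R}$ are differentiable; $f=\frac1n\sum_{i=1}^n f_i$; $\psi:\mathbb{R}^d\to\mathbb{R}\cup\{+\infty\}$ is convex, lower semicontinuous and not identically $+\infty$; $h=f+\psi$. $\nabla F(x)\in\mathbb{R}^{d\times n}$ is the matrix whose $i$-th column is $\nabla f_i(x)$. $\|\cdot\|_F$ is the Frobenius norm, $e_i$ denotes a standard basis vector, $\mathbf 1$ the all-ones vector in $\mathbb{R}^n$, $\mathbb{S}^{d-1}$ the unit sphere. $f_i$ is $L$-smooth if $\|\nabla f_i(x)-\nabla f_i(y)\|_2\le L\|x-y\|_2$ for all $x,y$. $\operatorname{prox}_{\alpha\psi}(x)=\arg\min_y\{\frac12\|x-y\|_2^2+\alpha\psi(y)\}$. For $u\in\mathbb{R}^d$, $\beta>0$: $\widehat\nabla_u f_i(x;\beta)=\frac{f_i(x+\beta u)-f_i(x)}{\beta}u$. Algorithm. Parameters: $\alpha>0$, smoothing radii $\beta_k>0$ ($k\ge0$), batch size $R$ (positive integer); deterministic $x_0\in\mathbb{R}^d$, $J_0\in\mathbb{R}^{d\times n}$. $J_k^{(i)}$ is the $i$-th column of $J_k$. At iteration $k=0,1,2,\dots$ generate a $\{0,1\}$-valued random variable $\omega_k$, a random finite set $\mathcal S_k\subseteq[n]\times\mathbb{R}^d$ (possibly dependent on $\omega_k$), and $\mathcal R_k=\{(i_k^1,u_k^1),\dots,(i_k^R,u_k^R)\}$,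 where $i_k^1,\dots,i_k^R$ are sampled uniformly from $[n]$ without replacement (so $R\le n$), and, independently of them, $u_k^1,\dots,u_k^R$ are independent, all uniform on $\{e_1,\dots,e_d\}$ or all uniform on $\mathbb{S}^{d-1}$ (one of the two choices, fixed). The random quantities drawn at iteration $k$ are independent of those of earlier iterations. Then \[ g_k=\tfrac1n J_k\mathbf 1+\tfrac dR\sum_{(i,u)\in\mathcal R_k}\big(\widehat\nabla_u f_i(x_k;\beta_k)-uu^TJ_k^{(i)}\big),\qquad x_{k+1}=\operatorname{prox}_{\alpha\psi}(x_k-\alpha g_k), \] \[ J_{k+1}=J_k+\omega_k\sum_{(i,u)\in\mathcal S_k}\big(\widehat\nabla_u f_i(x_k;\beta_k)-uu^TJ_k^{(i)}\big)e_i^T . \] Sampling assumption. Let $P_k(A)=\sum_{(i,u)\in\mathcal S_k}uu^TAe_ie_i^T$ for $A\in\mathbb{R}^{d\times n}$. (i) $(\mathcal S_k,\omega_k)$, $k\ge0$, are i.i.d.; (ii) for every $k$ and $i\in[n]$, the vectors $\{u:(i,u)\in\mathcal S_k\}$ are orthonormal; (iii) there is a constant $\sigma\in(0,1)$ with $\mathbb{E}[\omega_kP_k(A)]=\sigma A$ for all $A\in\mathbb{R}^{d\times n}$ and all $k$. Define $\nu=\mathbb{E}[\omega_k|\mathcal S_k|]$ (independent of $k$). *)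

(* Defs.v *)
From HB Require Import structures.
From mathcomp Require Import all_boot all_order all_algebra finmap.
From mathcomp Require Import all_classical all_reals all_analysis.

Set Implicit Arguments.
Unset Strict Implicit.
Unset Printing Implicit Defensive.

Import Order.TTheory GRing.Theory Num.Theory.
Import numFieldNormedType.Exports.

Local Open Scope classical_set_scope.
Local Open Scope ring_scope.

Section euclidean.
Context {R : realType}.

(* The library norm `|A| on matrices is the sup norm; fnorm is the Frobenius
   norm, hence the Euclidean norm on column vectors. *)
Definition fnorm m p (A : 'M[R]_(m, p)) : R :=
  Num.sqrt (\sum_i \sum_j A i j ^+ 2).

Definition grad d (f : 'cV[R]_d -> R) (x : 'cV[R]_d) : 'cV[R]_d :=
  \col_j 'D_(delta_mx j 0) f x.

Definition gradF n d (f : 'I_n -> 'cV[R]_d -> R) (x : 'cV[R]_d) : 'M[R]_(d, n) :=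
  \matrix_(a, i) grad (f i) x a 0.

Definition smooth d (L : R) (f : 'cV[R]_d -> R) : Prop :=
  forall x y, fnorm (grad f x - grad f y) <= L * fnorm (x - y).

Definition strongly_convex d (mu : R) (f : 'cV[R]_d -> R) : Prop :=
  forall (x y : 'cV[R]_d) (t : R), 0 <= t <= 1 ->
    f (t *: x + (1 - t) *: y) <=
    t * f x + (1 - t) * f y - mu / 2 * t * (1 - t) * fnorm (x - y) ^+ 2.

Definition favg n d (f : 'I_n -> 'cV[R]_d -> R) (x : 'cV[R]_d) : R :=
  n%:R^-1 * \sum_i f i x.

(* With values in \bar R \ {-oo} the conventions 0 * +oo = 0 and
   r + +oo = +oo make the endpoints t = 0 and t = 1 harmless. *)
Definition econvex d (psi : 'cV[R]_d -> \bar R) : Prop :=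
  forall (x y : 'cV[R]_d) (t : R), 0 <= t <= 1 ->
    (psi (t *: x + (1 - t) *: y)%R <= t%:E * psi x + (1 - t)%:E * psi y)%E.

Definition eproper d (psi : 'cV[R]_d -> \bar R) : Prop :=
  (forall x, psi x != -oo%E) /\ (exists x, psi x != +oo%E).

Definition argmin (X : Type) (F : X -> \bar R) : set X :=
  [set y | forall z, (F y <= F z)%E].

Definition prox d (alpha : R) (psi : 'cV[R]_d -> \bar R) (x : 'cV[R]_d) :
    'cV[R]_d :=
  get (argmin (fun y =>
    ((2^-1 * fnorm (x - y) ^+ 2)%:E + alpha%:E * psi y)%E)).

End euclidean.

Section random_elements.
Context {R : realType}.

Definition borel_cV d := g_sigma_algebraType (@open 'cV[R]_d).

(* The sigma-algebra on finite subsets of [n] x R^d generated by the counting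
   maps s |-> #{u in B | (i, u) in s}, with B a Borel set. *)
Definition count_events n d : set (set {fset 'I_n * 'cV[R]_d}) :=
  [set A | exists i (B : set 'cV[R]_d) (m : nat), <<s open >> B /\
    A = [set s | #|` [fset p in s | (p.1 == i) && (p.2 \in B)]%fset | = m]].

Definition random_fset n d := g_sigma_algebraType (@count_events n d).

Context {dT : measure_display} {T : measurableType dT} (P : probability T R).

Definition independent {d1 d2} {T1 : measurableType d1} {T2 : measurableType d2}
    (X : T -> T1) (Y : T -> T2) : Prop :=
  forall A B, measurable A -> measurable B ->
    P (X @^-1` A `&` Y @^-1` B) = (P (X @^-1` A) * P (Y @^-1` B))%E.

Definition mutually_independent (J : finType) {d1} {T1 : measurableType d1}
    (X : J -> T -> T1) : Prop :=
  forall A : J -> set T1, (forall j, measurable (A j)) ->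
    P (\bigcap_j (X j @^-1` A j)) = (\prod_j P (X j @^-1` A j))%E.

(* Independence of an infinite sequence only has to be tested on its initial
   segments: a finite subfamily is obtained by taking A j = setT elsewhere. *)
Definition iid {d1} {T1 : measurableType d1} (X : nat -> T -> T1) : Prop :=
  (forall N, mutually_independent (fun j : 'I_N => X j)) /\
  (forall k A, measurable A -> P (X k @^-1` A) = P (X 0%N @^-1` A)).

Definition uniform_basis d (u : T -> 'cV[R]_d) : Prop :=
  forall j : 'I_d, P [set w | u w = delta_mx j 0] = (d%:R^-1)%:E.

(* The uniform distribution on the unit sphere is the only probability
   measure on the sphere which is invariant under the orthogonal group. *)
Definition uniform_sphere d (u : T -> 'cV[R]_d) : Prop :=
  P [set w | fnorm (u w) = 1] = 1%E /\
  forall (Q : 'M[R]_d) (B : set (borel_cV d)),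
    Q^T *m Q = 1%:M -> measurable B ->
    P [set w | B (Q *m u w)] = P [set w | B (u w)].

Definition without_replacement n b (i : T -> b.-tuple 'I_n) : Prop :=
  forall t : b.-tuple 'I_n,
    P [set w | i w = t] = (if uniq t then ((n ^_ b)%:R^-1)%:E else 0)%E.

Section draws.
Variables (n d b : nat).
Variables (omega : nat -> T -> bool) (S : nat -> T -> {fset 'I_n * 'cV[R]_d}).
Variables (I : nat -> T -> b.-tuple 'I_n) (U : nat -> T -> b.-tuple 'cV[R]_d).

(* Indices are read in nat, which carries the discrete sigma-algebra. *)
Definition draw (k : nat) (w : T) :
    bool * random_fset n d * b.-tuple nat * b.-tuple (borel_cV d) :=
  (omega k w, S k w, map_tuple val (I k w), U k w).

Definition past_draws (k : nat) (w : T) := [tuple draw j w | j < k].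

Definition draws_independent : Prop :=
  forall k, independent (draw k) (past_draws k).

(* (draw k w).1.2 is the tuple of sampled indices, (draw k w).2 the tuple of
   sampled directions. *)
Definition batch_sampling : Prop :=
  [/\ forall k, without_replacement (I k),
      forall k, independent (fun w => (draw k w).1.2) (fun w => (draw k w).2),
      forall k, mutually_independent
        (fun r w => tnth (U k w) r : borel_cV d)
    & (forall k r, uniform_basis (fun w => tnth (U k w) r)) \/
      (forall k r, uniform_sphere (fun w => tnth (U k w) r)) ].

Definition Pop (s : {fset 'I_n * 'cV[R]_d}) (A : 'M[R]_(d, n)) : 'M[R]_(d, n) :=
  \sum_(p <- s) p.2 *m p.2^T *m A *m
    (delta_mx p.1 0 : 'cV[R]_n) *m (delta_mx 0 p.1 : 'rV[R]_n).

Definition orthonormal_slices (s : {fset 'I_n * 'cV[R]_d}) : Prop :=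
  forall i u v, (i, u) \in s -> (i, v) \in s ->
    (u^T *m v) 0 0 = (u == v)%:R.

Definition sampling_assumption (sigma : R) : Prop :=
  [/\ iid (fun k w => (S k w : random_fset n d, omega k w)),
      forall k, {ae P, forall w, orthonormal_slices (S k w)},
      0 < sigma < 1
    & forall k (A : 'M[R]_(d, n)) a i,
        ('E_P[fun w => ((omega k w)%:R *: Pop (S k w) A)%R a i]
         = (sigma * A a i)%:E)%E ].

(* Defined from iteration 0; by iid the value is the same at every iteration. *)
Definition mean_size : R :=
  fine 'E_P[fun w => ((omega 0%N w)%:R * (#|` S 0%N w|)%:R)%R]%E.

End draws.
End random_elements.

Section algorithm.
Context {R : realType} {T : Type}.
Variables (n d b : nat).
Variables (f : 'I_n -> 'cV[R]_d -> R) (psi : 'cV[R]_d -> \bar R).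
Variables (alpha : R) (beta : nat -> R).
Variables (x0 : 'cV[R]_d) (J0 : 'M[R]_(d, n)).
Variables (omega : nat -> T -> bool) (S : nat -> T -> {fset 'I_n * 'cV[R]_d}).
Variables (I : nat -> T -> b.-tuple 'I_n) (U : nat -> T -> b.-tuple 'cV[R]_d).

Definition zo_grad (u : 'cV[R]_d) (g : 'cV[R]_d -> R) (x : 'cV[R]_d) (be : R) :
    'cV[R]_d :=
  ((g (x + be *: u) - g x) / be) *: u.

Definition correction (x : 'cV[R]_d) (J : 'M[R]_(d, n)) (be : R)
    (p : 'I_n * 'cV[R]_d) : 'cV[R]_d :=
  zo_grad p.2 (f p.1) x be - p.2 *m p.2^T *m col p.1 J.

(* The sum over the set {(i^r, u^r)} is indexed by r: sampling is without
   replacement, so the pairs are almost surely distinct. *)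
Definition gstep (x : 'cV[R]_d) (J : 'M[R]_(d, n)) (be : R)
    (i : b.-tuple 'I_n) (u : b.-tuple 'cV[R]_d) : 'cV[R]_d :=
  n%:R^-1 *: (J *m const_mx 1) +
  (d%:R / b%:R) *: \sum_(r < b) correction x J be (tnth i r, tnth u r).

Definition Jstep (x : 'cV[R]_d) (J : 'M[R]_(d, n)) (be : R)
    (om : bool) (s : {fset 'I_n * 'cV[R]_d}) : 'M[R]_(d, n) :=
  J + om%:R *: \sum_(p <- s) correction x J be p *m (delta_mx 0 p.1 : 'rV[R]_n).

Fixpoint iterate (k : nat) (w : T) : 'cV[R]_d * 'M[R]_(d, n) :=
  if k is j.+1 then
    let: (x, J) := iterate j w in
    (prox alpha psi (x - alpha *: gstep x J (beta j) (I j w) (U j w)),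
     Jstep x J (beta j) (omega j w) (S j w))
  else (x0, J0).

Definition xiter (k : nat) (w : T) : 'cV[R]_d := (iterate k w).1.

End algorithm.

(* Main.v *)
(* Let xs be the minimizer, D = 36d + R, c = 8dR / (L^2 n sigma D^2) and
   V(x, J) = |x - xs|^2 + c |J - grad F(xs)|^2. One iteration from a fixed state
   satisfies E V(x+, J+) <= (1 - kappa) V(x, J) + C1(beta), and independence of
   the draws lets this be iterated.
   Since xs = prox(xs - alpha grad f(xs)), nonexpansiveness gives
   |x+ - xs| <= |x - xs - alpha (g - grad f(xs))|. The estimator g splits into a
   part linear in the matrices u u^T, unbiased for grad f(x), and a
   finite-difference error whose coefficient along each unit vector u lies in
   [0, L beta / 2] by convexity and smoothness. The variance of the linear part
   is controlled since draws without replacement are negatively correlated.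
   For J, orthonormality of the slices of S gives, with B = J - grad F(xs) and
   H = grad F(x) - grad F(xs), E |J+ - grad F(xs)|^2 <= (1 - sigma) |B|^2
   + 2 sigma |H|^2 + L^2 beta^2 nu / 2. Cocoercivity bounds |H|^2 by 2 L n times
   the Bregman divergence of f, which the term -2 alpha <grad f(x) - grad f(xs),
   x - xs> absorbs. *)
Require Import Defs.
From HB Require Import structures.
From mathcomp Require Import all_boot all_order all_fingroup all_algebra finmap.
From mathcomp Require Import lra.
From mathcomp Require Import all_classical all_reals all_analysis measurable_realfun.
Set Implicit Arguments.
Unset Strict Implicit.
Unset Printing Implicit Defensive.
Import Order.TTheory GRing.Theory Num.Theory.
Import numFieldNormedType.Exports.
Local Open Scope classical_set_scope.
Local Open Scope ring_scope.

(** * Frobenius inner product and gradients *)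

(** The constants come from one balance. A finite-difference error is correlated with its u, so it
    is bounded path by path: Young's inequality with weight mu costs alpha mu/2 |x - xs|^2 on
    average, half of the contraction alpha mu due to strong convexity; the other half is the first
    entry of kappa. The weight satisfies c sigma = 32 alpha^2 d / (R n), so the variance of g
    returns only (c sigma / 8) |B|^2 to the J-part, which loses c sigma |B|^2. The Bregman terms add
    up to alpha^2 L (4 + 136 d/R); since alpha L = R / (2D), this is 2 alpha (R + 34d) / D, below
    the available 2 alpha because D = R + 36d. The formal weight lies on measurability. Freezing the
    state, or the sampled indices, replaces conditional expectation and is Tonelli's theorem for
    nonnegative gaps. It requires each iteration to be jointly measurable in state and draw: this
    includes sums over a random finite set known only through its counts, and the prox, which exists
    by completeness and is Borel by nonexpansiveness. *)

Section inner_product.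
Context {R : realType}.

(** Squared norms are written [dot A A]: [dotE] expands them, and what remains is linear in inner
    products, within reach of [lra]. *)
Definition dot m p (A B : 'M[R]_(m, p)) : R := \sum_i \sum_j A i j * B i j.

Section theory.
Variables m p : nat.
Implicit Types (A B C : 'M[R]_(m, p)) (k : R).

Lemma dotC A B : dot A B = dot B A.
Proof. by apply: eq_bigr => i _; apply: eq_bigr => j _; rewrite mulrC. Qed.

Lemma dotDl A B C : dot (A + B) C = dot A C + dot B C.
Proof.
rewrite -big_split/=; apply: eq_bigr => i _; rewrite -big_split/=.
by apply: eq_bigr => j _; rewrite mxE mulrDl.
Qed.

Lemma dotZl k A B : dot (k *: A) B = k * dot A B.
Proof.
rewrite mulr_sumr; apply: eq_bigr => i _; rewrite mulr_sumr.
by apply: eq_bigr => j _; rewrite mxE mulrA.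
Qed.

Lemma dotNl A B : dot (- A) B = - dot A B.
Proof. by rewrite -scaleN1r dotZl mulN1r. Qed.

Lemma dotDr A B C : dot A (B + C) = dot A B + dot A C.
Proof. by rewrite dotC dotDl !(dotC A). Qed.

Lemma dotZr k A B : dot A (k *: B) = k * dot A B.
Proof. by rewrite dotC dotZl dotC. Qed.

Lemma dotNr A B : dot A (- B) = - dot A B.
Proof. by rewrite dotC dotNl dotC. Qed.

Definition dotE := (dotDl, dotDr, dotNl, dotNr, dotZl, dotZr).

Lemma dot0l A : dot 0 A = 0.
Proof. by rewrite -(scale0r 0) dotZl mul0r. Qed.

Lemma dot0r A : dot A 0 = 0.
Proof. by rewrite dotC dot0l. Qed.

Lemma dot_suml (I : Type) (r : seq I) (Q : pred I) (F : I -> 'M[R]_(m, p)) B :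
  dot (\sum_(i <- r | Q i) F i) B = \sum_(i <- r | Q i) dot (F i) B.
Proof. by elim/big_rec2: _ => [|i y z _ <-]; rewrite ?dot0l ?dotDl. Qed.

Lemma dot_sumr (I : Type) (r : seq I) (Q : pred I) (F : I -> 'M[R]_(m, p)) B :
  dot B (\sum_(i <- r | Q i) F i) = \sum_(i <- r | Q i) dot B (F i).
Proof. by rewrite dotC dot_suml; apply: eq_bigr => i _; rewrite dotC. Qed.

Lemma dot_ge0 A : 0 <= dot A A.
Proof. by do 2 apply: sumr_ge0 => ? _; rewrite -expr2 sqr_ge0. Qed.

Lemma fnorm2 A : fnorm A ^+ 2 = dot A A.
Proof.
rewrite sqr_sqrtr.
  by apply: eq_bigr => i _; apply: eq_bigr => j _; rewrite expr2.
by do 2 apply: sumr_ge0 => ? _; rewrite sqr_ge0.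
Qed.

Lemma fnorm_ge0 A : 0 <= fnorm A.
Proof. exact: sqrtr_ge0. Qed.

Lemma coord_le_dot A i j : A i j ^+ 2 <= dot A A.
Proof.
rewrite /dot (bigD1 i)//= (bigD1 j)//= -expr2 -addrA lerDl.
rewrite addr_ge0//; first by apply: sumr_ge0 => ? _; rewrite -expr2 sqr_ge0.
by do 2 apply: sumr_ge0 => ? _; rewrite -expr2 sqr_ge0.
Qed.

Lemma dot_eq0 A : dot A A = 0 -> A = 0.
Proof.
move=> A0; apply/matrixP => i j; rewrite mxE; apply/eqP.
by rewrite -sqrf_eq0 eq_le sqr_ge0 andbT -A0 coord_le_dot.
Qed.

Lemma dot_CS A B : dot A B ^+ 2 <= dot A A * dot B B.
Proof.
have [B0|B0] := eqVneq (dot B B) 0.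
  by rewrite (dot_eq0 B0) !dot0r mulr0 expr0n.
have Bp : 0 < dot B B by rewrite lt_def B0 dot_ge0.
have := dot_ge0 (dot B B *: A - dot A B *: B); rewrite !dotE (dotC B A) => H.
rewrite -(ler_pM2l Bp); lra.
Qed.

Lemma dot_le_fnorm A B : dot A B <= fnorm A * fnorm B.
Proof.
have [AB0|AB0] := leP (dot A B) 0.
  by rewrite (le_trans AB0)// mulr_ge0 ?fnorm_ge0.
rewrite -(ler_pXn2r (n := 2))// ?nnegrE ?(ltW AB0) ?mulr_ge0 ?fnorm_ge0//.
by rewrite exprMn !fnorm2 dot_CS.
Qed.

Lemma dotD2_le A B : dot (A + B) (A + B) <= 2 * dot A A + 2 * dot B B.
Proof. have := dot_ge0 (A - B); rewrite !dotE (dotC B A); lra. Qed.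

End theory.

Lemma dot_delta d (a : 'cV[R]_d) (j : 'I_d) : dot a (delta_mx j 0) = a j 0.
Proof.
rewrite /dot (bigD1 j)//= big_ord1 mxE !eqxx mulr1 big1 ?addr0// => i ij.
by rewrite big_ord1 mxE (negbTE ij) mulr0.
Qed.

Lemma dot_cV d (a b : 'cV[R]_d) : dot a b = \sum_i a i 0 * b i 0.
Proof. by apply: eq_bigr => i _; rewrite big_ord1. Qed.

Lemma mulmxTcV d (a b : 'cV[R]_d) : a^T *m b = (dot a b)%:M.
Proof.
apply/matrixP => i j; rewrite !ord1 !mxE eqxx mulr1n dot_cV.
by apply: eq_bigr => k _; rewrite mxE.
Qed.

Lemma mulmx_outer d (u a : 'cV[R]_d) : u *m u^T *m a = dot u a *: u.
Proof. by rewrite -mulmxA mulmxTcV mul_mx_scalar. Qed.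

Lemma dot_cols d n (A B : 'M[R]_(d, n)) :
  dot A B = \sum_i dot (col i A) (col i B).
Proof.
rewrite /dot exchange_big/=; apply: eq_bigr => i _; apply: eq_bigr => j _.
by rewrite big_ord1 !mxE.
Qed.

End inner_product.

(** * Directional derivatives and the descent lemma *)

Section calculus.
Context {R : realType} {d : nat}.
Implicit Types (f : 'cV[R]_d -> R) (x y v : 'cV[R]_d) (L mu : R).

Lemma derive_grad f x v : differentiable f x -> 'D_v f x = dot (grad f x) v.
Proof.
move=> df; rewrite deriveE// [v in LHS]matrix_sum_delta dot_cV.
rewrite linear_sum/=; apply: eq_bigr => i _; rewrite big_ord1 linearZ/=.
by rewrite mxE -deriveE// mulrC.
Qed.

Lemma is_derive_line f x v (t : R) : differentiable f (x + t *: v) ->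
  is_derive t 1 (fun s => f (x + s *: v)) (dot (grad f (x + t *: v)) v).
Proof.
(* The difference quotient at t along 1 of the restriction to the line is that of [f] at x + t v
   along v. *)
move=> df; have E : (fun h : R => h^-1 *: (f (x + (h *: 1 + t) *: v)
      - f (x + t *: v))) =
    (fun h : R => h^-1 *: (f (h *: v + (x + t *: v)) - f (x + t *: v))).
  apply/funext => h; congr (_ *: (f _ - _)).
  by rewrite scalerDl /GRing.scale/= mulr1 addrCA.
split.
  rewrite /derivable/=; have := diff_derivable (v := v) df.
  by rewrite /derivable/= => dv; rewrite E.
by rewrite -derive_grad// /derive/= E.
Qed.

(** Descent lemma. Subtracting from f(x + t v) its linear part and L/2 |v|^2 t^2 leaves a function
    of t with nonpositive derivative on ]0, 1[, by Cauchy-Schwarz and the Lipschitz bound. The mean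
    value theorem then concludes without integrating the gradient. *)
Lemma smooth_upper f L x v : 0 <= L -> (forall y, differentiable f y) ->
  smooth L f -> f (x + v) <= f x + dot (grad f x) v + L / 2 * dot v v.
Proof.
move=> L0 df sf.
pose g (t : R) := f (x + t *: v) - t * dot (grad f x) v - L / 2 * dot v v * t ^+ 2.
pose dg t := dot (grad f (x + t *: v)) v - dot (grad f x) v
  - L / 2 * dot v v * (2 * t).
have gdg (t : R) : is_derive t 1 g (dg t).
  have ? := is_derive_line (df (x + t *: v)).
  apply: is_derive_eq.
  rewrite /dg !scaler0 !add0r /GRing.scale/= !mulr1; lra.
have [c /[!in_itv]/= /andP[c0 c1]] : exists2 c, c \in `]0, 1[ &
    g 1 - g 0 = dg c * (1 - 0).
  apply: MVT; rewrite ?ltr01// => t.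
  apply: continuous_subspaceT => u; apply: differentiable_continuous.
  by apply/derivable1_diffP; case: (gdg u).
have : dg c <= 0.
  have : dot (grad f (x + c *: v) - grad f x) v <= L * c * dot v v.
    apply: le_trans (dot_le_fnorm _ _) _.
    have := sf (x + c *: v) x; rewrite addrAC subrr add0r => H.
    apply: le_trans (ler_wpM2r (fnorm_ge0 _) H) _.
    have -> : fnorm (c *: v) = c * fnorm v.
      rewrite -[LHS]ger0_norm ?fnorm_ge0// -sqrtr_sqr fnorm2 dotZl dotZr.
      by rewrite mulrA -expr2 -fnorm2 -exprMn sqrtr_sqr ger0_norm// mulr_ge0// ?fnorm_ge0// ltW.
    by rewrite -fnorm2; lra.
  by rewrite /dg !dotE; lra.
rewrite /g scale1r scale0r addr0; lra.
Qed.

End calculus.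

(** * Convexity and proximal maps *)

Section convexity.
Context {R : realType} {d : nat}.
Implicit Types (f : 'cV[R]_d -> R) (x y v : 'cV[R]_d) (L mu : R).

(** Stands in for the limit t -> 0 in the three first-order arguments that divide a convexity
    inequality by t. *)
Lemma ge0_of_linear_lower (C Q : R) :
  (forall t, 0 < t <= 1 -> - (C * t) <= Q) -> 0 <= Q.
Proof.
move=> H; rewrite leNgt; apply/negP => Q0.
have C0 : 0 < C by have := H 1; rewrite lexx ltr01 mulr1 => /(_ isT); lra.
(* At t = -Q / (2C) the bound -C t equals Q / 2, which exceeds Q. If this t is larger than 1, then t
   = 1 already gives the contradiction. *)
have [t1|t1] := leP (- Q / (2 * C)) 1.
  have t0 : 0 < - Q / (2 * C) by rewrite divr_gt0 ?oppr_gt0// mulr_gt0.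
  have := H (- Q / (2 * C)); rewrite t0 t1 => /(_ isT).
  rewrite mulrCA invfM [C * _]mulrCA mulfV ?gt_eqF// mulr1; lra.
have : 2 * C < - Q by move: t1; rewrite ltr_pdivlMr ?mulr_gt0// mul1r.
have := H 1; rewrite lexx ltr01 mulr1 => /(_ isT); lra.
Qed.

(** 3/2 is 1/2 + 1: the descent lemma from x + v back to x, then the exchange of grad f(x + v) for
    grad f(x) at the cost of L |v|^2. The size of the constant is immaterial, since
    [strongly_convex_lower] removes it. *)
Lemma smooth_lower_weak f L x v : 0 <= L -> (forall y, differentiable f y) ->
  smooth L f -> f x + dot (grad f x) v - 3 / 2 * L * dot v v <= f (x + v).
Proof.
move=> L0 df sf.
have := smooth_upper (x + v) (- v) L0 df sf; rewrite addrK !dotE opprK.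
have : dot (grad f x - grad f (x + v)) v <= L * dot v v.
  apply: le_trans (dot_le_fnorm _ _) _; rewrite -fnorm2 expr2 mulrA.
  apply: ler_wpM2r; first exact: fnorm_ge0.
  apply: le_trans (sf _ _) _; rewrite opprD addNKr.
  by rewrite -[fnorm (- v)]ger0_norm ?fnorm_ge0// -sqrtr_sqr fnorm2 dotNl dotNr
    opprK -fnorm2 sqrtr_sqr ger0_norm ?fnorm_ge0.
rewrite !dotE; lra.
Qed.

(** Along t v the error C t^2 |v|^2 is of second order, so it disappears after division by t. [g] is
    not tied to [grad], which lets the lemma serve each f_i as well as their average. *)
Lemma strongly_convex_lower f mu (g : 'cV[R]_d) x v C :
  (forall v, f x + dot g v - C * dot v v <= f (x + v)) ->
  strongly_convex mu f ->
  f x + dot g v + mu / 2 * dot v v <= f (x + v).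
Proof.
move=> low cvx; rewrite -subr_ge0.
apply: (@ge0_of_linear_lower ((C + mu / 2) * dot v v)) => t /andP[t0 t1].
have := low (t *: v); have := cvx (x + v) x t; rewrite t1 ltW// => /(_ isT).
have -> : t *: (x + v) + (1 - t) *: x = x + t *: v.
  by rewrite scalerDr scalerBl scale1r [_ - _]addrC addrACA subrr add0r addrC.
rewrite [x + v - x]addrAC subrr add0r fnorm2 !dotE => H1 H2.
rewrite -(ler_pM2l t0); lra.
Qed.

Lemma convex_strongly_convex0 f : convex_function setT f -> strongly_convex 0 f.
Proof.
move=> cf x y t t01.
have /andP[t0 t1] := t01.
have := cf (Itv01 t0 t1) x y; rewrite !in_setT => /(_ isT isT).
rewrite mul0r !mul0r subr0; exact.
Qed.

Lemma cocoercive f L x y : 0 < L -> (forall y, differentiable f y) ->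
  smooth L f -> strongly_convex 0 f ->
  dot (grad f x - grad f y) (grad f x - grad f y) <=
  2 * L * (f x - f y - dot (grad f y) (x - y)).
Proof.
move=> L0 df sf cf; have [h hE] : exists h, h = grad f x - grad f y by exists (grad f x - grad f y).
rewrite -hE.
(* Both bounds are taken at x - h / L: the descent lemma around x bounds f there from above,
   convexity around y bounds it from below. *)
have := smooth_upper x (- L^-1 *: h) (ltW L0) df sf.
have := strongly_convex_lower (x - y - L^-1 *: h)
  (fun v => smooth_lower_weak y v (ltW L0) df sf) cf.
rewrite addrA [y + _]addrC subrK scaleNr !dotE => H1 H2.
have E : dot (grad f x) h = dot h h + dot (grad f y) h.
  by rewrite -dotDl hE subrK.
rewrite E in H2.
have {}H2 : f (x - L^-1 *: h) <= f x - L^-1 * dot (grad f y) h - L^-1 * dot h h / 2.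
  have LL : L * (L^-1 * (L^-1 * dot h h)) = L^-1 * dot h h.
    by rewrite mulVKf ?gt_eqF.
  by move: H2; rewrite !opprK; lra.
have {H1 H2} : L^-1 * dot h h <= 2 * (f x - f y - dot (grad f y) (x - y)).
  by rewrite !dotE; lra.
move=> /(ler_wpM2l (ltW L0)); rewrite mulVKf ?gt_eqF// !dotE; lra.
Qed.

End convexity.

Section topology.
Context {R : realType}.

Lemma cvg_dot {T : Type} {F : set_system T} {FF : Filter F} m p
    (g h : T -> 'M[R]_(m, p)) (a b : 'M[R]_(m, p)) :
  (forall i j, (fun t => g t i j) @ F --> a i j) ->
  (forall i j, (fun t => h t i j) @ F --> b i j) ->
  (fun t => dot (g t) (h t)) @ F --> dot a b.
Proof.
by move=> ga hb; apply: cvg_big => [|i _]; [exact: add_continuous|];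
  apply: cvg_big => [|j _]; [exact: add_continuous|]; apply: cvgM.
Qed.

Lemma cvg_coord {T : Type} {F : set_system T} {FF : Filter F} m p
    (g : T -> 'M[R]_(m, p)) (a : 'M[R]_(m, p)) :
  g @ F --> a -> forall i j, (fun t => g t i j) @ F --> a i j.
Proof. move=> ga i j; have := cvg_comp _ _ ga (@coord_continuous R m p i j a); exact. Qed.

Lemma normr_le_fnorm m p (A : 'M[R]_(m, p)) : `|A| <= fnorm A.
Proof.
rewrite [leLHS]/Num.norm/= mx_normrE; apply/bigmax_leP; split=> [|ij _].
  exact: fnorm_ge0.
rewrite -(ler_pXn2r (n := 2))// ?nnegrE ?fnorm_ge0//.
by rewrite real_normK ?num_real// fnorm2 coord_le_dot.
Qed.

End topology.

(* [prox_vi al psi z y] is the variational inequality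
   (z - y) / al \in \partial psi(y) characterizing y = prox(z). *)
Definition prox_vi (R : realType) d (al : R) (psi : 'cV[R]_d -> \bar R)
    (z y : 'cV[R]_d) : Prop :=
  exists2 p, psi y = p%:E &
    forall v q, psi v = q%:E -> p + al^-1 * dot (z - y) (v - y) <= q.

(** Each inequality is tested at the other solution; their sum is <z1 - z2 - (y1 - y2), y1 - y2> >=
    0. Speaking of solutions rather than of [prox] allows a comparison with [xstar] without
    uniqueness of minimizers. *)
Lemma prox_vi_nonexpansive (R : realType) d (al : R) (psi : 'cV[R]_d -> \bar R)
    (z1 z2 y1 y2 : 'cV[R]_d) : 0 < al ->
  prox_vi al psi z1 y1 -> prox_vi al psi z2 y2 ->
  dot (y1 - y2) (y1 - y2) <= dot (z1 - z2) (z1 - z2).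
Proof.
move=> al0 [p1 E1 H1] [p2 E2 H2].
have {}H1 := H1 _ _ E2; have {}H2 := H2 _ _ E1.
have : al^-1 * (dot (z1 - y1) (y2 - y1) + dot (z2 - y2) (y1 - y2)) <= 0 by lra.
rewrite pmulr_rle0 ?invr_gt0// => H.
have := dot_ge0 (z1 - z2 - (y1 - y2)); move: H; rewrite !dotE.
rewrite (dotC y2 y1) (dotC z2 z1) (dotC z1 y1) (dotC z1 y2) (dotC z2 y1) (dotC z2 y2).
lra.
Qed.

(** * Existence and first-order condition of the proximal point *)

Section prox.
Context {R : realType} {d : nat}.
Variables (psi : 'cV[R]_d -> \bar R) (al c : R) (a : 'cV[R]_d).
Hypotheses (al0 : 0 < al) (psi_proper : eproper psi) (psi_convex : econvex psi)
  (psi_lsc : lower_semicontinuous psi)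
  (psi_minorant : forall y, ((c + dot a y)%:E <= psi y)%E).

Let q (z y : 'cV[R]_d) : R := 2^-1 * dot (z - y) (z - y).
Let phi z y := ((q z y)%:E + al%:E * psi y)%E.

Let prox_phi z : prox al psi z = get (argmin (phi z)).
Proof. by congr (get (argmin _)); apply/funext => y; rewrite fnorm2. Qed.

Lemma econvex_real x y t p1 p2 : 0 <= t <= 1 -> psi x = p1%:E -> psi y = p2%:E ->
  exists2 p, psi (t *: x + (1 - t) *: y) = p%:E & p <= t * p1 + (1 - t) * p2.
Proof.
move=> t01 E1 E2; have := psi_convex x y t01; rewrite E1 E2.
have := psi_minorant (t *: x + (1 - t) *: y).
case: (psi _) => [r| |]//=; rewrite -!EFinM -EFinD ?lee_fin ?leye_eq//.
by move=> _ H; exists r.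
Qed.

Let phi_fin z y r : phi z y = r%:E -> exists2 p, psi y = p%:E & r = q z y + al * p.
Proof.
rewrite /phi; have := psi_minorant y.
case: (psi y) => [p| |]//= _; rewrite ?gt0_muley ?lte_fin// => -[<-].
by exists p.
Qed.

Let phi_lb z : exists r, forall y, (r%:E <= phi z y)%E.
Proof.
(* The minimum over y of the quadratic plus al times the affine minorant, attained at y = z - al
   a. *)
exists (al * c + al * dot a z - al ^+ 2 * dot a a / 2) => y.
apply: (@le_trans _ _ ((q z y)%:E + al%:E * (c + dot a y)%:E)%E); last first.
  by rewrite leeD2l// lee_pmul2l// ?lte_fin.
rewrite -EFinM -EFinD lee_fin /q.
have := dot_ge0 (z - y - al *: a); rewrite !dotE.
rewrite (dotC z a) (dotC y a); lra.
Qed.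

(** The quadratic is 1-strongly convex: at the midpoint the objective is at most the mean of r1 and
    r2 minus |y1 - y2|^2 / 8, and at least r. Near-minimizers are therefore close to each other. *)
Let phi_mid z y1 y2 r r1 r2 : (forall y, (r%:E <= phi z y)%E) ->
  phi z y1 = r1%:E -> phi z y2 = r2%:E ->
  dot (y1 - y2) (y1 - y2) <= 4 * (r1 + r2 - 2 * r).
Proof.
move=> rmin /phi_fin[p1 E1 ->] /phi_fin[p2 E2 ->].
have [|p E pp] := @econvex_real y1 y2 2^-1 _ _ _ E1 E2; first by lra.
have := rmin (2^-1 *: y1 + (1 - 2^-1) *: y2).
rewrite /phi E -EFinM -EFinD lee_fin /q !dotE.
rewrite (dotC z y1) (dotC y2 y1) (dotC z y2) => H.
have := ler_wpM2l (ltW al0) pp; lra.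
Qed.

(** By [phi_mid] a minimizing sequence is Cauchy, and lower semicontinuity makes its limit a
    minimizer. *)
Lemma argmin_prox z : exists y, argmin (phi z) y.
Proof.
have [r0 r0lb] := phi_lb z.
pose m := ereal_inf (range (phi z)).
have [y0 y0oo] := psi_proper.2.
have [p0 E0] : exists p, psi y0 = p%:E.
  by move: y0oo (psi_proper.1 y0); case: (psi y0) => [p| |]// _ _; exists p.
have mlo : (r0%:E <= m)%E by apply/ereal_infP => _ [y _ <-].
have mhi : (m <= (q z y0 + al * p0)%:E)%E.
  by apply: ereal_inf_lbound; exists y0 => //; rewrite /phi E0.
have [r mE] : exists r, m = r%:E.
  by move: mlo mhi; case: m => [r| |]//; exists r.
have rlb y : (r%:E <= phi z y)%E by rewrite -mE; apply: ereal_inf_lbound; exists y.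
have /choice[u uP] (k : nat) : exists y, exists2 s, phi z y = s%:E & s < r + k.+1%:R^-1.
  have : (ereal_inf (range (phi z)) < (r + k.+1%:R^-1)%:E)%E.
    by rewrite -/m mE lte_fin ltrDl.
  move=> /ereal_inf_lt[_ [y _ <-]] lty; exists y.
  move: lty (rlb y); case: (phi z y) => [s| |]//; rewrite lte_fin => ? _.
  by exists s.
have uC k l : dot (u k - u l) (u k - u l) <= 4 * (k.+1%:R^-1 + l.+1%:R^-1).
  have [s1 F1 s1r] := uP k; have [s2 F2 s2r] := uP l.
  apply: le_trans (phi_mid rlb F1 F2) _.
  by move: (k.+1%:R^-1) (l.+1%:R^-1) s1r s2r => ? ?; lra.
have ucvg : cvg (u @ \oo).
  apply/cauchy_cvgP/cauchy_ballP => e e0; rewrite near_map2.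
  (* With both reciprocals below e^2 / 8, [uC] bounds the squared distance by 4 (e^2/8 + e^2/8) =
     e^2. *)
  have e8 : 0 < e ^+ 2 / 8 by rewrite divr_gt0// exprn_gt0.
  near=> k l.
  rewrite -ball_normE/=; apply: le_lt_trans (normr_le_fnorm _) _.
  rewrite -(ltr_pXn2r (n := 2))// ?nnegrE ?fnorm_ge0 ?ltW// fnorm2.
  apply: le_lt_trans (uC _ _) _.
  have : k.+1%:R^-1 < e ^+ 2 / 8.
    by near: k; exact: near_infty_natSinv_lt (PosNum e8).
  have : l.+1%:R^-1 < e ^+ 2 / 8.
    by near: l; exact: near_infty_natSinv_lt (PosNum e8).
  by move: (k.+1%:R^-1) (l.+1%:R^-1) => ? ?; lra.
have /cvg_ex[y uy] := ucvg.
exists y => y'; apply: le_trans (rlb y'); rewrite leNgt; apply/negP => ry.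
(* Lower semicontinuity speaks of real levels b < psi(y), so a level is chosen that keeps the
   objective above r. When psi(y) = +oo it is the one at which the objective would be r + 1. *)
have [b bpsi rb] : exists2 b, (b%:E < psi y)%E & r < q z y + al * b.
  move: ry; rewrite /phi; have := psi_proper.1 y.
  case: (psi y) => [p| |]//= _.
    rewrite -EFinM -EFinD lte_fin => ry.
    exists (p - (q z y + al * p - r) / (2 * al)).
      by rewrite lte_fin ltrBlDr ltrDl divr_gt0 ?mulr_gt0// subr_gt0.
    rewrite mulrBr invfM mulrCA [al * (_ * _)]mulrCA mulfV ?gt_eqF// mulr1; lra.
  move=> _; exists ((r + 1 - q z y) / al); first by rewrite ltry.
  rewrite mulrCA mulfV ?gt_eqF//; lra.
have [V nV Vpsi] := psi_lsc bpsi.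
(* Half of the gap: near y the objective exceeds q z y - e + al b = r + e, whereas the minimizing
   sequence ends up below r + e. *)
pose e := (q z y + al * b - r) / 2.
have e0 : 0 < e by rewrite /e; lra.
have qy : (fun k => q z (u k)) @ \oo --> q z y.
  apply: cvgM; first exact: cvg_cst.
  have H i j : (fun k => (z - u k) i j) @ \oo --> (z - y) i j.
    rewrite mxE [X in _ --> _ + X]mxE.
    have -> : (fun k => (z - u k) i j) = (fun k : nat => z i j - u k i j).
      by apply/funext => k; rewrite !mxE.
    by apply: cvgB; [exact: cvg_cst|exact: cvg_coord].
  exact: cvg_dot.
have [k [kV kq ke]] : exists k, [/\ V (u k), q z y - e < q z (u k) &
    k.+1%:R^-1 < e].
  have : \forall k \near \oo, [/\ V (u k), q z y - e < q z (u k) &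
    k.+1%:R^-1 < e].
    near=> k; split; near: k.
    - exact: uy.
    - by apply: (cvgr_gt (q z y)) => //; rewrite ltrBlDr ltrDl.
    - exact: near_infty_natSinv_lt (PosNum e0).
  by move=> /filter_ex.
have [s /phi_fin[p Ep ->] sr] := uP k.
have := Vpsi _ kV; rewrite Ep lte_fin -(ltr_pM2l al0).
by move: (k.+1%:R^-1) sr kq ke; rewrite /e => ?; lra.
Unshelve. all: by end_near. Qed.

(** [prox] is a [get], to which [argmin_prox] gives meaning. The inequality is the first-order
    condition along y + t (v - y); the constant |v - y|^2 / (2 al) below is its t^2 term. *)
Lemma proxP z : prox_vi al psi z (prox al psi z).
Proof.
rewrite prox_phi; have /(@getPex _ (argmin (phi z))) := argmin_prox z.
move: (get _) => y ymin.
have [p Ep] : exists p, psi y = p%:E.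
  have [y0 y0oo] := psi_proper.2.
  move: y0oo (psi_proper.1 y0) (psi_proper.1 y) (ymin y0); rewrite /phi.
  case: (psi y0) => [p0| |]// _ _.
  case: (psi y) => [p| |]// _; first by exists p.
  by rewrite gt0_muley ?lte_fin.
exists p => // v p' Ev.
rewrite -subr_ge0.
apply: (@ge0_of_linear_lower _ (al^-1 * dot (v - y) (v - y) / 2)) => t /andP[t0 t1].
have t01 : 0 <= t <= 1 by rewrite ltW.
have [p2 E2 p2le] := econvex_real t01 Ev Ep.
have := ymin (t *: v + (1 - t) *: y); rewrite /phi Ep E2 -!EFinM -!EFinD lee_fin.
have -> : t *: v + (1 - t) *: y = y + t *: (v - y).
  by rewrite scalerBl scale1r scalerBr addrCA.
move: (v - y) => w; rewrite /q opprD addrA !dotE (dotC w z) (dotC w y) => H.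
have {p2le} := ler_wpM2l (ltW al0) p2le => H2.
rewrite -(ler_pM2l t0) -(ler_pM2l al0).
have alE X : al * (al^-1 * X) = X by rewrite mulrA mulfV ?gt_eqF// mul1r.
have -> : al * (t * - (al^-1 * dot w w / 2 * t)) = - (dot w w / 2 * t * t).
  by rewrite -[in RHS](alE (dot w w)); lra.
have -> : al * (t * (p' - (p + al^-1 * (dot z w - dot y w)))) =
   t * (al * (p' - p) - (dot z w - dot y w)).
  by rewrite -[in RHS](alE (dot z w - dot y w)); lra.
lra.
Qed.

Lemma prox_nonexpansive z1 z2 :
  dot (prox al psi z1 - prox al psi z2) (prox al psi z1 - prox al psi z2)
  <= dot (z1 - z2) (z1 - z2).
Proof. by apply: prox_vi_nonexpansive al0 _ _; exact: proxP. Qed.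

End prox.

(** * Measurability *)

Section borel_matrices.
Context {R : realType}.

(** [borel_mx d 1] unfolds to [borel_cV d], so directions, points and Jacobian estimates live in one
    family of Borel spaces. *)
Definition borel_mx m p := g_sigma_algebraType (@open 'M[R]_(m, p)).

Lemma continuous_borel_measurable m p (h : 'M[R]_(m, p) -> R) :
  continuous h -> measurable_fun setT (h : borel_mx m p -> R).
Proof.
move=> ch; apply: (measurability _ (RGenOpens.measurableE R)).
move=> _ [_ [a [b ->] <-]]; rewrite setTI; apply: sub_sigma_algebra.
by move/continuousP : ch; apply; exact: interval_open.
Qed.

Lemma measurable_coord m p i j :
  measurable_fun setT (fun A : borel_mx m p => A i j).
Proof. by apply: continuous_borel_measurable => A; exact: coord_continuous. Qed.

Lemma measurable_bigcup_countType d (T : measurableType d) (I : countType)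
    (Q : I -> Prop) (F : I -> set T) :
  (forall i, measurable (F i)) -> measurable (\bigcup_(i in Q) F i).
Proof.
move=> mF; rewrite (_ : \bigcup_(i in Q) F i = \bigcup_k
    (if @choice.unpickle I k is Some i then if `[< Q i >] then F i else set0 else set0)).
  apply: bigcupT_measurable => k; case: choice.unpickle => [i|//].
  by case: ifP => // _.
apply/seteqP; split=> [x [i Qi Fi]|x [k _]].
  by exists (choice.pickle i) => //; rewrite choice.pickleK; case: asboolP.
by case: choice.unpickle => [i|//]; case: asboolP => // Qi Fi; exists i.
Qed.

(* Open sets of matrices are countable unions of balls with rational centers
   and radii. *)
Lemma measurable_fun_mx d (T : measurableType d) m p (g : T -> borel_mx m p) :
  (forall i j, measurable_fun setT (fun t => g t i j)) -> measurable_fun setT g.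
Proof.
move=> mg; apply: (@measurability _ _ T (borel_mx m p) setT g
  (@open 'M[R]_(m, p))) => // _ [V oV <-]; rewrite setTI.
pose B (cr : 'M[rat]_(m, p) * nat) : set 'M[R]_(m, p) :=
  [set A | forall i j, `|A i j - ratr (cr.1 i j)| < cr.2.+1%:R^-1].
have -> : g @^-1` V = \bigcup_(cr in [set cr | B cr `<=` V]) (g @^-1` (B cr)).
  apply/seteqP; split=> [t Vt|t [cr /= BV]]; last exact: BV.
  have := oV; rewrite openE => /(_ _ Vt); rewrite /interior/= -nbhs_ballE.
  move=> [e e0 eV].
  have e20 : 0 < e / 2 by rewrite divr_gt0.
  have [k ke] : exists k : nat, k.+1%:R^-1 < e / 2.
    have : \forall k \near \oo, k.+1%:R^-1 < e / 2 :> R.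
      exact: near_infty_natSinv_lt (PosNum e20).
    by move=> /filter_ex[k kk]; exists k.
  have k0 : (0 : R) < k.+1%:R^-1 by rewrite invr_gt0.
  have /choice[c cP] (ij : 'I_m * 'I_p) : exists c : rat,
      `|g t ij.1 ij.2 - ratr c| < k.+1%:R^-1.
    have /rat_in_itvoo[c] : g t ij.1 ij.2 - k.+1%:R^-1 < g t ij.1 ij.2 + k.+1%:R^-1.
      by rewrite ltrBlDr -addrA ltrDl addr_gt0.
    rewrite in_itv/= => /andP[c1 c2]; exists c.
    by move: (k.+1%:R^-1) c1 c2 => ? ? ?; rewrite ltr_norml; lra.
  exists (\matrix_(i, j) c (i, j), k) => /=.
    move=> A BA; apply: eV; split=> // i j.
    have := BA i j; have := cP (i, j); rewrite /= mxE => H1 H2.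
    rewrite /ball/=; rewrite (distrC (A i j)) in H2.
    rewrite -(subrKA (ratr (c (i, j)))); apply: le_lt_trans (ler_normD _ _) _.
    by move: (k.+1%:R^-1) ke H1 H2 => ?; lra.
  by move=> i j; rewrite /= mxE; exact: (cP (i, j)).
apply: measurable_bigcup_countType => cr.
have -> : g @^-1` B cr = \bigcap_(i in setT) \bigcap_(j in setT)
   ((fun t => `|g t i j - ratr (cr.1 i j)|) @^-1` `]-oo, cr.2.+1%:R^-1[).
  apply/seteqP; split=> [t /= Bt i _ j _|t Bt i j]/=; first by rewrite in_itv/= Bt.
  by have := Bt i I j I; rewrite /= in_itv.
apply: fin_bigcap_measurable => // i _.
apply: fin_bigcap_measurable => // j _.
rewrite -[X in measurable X]setTI.
have : measurable_fun setT (fun t => `|g t i j - ratr (cr.1 i j)|).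
  by apply: measurableT_comp => //; apply: measurable_funB.
exact.
Qed.

End borel_matrices.

(** * Measurability of sums over a random finite set *)

Section counting.
Context {R : realType} {n d : nat}.
Local Notation fs := (@random_fset R n d).

Definition slice (i : 'I_n) (s : {fset 'I_n * 'cV[R]_d}) : seq 'cV[R]_d :=
  [seq q.2 | q <- enum_fset s & q.1 == i].

Lemma big_slices (V : nmodType) (F : 'I_n -> 'cV[R]_d -> V)
    (s : {fset 'I_n * 'cV[R]_d}) :
  \sum_(q <- s) F q.1 q.2 = \sum_i \sum_(u <- slice i s) F i u.
Proof.
under [RHS]eq_bigr => i _ do rewrite /slice big_map big_filter.
rewrite (exchange_big_dep xpredT)//=; apply: eq_bigr => q _.
rewrite (eq_bigl (fun i => i == q.1)); last by move=> i; rewrite eq_sym.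
by rewrite big_pred1_eq.
Qed.

Lemma measurable_count_slice i (B : set 'cV[R]_d) : <<s open >> B ->
  measurable_fun setT (fun s : fs => (count (fun u => u \in B) (slice i s))%:R : R).
Proof.
move=> mB.
have H m : measurable [set s : fs | count (fun u => u \in B) (slice i s) = m].
  apply: sub_sigma_algebra; exists i, B, m; split=> //.
  have E (A s : {fset 'I_n * 'cV[R]_d}) :
      (forall q, (q \in A) = [&& q \in s, q.1 == i & q.2 \in B]) ->
    #|` A| = count (fun u => u \in B) (slice i s).
    move=> Aq; rewrite /slice count_map -size_filter -filter_predI.
    apply: perm_size; apply: uniq_perm => [||q].
    - exact: fset_uniq.
    - by rewrite filter_uniq// fset_uniq.
    - by rewrite Aq mem_filter/= andbC [X in X && _]andbC.
  by apply/seteqP; split=> s /= <-; [|apply/esym]; apply: E => q; rewrite !inE.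
move=> _ C mC; rewrite setTI.
rewrite (_ : _ @^-1` C = \bigcup_(m in [set m : nat | C m%:R])
   [set s : fs | count (fun u => u \in B) (slice i s) = m]).
  exact: bigcup_measurable.
apply/seteqP; split=> [s Cs|s [m Cm /= sm]]; last by rewrite /preimage/= sm.
by exists (count (fun u => u \in B) (slice i s)).
Qed.

(* Counting measure on s, zero unless size s = m: for fixed m this is a finite
   kernel in s, so sums over random slices are measurable as kernel integrals. *)
Definition seq_measure (s : seq (@borel_mx R d 1)) (m : nat) :
    {measure set (@borel_mx R d 1) -> \bar R} :=
  msum (fun k => \d_(nth (0 : 'M[R]_(d, 1)) s k : @borel_mx R d 1)) (if size s == m then m else 0%N).

Lemma seq_measureE s B : seq_measure s (size s) B
  = ((count (fun u => u \in B) s)%:R)%:E.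
Proof.
rewrite /seq_measure/= eqxx /msum.
rewrite -(big_mkord xpredT (fun k => \d_(nth (0 : 'M[R]_(d, 1)) s k : @borel_mx R d 1) B)).
rewrite -(big_nth 0 xpredT (fun u : @borel_mx R d 1 => \d_u B)).
elim: s => [|u s IH]; first by rewrite big_nil.
by rewrite big_cons IH diracE/= natrD EFinD.
Qed.

Lemma integral_seq_measure s (h : @borel_mx R d 1 -> R) :
  measurable_fun setT h -> (forall u, 0 <= h u) ->
  (\int[seq_measure s (size s)]_u (h u)%:E = (\sum_(u <- s) h u)%:E)%E.
Proof.
move=> mh h0; rewrite /seq_measure eqxx ge0_integral_measure_sum//.
- under eq_bigr => k _.
    rewrite integral_dirac//; last exact/measurable_EFinP.
    rewrite diracT mul1e; over.
  rewrite -(big_mkord xpredT (fun k => (h (nth (0 : 'M[R]_(d, 1)) s k : @borel_mx R d 1))%:E)).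
  by rewrite -(big_nth 0 xpredT (fun u => (h u)%:E)) sumEFin.
- by move=> u _; rewrite lee_fin.
- exact/measurable_EFinP.
Qed.

Context {dX : measure_display} {X : measurableType dX}.
Variable i : 'I_n.

Definition slice_measure m (xs : X * fs) := seq_measure (slice i xs.2) m.

Lemma measurable_slice_measure m U : measurable U -> measurable_fun setT ((slice_measure m) ^~ U).
Proof.
move=> mU.
have mS : measurable_fun setT (fun xs : X * fs => size (slice i xs.2) == m).
  have := @measurable_count_slice i setT
    (@measurableT _ (@borel_mx R d 1)).
  have -> : (fun s : fs => (count (fun u => u \in setT) (slice i s))%:R : R) =
      (fun s : fs => (size (slice i s))%:R).
    by apply/funext => s; congr _%:R; rewrite -[RHS]count_predT;
      apply: eq_count => u; rewrite in_setT.
  move=> mc; have {}mc := measurableT_comp mc (@measurable_snd _ _ X fs).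
  have : measurable_fun setT
     (fun xs : X * fs => ((size (slice i xs.2))%:R : R) == m%:R).
    exact: measurable_fun_eqr.
  by congr measurable_fun; apply/funext => xs; rewrite eqr_nat.
have -> : (slice_measure m) ^~ U = fun xs : X * fs => (if size (slice i xs.2) == m then
    ((count (fun u => u \in U) (slice i xs.2))%:R : R) else 0)%:E.
  apply/funext => xs; rewrite /slice_measure; case: eqP => [<-|/eqP/negbTE sm].
    exact: seq_measureE.
  by rewrite /seq_measure/= sm /msum big_ord0.
apply/measurable_EFinP; apply: measurable_fun_ifT => //.
have := @measurable_count_slice i U mU.
by move=> mc; exact: (measurableT_comp mc (@measurable_snd _ _ X fs)).
Qed.

Lemma slice_measureT_le m xs : (slice_measure m xs setT <= m%:R%:E)%E.
Proof.
rewrite /slice_measure /seq_measure/= /msum; case: ifP => _; last first.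
  by rewrite big_ord0 lee_fin.
under eq_bigr do rewrite /= diracE in_setT.
by rewrite sumEFin big_const_ord iter_addr_0 lee_fin.
Qed.

HB.instance Definition _ m := isKernel.Build _ _ _ _ _ (slice_measure m)
  (@measurable_slice_measure m).

Lemma slice_measure_uub m : measure_fam_uub (slice_measure m).
Proof.
exists m.+1%:R => xs; apply: le_lt_trans (slice_measureT_le m xs) _.
by rewrite lte_fin ltr_nat.
Qed.

HB.instance Definition _ m := Kernel_isFinite.Build _ _ _ _ _ (slice_measure m)
  (slice_measure_uub m).

Lemma measurable_sum_slice (h : X * @borel_mx R d 1 -> R) :
  measurable_fun setT h ->
  measurable_fun setT (fun xs : X * fs => \sum_(u <- slice i xs.2) h (xs.1, u)).
Proof.
have pos (g : X * @borel_mx R d 1 -> R) : measurable_fun setT g ->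
    (forall z, 0 <= g z) ->
    measurable_fun setT (fun xs : X * fs => \sum_(u <- slice i xs.2) g (xs.1, u)).
  move=> mg g0; apply/measurable_EFinP.
  pose k (z : X * fs * @borel_mx R d 1) : \bar R := (g (z.1.1, z.2))%:E.
  have mk : measurable_fun setT k.
    apply/measurable_EFinP; apply: (measurableT_comp mg).
    apply/measurable_fun_pairP; split=> /=.
      exact: measurableT_comp measurable_fst measurable_fst.
    exact: measurable_snd.
  (* Only the term m = size of the slice is nonzero, so the series over m recovers the sum although
     the size varies with s. *)
  have -> : (EFin \o (fun xs : X * fs => \sum_(u <- slice i xs.2) g (xs.1, u)))
     = (fun xs => \sum_(0 <= m <oo) \int[slice_measure m xs]_u k (xs, u))%E.
    apply/funext => xs /=.
    rewrite (@nneseriesD1 R _ (size (slice i xs.2)))//; last first.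
      by move=> m _; apply: integral_ge0 => u _; rewrite lee_fin.
    rewrite eseries0 ?adde0; last first.
      move=> m _ /negbTE ms; rewrite /slice_measure /seq_measure eq_sym ms.
      by rewrite msum_mzero integral_measure_zero.
    rewrite -integral_seq_measure//.
    exact: measurableT_comp (mg) (measurable_pair1 _).
  apply: ge0_emeasurable_sum => m.
    by move=> xs _ _; apply: integral_ge0 => u _; rewrite lee_fin.
  move=> _; apply: (measurable_fun_integral_finite_kernel k [the R.-fker _ ~> _ of slice_measure m]) => // z.
  by rewrite lee_fin.
move=> mh.
have := measurable_funB (pos _ (measurable_funrpos mh) (fun _ => _))
   (pos _ (measurable_funrneg mh) (fun _ => _)).
have -> : (fun xs : X * fs => \sum_(u <- slice i xs.2) h (xs.1, u)) =
  (fun xs => \sum_(u <- slice i xs.2) h^\+ (xs.1, u)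
     - \sum_(u <- slice i xs.2) h^\- (xs.1, u)).
  apply/funext => xs; rewrite -sumrB; apply: eq_bigr => u _.
  by rewrite -[h in LHS]funrposBneg.
by apply => ?; [exact: funrpos_ge0|exact: funrneg_ge0].
Qed.

End counting.

(** * Real expectations *)

Section real_expectation.
Context {R : realType} {dT : measure_display} {T : measurableType dT}.
Variable P : probability T R.
Implicit Types X Y : T -> R.

(** Real-valued, so that bounds on expectations are open to [lra]; [fine] sends an infinite integral
    to 0, hence the [rint] hypotheses that follow. *)
Definition Ex X : R := fine (\int[P]_w (X w)%:E)%E.
Definition rint X := P.-integrable setT (EFin \o X).

Lemma Ex_EFin X : rint X -> (\int[P]_w (X w)%:E)%E = (Ex X)%:E.
Proof. by move=> iX; rewrite fineK//; exact: integrable_fin_num. Qed.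

Lemma rint_meas X : rint X -> measurable_fun setT X.
Proof. by move=> /(measurable_int P)/measurable_EFinP. Qed.

Lemma rint_fin_num X : measurable_fun setT X ->
  (\int[P]_w (X w)%:E)%E \is a fin_num -> rint X.
Proof.
move=> mX fX; apply/integrableP; split; first exact/measurable_EFinP.
by rewrite integral_fin_num_abs.
Qed.

Lemma rint_cst r : rint (fun=> r).
Proof. exact: finite_measure_integrable_cst. Qed.

Lemma rintD X Y : rint X -> rint Y -> rint (fun w => X w + Y w).
Proof.
by move=> iX iY; apply: eq_integrable (integrableD measurableT iX iY).
Qed.

Lemma rintZ k X : rint X -> rint (fun w => k * X w).
Proof.
by move=> iX; apply: eq_integrable (integrableZl measurableT k iX).
Qed.

Lemma rint_sum (I : Type) (r : seq I) (Q : pred I) (X : I -> T -> R) :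
  (forall i, rint (X i)) -> rint (fun w => \sum_(i <- r | Q i) X i w).
Proof.
move=> iX; elim: r => [|i r IH].
  by under [X in rint X]eq_fun do rewrite big_nil; exact: rint_cst.
under [X in rint X]eq_fun do rewrite big_cons.
by case: (Q i) => //; exact: rintD.
Qed.

Lemma Ex_cst r : Ex (fun=> r) = r.
Proof. by rewrite /Ex integral_cst//= probability_setT mule1. Qed.

Lemma ExD X Y : rint X -> rint Y -> Ex (fun w => X w + Y w) = Ex X + Ex Y.
Proof.
by move=> iX iY; apply: EFin_inj; rewrite EFinD -!Ex_EFin ?integralD_EFin//;
  exact: rintD.
Qed.

Lemma ExZ k X : rint X -> Ex (fun w => k * X w) = k * Ex X.
Proof.
move=> iX; apply: EFin_inj; rewrite EFinM -!Ex_EFin//; last exact: rintZ.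
by under eq_integral do rewrite EFinM; rewrite integralZl.
Qed.

Lemma rintB X Y : rint X -> rint Y -> rint (fun w => X w - Y w).
Proof.
by move=> iX iY; apply: eq_integrable (integrableB measurableT iX iY).
Qed.

Lemma ExB X Y : rint X -> rint Y -> Ex (fun w => X w - Y w) = Ex X - Ex Y.
Proof.
by move=> iX iY; apply: EFin_inj; rewrite EFinB -!Ex_EFin ?integralB_EFin//;
  exact: rintB.
Qed.

Lemma Ex_sum (I : Type) (r : seq I) (Q : pred I) (X : I -> T -> R) :
  (forall i, rint (X i)) ->
  Ex (fun w => \sum_(i <- r | Q i) X i w) = \sum_(i <- r | Q i) Ex (X i).
Proof.
move=> iX; elim: r => [|i r IH].
  by under [X in Ex X]eq_fun do rewrite big_nil; rewrite Ex_cst big_nil.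
under [X in Ex X]eq_fun do rewrite big_cons.
by rewrite big_cons; case: (Q i) => //; rewrite ExD// ?IH//; exact: rint_sum.
Qed.

Lemma Ex_ae_eq X Y : measurable_fun setT X -> measurable_fun setT Y ->
  {ae P, forall w, X w = Y w} -> Ex X = Ex Y.
Proof.
move=> mX mY XY; congr fine; apply: ae_eq_integral => //.
- exact/measurable_EFinP.
- exact/measurable_EFinP.
- by apply: filterS XY => w /= ->.
Qed.

Lemma rint_ae_eq X Y : measurable_fun setT X -> rint Y ->
  {ae P, forall w, X w = Y w} -> rint X.
Proof.
move=> mX iY XY; apply: rint_fin_num => //.
rewrite (_ : (\int[P]_w (X w)%:E = \int[P]_w (Y w)%:E)%E).
  exact: integrable_fin_num iY.
apply: ae_eq_integral => //.
- exact/measurable_EFinP.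
- exact: measurable_int iY.
- by apply: filterS XY => w /= ->.
Qed.

(** Y may be negative on a null set; its positive part is nonnegative everywhere and has the same
    integral. X is bounded without being known to be integrable. *)
Lemma integral_le_Ex X Y : measurable_fun setT X -> (forall w, 0 <= X w) ->
  rint Y -> {ae P, forall w, X w <= Y w} ->
  (\int[P]_w (X w)%:E <= (Ex Y)%:E)%E.
Proof.
move=> mX X0 iY XY; have mY := rint_meas iY.
rewrite -Ex_EFin// -[leRHS](_ : (\int[P]_w (Y^\+ w)%:E)%E = _); last first.
  apply: ae_eq_integral => //.
  - exact/measurable_EFinP/measurable_funrpos.
  - exact/measurable_EFinP.
  - apply: filterS XY => w /= XY _; congr EFin.
    by rewrite /funrpos; apply/max_idPl; exact: le_trans XY.
apply: ae_ge0_le_integral => //.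
- by move=> w _; rewrite lee_fin.
- exact/measurable_EFinP.
- by move=> w _; rewrite lee_fin funrpos_ge0.
- exact/measurable_EFinP/measurable_funrpos.
- by apply: filterS XY => w /= XY _; rewrite lee_fin /funrpos le_max XY.
Qed.

(** Unlike integrability, this property is stable under products. Directions are unit vectors almost
    surely, so polynomials in their coordinates have it. *)
Definition aebnd X := measurable_fun setT X /\
  exists M, {ae P, forall w, `|X w| <= M}.

Lemma aebnd_rint X : aebnd X -> rint X.
Proof.
move=> [mX [M XM]]; apply/integrableP; split; first exact/measurable_EFinP.
have M0 : (\int[P]_w (`|M|%:E) < +oo)%E.
  by rewrite integral_cst//= probability_setT mule1 ltry.
apply: le_lt_trans M0; apply: ae_ge0_le_integral => //.
- by apply: measurableT_comp => //; exact/measurable_EFinP.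
- apply: filterS XM => w /= XM _.
  by rewrite lee_fin (le_trans XM)// ler_norm.
Qed.

Lemma aebnd_cst r : aebnd (fun=> r).
Proof. by split=> //; exists `|r|; exact: aeW. Qed.

Lemma aebndD X Y : aebnd X -> aebnd Y -> aebnd (fun w => X w + Y w).
Proof.
move=> [mX [M XM]] [mY [N YN]]; split; first exact: measurable_funD.
exists (M + N); apply: filterS2 XM YN => w XM YN.
by apply: le_trans (ler_normD _ _) _; exact: lerD.
Qed.

Lemma aebndM X Y : aebnd X -> aebnd Y -> aebnd (fun w => X w * Y w).
Proof.
move=> [mX [M XM]] [mY [N YN]]; split; first exact: measurable_funM.
exists (M * N); apply: filterS2 XM YN => w XM YN.
by rewrite normrM ler_pM.
Qed.

Lemma aebndZ k X : aebnd X -> aebnd (fun w => k * X w).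
Proof. exact: aebndM (aebnd_cst k). Qed.

Lemma aebnd_sum (I : Type) (r : seq I) (Q : pred I) (X : I -> T -> R) :
  (forall i, aebnd (X i)) -> aebnd (fun w => \sum_(i <- r | Q i) X i w).
Proof.
move=> iX; elim: r => [|i r IH].
  by under [X in aebnd X]eq_fun do rewrite big_nil; exact: aebnd_cst.
under [X in aebnd X]eq_fun do rewrite big_cons.
by case: (Q i) => //; exact: aebndD.
Qed.

Lemma aebnd_funrpos X : aebnd X -> aebnd X^\+.
Proof.
move=> [mX [M XM]]; split; first exact: measurable_funrpos.
exists M; apply: filterS XM => w XM.
rewrite /funrpos ger0_norm ?le_max ?lexx ?orbT// ge_max (le_trans (ler_norm _) XM).
exact: le_trans XM.
Qed.

Lemma aebnd_funrneg X : aebnd X -> aebnd X^\-.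
Proof.
move=> [mX [M XM]]; split; first exact: measurable_funrneg.
exists M; apply: filterS XM => w XM.
rewrite /funrneg ger0_norm ?le_max ?lexx ?orbT// ge_max.
by rewrite -normrN in XM; rewrite (le_trans (ler_norm _) XM) (le_trans _ XM).
Qed.

End real_expectation.

(** * Equality of laws, independence and Tonelli's theorem *)

Section law.
Context {R : realType} {dT : measure_display} {T : measurableType dT}.
Variable P : probability T R.

(** Equal laws give equal integrals to the positive and to the negative part of [phi], each possibly
    infinite. *)
Lemma Ex_eq_law d1 (T1 : measurableType d1) (X Y : T -> T1) (phi : T1 -> R) :
  measurable_fun setT X -> measurable_fun setT Y -> measurable_fun setT phi ->
  (forall B, measurable B -> P (X @^-1` B) = P (Y @^-1` B)) ->
  Ex P (fun w => phi (X w)) = Ex P (fun w => phi (Y w)).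
Proof.
move=> mX mY mphi XY; congr fine.
pose X' : {mfun T >-> T1} := HB.pack X (isMeasurableFun.Build _ _ _ _ _ mX).
pose Y' : {mfun T >-> T1} := HB.pack Y (isMeasurableFun.Build _ _ _ _ _ mY).
have pos (g : T1 -> \bar R) : measurable_fun setT g -> (forall x, 0 <= g x)%E ->
    (\int[P]_w g (X w) = \int[P]_w g (Y w))%E.
  move=> mg g0.
  rewrite -(ge0_integral_distribution X' mg g0).
  rewrite -(ge0_integral_distribution Y' mg g0).
  by apply: eq_measure_integral => A mA _; exact: XY.
rewrite integralE [RHS]integralE.
have mE : measurable_fun setT (EFin \o phi) by exact/measurable_EFinP.
have Ep (Z : T -> T1) : ((fun w => (phi (Z w))%:E)^\+ =
    fun w => (EFin \o phi)^\+ (Z w))%E by apply/funext => w; rewrite !funeposE.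
have En (Z : T -> T1) : ((fun w => (phi (Z w))%:E)^\- =
    fun w => (EFin \o phi)^\- (Z w))%E by apply/funext => w; rewrite !funenegE.
rewrite !Ep !En; congr (_ - _)%E; apply: pos.
- exact: measurable_funepos.
- by move=> x; exact: funepos_ge0.
- exact: measurable_funeneg.
- by move=> x; exact: funeneg_ge0.
Qed.

Context {d1 d2 : measure_display} {T1 : measurableType d1} {T2 : measurableType d2}.
Variables (X : T -> T1) (Y : T -> T2).
Hypotheses (mX : measurable_fun setT X) (mY : measurable_fun setT Y)
  (XY : independent P X Y).

(** By independence the joint law of X and Y is the product of their laws, to which Tonelli's
    theorem applies. *)
Lemma integral_indep (h : T1 * T2 -> \bar R) :
  measurable_fun setT h -> (forall z, 0 <= h z)%E ->
  (\int[P]_w h (X w, Y w) = \int[P]_w \int[P]_w' h (X w, Y w'))%E.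
Proof.
move=> mh h0.
pose X' : {mfun T >-> T1} := HB.pack X (isMeasurableFun.Build _ _ _ _ _ mX).
pose Y' : {mfun T >-> T2} := HB.pack Y (isMeasurableFun.Build _ _ _ _ _ mY).
have mXY : measurable_fun setT (fun w => (X w, Y w)) by exact: measurable_fun_pair.
pose XY' : {mfun T >-> (T1 * T2)%type} := HB.pack (fun w => (X w, Y w))
  (isMeasurableFun.Build _ _ _ _ _ mXY).
rewrite -(ge0_integral_distribution XY' mh h0).
transitivity (\int[distribution P X' \x distribution P Y']_z h z)%E.
  apply: eq_measure_integral => A mA _; apply/esym.
  by apply: product_measure_unique => // B C mB mC; exact: XY.
rewrite fubini_tonelli1//= /fubini_F.
rewrite ge0_integral_distribution//=.
- apply: eq_integral => w _; rewrite ge0_integral_distribution//.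
  exact: measurableT_comp mh (measurable_pair1 _).
- exact: measurable_fun_fubini_tonelli_F.
- by move=> x; exact: integral_ge0.
Qed.

(** Takes the place of conditional expectation: a bound valid for every frozen value of X survives
    averaging over X. *)
Lemma integral_indep_le (h : T1 * T2 -> \bar R) (g : T1 -> \bar R) :
  measurable_fun setT h -> (forall z, 0 <= h z)%E -> measurable_fun setT g ->
  (forall x, \int[P]_w h (x, Y w) <= g x)%E ->
  (\int[P]_w h (X w, Y w) <= \int[P]_w g (X w))%E.
Proof.
move=> mh h0 mg hg; rewrite integral_indep//.
pose Y' : {mfun T >-> T2} := HB.pack Y (isMeasurableFun.Build _ _ _ _ _ mY).
have mF : measurable_fun setT (fun x => \int[P]_w h (x, Y w))%E.
  rewrite (_ : (fun x => _) = fubini_F (distribution P Y') h).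
    exact: measurable_fun_fubini_tonelli_F.
  apply/funext => x; rewrite /fubini_F ge0_integral_distribution//.
  exact: measurableT_comp mh (measurable_pair1 _).
have F0 x : (0 <= \int[P]_w h (x, Y w))%E by exact: integral_ge0.
apply: ge0_le_integral => //.
- exact: measurableT_comp mF mX.
- exact: measurableT_comp mg mX.
Qed.

(** Nonnegative factors are a case of [integral_indep]; signed ones are recovered from the four
    combinations of positive and negative parts. *)
Lemma Ex_indepM (phi : T1 -> R) (psi : T2 -> R) :
  measurable_fun setT phi -> measurable_fun setT psi ->
  aebnd P (phi \o X) -> aebnd P (psi \o Y) ->
  Ex P (fun w => phi (X w) * psi (Y w)) =
  Ex P (fun w => phi (X w)) * Ex P (fun w => psi (Y w)).
Proof.
have pos (g : T1 -> R) (h : T2 -> R) : measurable_fun setT g ->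
    measurable_fun setT h -> (forall x, 0 <= g x) -> (forall x, 0 <= h x) ->
    aebnd P (g \o X) -> aebnd P (h \o Y) ->
    Ex P (fun w => g (X w) * h (Y w)) =
    Ex P (fun w => g (X w)) * Ex P (fun w => h (Y w)).
  move=> mg mh g0 h0 bg bh; apply: EFin_inj; rewrite EFinM.
  have ig := aebnd_rint bg; have ih := aebnd_rint bh.
  rewrite -!Ex_EFin//; last exact: aebnd_rint (aebndM bg bh).
  rewrite (integral_indep (h := fun z => (g z.1 * h z.2)%:E))//=; last 2 first.
  - apply/measurable_EFinP; apply: measurable_funM.
    + exact: measurableT_comp mg measurable_fst.
    + exact: measurableT_comp mh measurable_snd.
  - by move=> z; rewrite lee_fin mulr_ge0.
  under eq_integral => w _.
    under eq_integral do rewrite EFinM.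
    rewrite ge0_integralZl//; last 3 first.
    - exact: measurable_int ih.
    - by move=> x _; rewrite lee_fin.
    - by rewrite lee_fin.
    over.
  rewrite ge0_integralZr//.
  - exact: measurable_int ig.
  - by move=> x _; rewrite lee_fin.
  - by apply: integral_ge0 => x _; rewrite lee_fin.
move=> mphi mpsi bphi bpsi.
have split (g : T -> R) : aebnd P g ->
    Ex P g = Ex P g^\+ - Ex P g^\-.
  move=> bg; rewrite -ExB; last 2 first.
  - exact/aebnd_rint/aebnd_funrpos.
  - exact/aebnd_rint/aebnd_funrneg.
  by congr Ex; rewrite -[LHS]funrposBneg.
have b1 := aebnd_funrpos bphi; have b2 := aebnd_funrneg bphi.
have b3 := aebnd_funrpos bpsi; have b4 := aebnd_funrneg bpsi.
have m1 := measurable_funrpos mphi; have m2 := measurable_funrneg mphi.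
have m3 := measurable_funrpos mpsi; have m4 := measurable_funrneg mpsi.
have E1 := pos _ _ m1 m3 (funrpos_ge0 _) (funrpos_ge0 _) b1 b3.
have E2 := pos _ _ m1 m4 (funrpos_ge0 _) (funrneg_ge0 _) b1 b4.
have E3 := pos _ _ m2 m3 (funrneg_ge0 _) (funrpos_ge0 _) b2 b3.
have E4 := pos _ _ m2 m4 (funrneg_ge0 _) (funrneg_ge0 _) b2 b4.
have -> : (fun w => phi (X w) * psi (Y w)) = (fun w =>
   (phi^\+ (X w) * psi^\+ (Y w) - phi^\+ (X w) * psi^\- (Y w))
   - (phi^\- (X w) * psi^\+ (Y w) - phi^\- (X w) * psi^\- (Y w))).
  apply/funext => w; rewrite -[phi in LHS]funrposBneg -[psi in LHS]funrposBneg.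
  by rewrite !fctE; lra.
have i13 := aebnd_rint (aebndM b1 b3); have i14 := aebnd_rint (aebndM b1 b4).
have i23 := aebnd_rint (aebndM b2 b3); have i24 := aebnd_rint (aebndM b2 b4).
rewrite ExB; [|exact: rintB|exact: rintB].
rewrite ExB// ExB// E1 E2 E3 E4 (split _ bphi) (split _ bpsi).
by rewrite mulrBl !mulrBr.
Qed.

End law.

(** * Random directions *)

Lemma measurable_fun_dot (R : realType) dT (T : measurableType dT) m p
    (g h : T -> 'M[R]_(m, p)) :
  (forall i j, measurable_fun setT (fun t => g t i j)) ->
  (forall i j, measurable_fun setT (fun t => h t i j)) ->
  measurable_fun setT (fun t => dot (g t) (h t)).
Proof.
move=> mg mh; apply: measurable_sum => i; apply: measurable_sum => j.
exact: measurable_funM.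
Qed.

Section random_directions.
Context {R : realType} {dT : measure_display} {T : measurableType dT}.
Variable P : probability T R.

Lemma mutually_independent_pair (J : finType) d1 (T1 : measurableType d1)
    (X : J -> T -> T1) (r s : J) : r != s -> mutually_independent P X ->
  independent P (X r) (X s).
Proof.
move=> rs iX A B mA mB.
pose C j := if j == r then A else if j == s then B else setT.
have mC j : measurable (C j) by rewrite /C; case: eqP => // _; case: eqP.
have := iX C mC.
rewrite (bigD1 r)//= (bigD1 s)//= 1?eq_sym//= /C eqxx [s == r]eq_sym (negbTE rs) eqxx.
rewrite big1 ?mule1 => [<-|j /andP[/negbTE -> /negbTE ->]]; last first.
  by rewrite preimage_setT probability_setT.
congr (P _); apply/seteqP; split=> [w [Aw Bw] j _|w H].
  by rewrite /preimage/=; case: eqP => [->//|_]; case: eqP => [->|].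
split; first by have := H r I; rewrite /preimage/= eqxx.
by have := H s I; rewrite /preimage/= [s == r]eq_sym (negbTE rs) eqxx.
Qed.

Lemma Ex_finite_valued (K : finType) (X : T -> K) (phi : K -> R) :
  (forall x, measurable [set w | X w = x]) ->
  rint P (fun w => phi (X w)) /\
  Ex P (fun w => phi (X w)) = \sum_x phi x * fine (P [set w | X w = x]).
Proof.
move=> mX.
have E : (fun w => phi (X w)) =
    (fun w => \sum_x phi x * \1_[set w | X w = x] w).
  apply/funext => w; rewrite (bigD1 (X w))//= indicE mem_set// mulr1.
  rewrite big1 ?addr0// => x xX; rewrite indicE memNset ?mulr0//=.
  by move=> /esym/eqP; apply/negP.
have iI x : rint P (\1_[set w | X w = x] : T -> R).
  exact: integrable_indic.
rewrite E; split; first by apply: rint_sum => x; exact: rintZ.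
rewrite Ex_sum; last by move=> x; exact: rintZ.
apply: eq_bigr => x _; rewrite ExZ//; congr (_ * _).
by rewrite /Ex integral_indic// setIT.
Qed.

Context {d : nat}.
Implicit Types (u : T -> 'cV[R]_d) (v c : 'cV[R]_d).

(* The two admissible laws of a direction u enter the proof only through
   |u| = 1 and E[u u^T] = 1/d. *)
Definition isotropic u :=
  [/\ measurable_fun setT (u : T -> borel_mx d 1),
      {ae P, forall w, dot (u w) (u w) = 1}
    & forall a b, Ex P (fun w => u w a 0 * u w b 0) = (a == b)%:R / d%:R].

Lemma isotropic_coord u a b : isotropic u -> aebnd P (fun w => u w a b).
Proof.
move=> [mu u1 _]; split.
  exact: measurableT_comp (measurable_coord _ _) mu.
exists 1; apply: filterS u1 => w u1.
by rewrite -(ler_pXn2r (n := 2))// ?nnegrE// expr1n real_normK ?num_real// -u1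
  coord_le_dot.
Qed.

Lemma isotropic_dot u v : isotropic u -> aebnd P (fun w => dot v (u w)).
Proof.
by move=> iu; apply: aebnd_sum => a; apply: aebnd_sum => b; apply: aebndZ;
  exact: isotropic_coord.
Qed.

Lemma Ex_isotropic u v c : isotropic u ->
  Ex P (fun w => dot v (u w) * dot c (u w)) = dot v c / d%:R.
Proof.
move=> iu; have [_ _ Eu] := iu.
have -> : (fun w => dot v (u w) * dot c (u w)) = (fun w =>
   \sum_a \sum_b (v a 0 * c b 0) * (u w a 0 * u w b 0)).
  apply/funext => w; rewrite !dot_cV mulr_suml; apply: eq_bigr => a _.
  by rewrite mulr_sumr; apply: eq_bigr => b _; lra.
have iuu a b : rint P (fun w => u w a 0 * u w b 0).
  by apply: aebnd_rint; apply: aebndM; exact: isotropic_coord.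
rewrite Ex_sum; last by move=> a; apply: rint_sum => b; exact: rintZ.
rewrite dot_cV mulr_suml; apply: eq_bigr => a _.
rewrite Ex_sum; last by move=> b; exact: rintZ.
rewrite (bigD1 a)//= ExZ// Eu eqxx big1 ?addr0 ?mul1r// => b ba.
by rewrite ExZ// Eu eq_sym (negbTE ba) mul0r mulr0.
Qed.

Lemma Ex_isotropic_self u c : isotropic u ->
  Ex P (fun w => dot (dot c (u w) *: u w) (dot c (u w) *: u w)) = dot c c / d%:R.
Proof.
move=> iu; rewrite -(Ex_isotropic c c iu).
have [_ u1 _] := iu.
have b1 := isotropic_dot c iu.
have mu := (isotropic_coord _ _ iu).1.
apply: Ex_ae_eq.
- apply: measurable_fun_dot => i j.
    under eq_fun do rewrite mxE.
    by apply: measurable_funM => //; exact: b1.1.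
  under eq_fun do rewrite mxE.
  by apply: measurable_funM => //; exact: b1.1.
- exact: (aebndM b1 b1).1.
- by apply: filterS u1 => w u1; rewrite !dotE u1; lra.
Qed.

(** The expectation factors coordinate by coordinate, and E[<c, u> u] = c / d on either side. *)
Lemma Ex_isotropic_indep u u' c c' : isotropic u -> isotropic u' ->
  @independent _ _ _ P _ _ (borel_mx d 1) (borel_mx d 1) u u' ->
  Ex P (fun w => dot (dot c (u w) *: u w) (dot c' (u' w) *: u' w))
  = dot c c' / d%:R ^+ 2.
Proof.
move=> iu iu' ind; have [mu _ _] := iu; have [mu' _ _] := iu'.
pose phi e a : borel_mx d 1 -> R := fun x => dot e x * dot (delta_mx a 0) x.
have mphi e a : measurable_fun setT (phi e a).
  by apply: measurable_funM; apply: measurable_fun_dot => // i j;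
    exact: measurable_coord.
have bphi e a : aebnd P (fun w => phi e a (u w)).
  by apply: aebndM; exact: isotropic_dot.
have bphi' e a : aebnd P (fun w => phi e a (u' w)).
  by apply: aebndM; exact: isotropic_dot.
have -> : (fun w => dot (dot c (u w) *: u w) (dot c' (u' w) *: u' w)) =
    (fun w => \sum_a phi c a (u w) * phi c' a (u' w)).
  apply/funext => w; rewrite dot_cV; apply: eq_bigr => a _.
  by rewrite /phi !(dotC (delta_mx _ _)) !dot_delta !mxE.
rewrite Ex_sum => [|a]; last exact: aebnd_rint (aebndM _ _).
rewrite dot_cV mulr_suml; apply: eq_bigr => a _.
rewrite (Ex_indepM mu mu' ind)//.
rewrite [Ex P _](Ex_isotropic c (delta_mx a 0) iu).
rewrite [Ex P _](Ex_isotropic c' (delta_mx a 0) iu').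
- by rewrite !dot_delta expr2 invfM; lra.
- exact: bphi.
- exact: bphi'.
Qed.

Section batch_moments.
Context {b : nat}.
Variables (u : 'I_b -> T -> 'cV[R]_d) (z : 'I_b -> 'cV[R]_d) (A : 'cV[R]_d).
Hypotheses (b_gt0 : (0 < b)%N) (d_gt0 : (0 < d)%N)
  (iu : forall r, isotropic (u r))
  (indu : forall r s, r != s ->
     @independent _ _ _ P _ _ (borel_mx d 1) (borel_mx d 1) (u r) (u s)).

Let y r w := dot (z r) (u r w) *: u r w.

(** The part of the estimator that is linear in the matrices u u^T. It is used with [z r] = grad
    f_i(x) - J^(i) for the r-th sampled index i, and with [A] = J 1 / n minus the gradient of f at
    the minimizer. *)
Definition sketch w := A + (d%:R / b%:R) *: \sum_r y r w.

Let d_neq0 : (d%:R : R) != 0. Proof. by rewrite pnatr_eq0 -lt0n. Qed.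
Lemma aebnd_dot_sketch v : aebnd P (fun w => dot v (sketch w)).
Proof.
under [X in aebnd _ X]eq_fun do rewrite dotDr dotZr dot_sumr.
apply: aebndD; first exact: aebnd_cst.
apply: aebndZ; apply: aebnd_sum => r.
under [X in aebnd _ X]eq_fun do rewrite dotZr.
by apply: aebndM; exact: isotropic_dot.
Qed.

Lemma Ex_dot_sketch v :
  Ex P (fun w => dot v (sketch w)) = dot v (A + b%:R^-1 *: \sum_r z r).
Proof.
have H r : aebnd P (fun w => dot v (y r w)).
  under [X in aebnd _ X]eq_fun do rewrite dotZr.
  by apply: aebndM; exact: isotropic_dot.
under [X in Ex _ X]eq_fun do rewrite dotDr dotZr dot_sumr.
have HS : rint P (fun w => \sum_r dot v (y r w)).
  by apply: rint_sum => r; exact: aebnd_rint.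
rewrite ExD ?Ex_cst ?ExZ//; [|exact: rint_cst|exact: rintZ].
rewrite Ex_sum; last by move=> r; exact: aebnd_rint.
rewrite dotDr dotZr dot_sumr; congr (_ + _).
rewrite mulr_sumr [RHS]mulr_sumr; apply: eq_bigr => r _.
under [X in Ex _ X]eq_fun do rewrite dotZr.
by rewrite Ex_isotropic// (dotC (z r)) mulrAC mulrCA divff// mulr1 mulrC.
Qed.

Lemma aebnd_sketch2 : aebnd P (fun w => dot (sketch w) (sketch w)).
Proof.
apply: aebnd_sum => i; apply: aebnd_sum => j; rewrite ord1.
have H : aebnd P (fun w => sketch w i 0).
  under [X in aebnd _ X]eq_fun do rewrite -dot_delta dotC.
  exact: aebnd_dot_sketch.
exact: aebndM.
Qed.

(** Each diagonal product of the y_r averages to |z_r|^2 / d and each off-diagonal one to <z_r, z_s>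
    / d^2. Against the factor (d/b)^2 only the diagonal keeps a d: this is the price of observing
    one direction. *)
Lemma Ex_sketch2 : Ex P (fun w => dot (sketch w) (sketch w)) =
  dot A A + 2 / b%:R * \sum_r dot A (z r)
  + d%:R / b%:R ^+ 2 * \sum_r dot (z r) (z r)
  + b%:R ^- 2 * \sum_r \sum_(s | s != r) dot (z r) (z s).
Proof.
have byy r s : aebnd P (fun w => dot (y r w) (y s w)).
  under [X in aebnd _ X]eq_fun do rewrite dotZr dotZl mulrC.
  apply: aebndM.
    by apply: aebndM; [exact: isotropic_dot|];
    apply: aebnd_sum => i; apply: aebnd_sum => j;
    apply: aebndM; exact: isotropic_coord.
  exact: isotropic_dot.
have bAy r : aebnd P (fun w => dot A (y r w)).
  under [X in aebnd _ X]eq_fun do rewrite dotZr.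
  by apply: aebndM; exact: isotropic_dot.
have -> : (fun w => dot (sketch w) (sketch w)) = (fun w => dot A A
   + 2 * (d%:R / b%:R) * \sum_r dot A (y r w)
   + (d%:R / b%:R) ^+ 2 * \sum_r \sum_s dot (y r w) (y s w)).
  apply/funext => w; rewrite -dot_sumr.
  under [X in _ + _ * X]eq_bigr do rewrite -dot_sumr.
  rewrite -dot_suml /sketch; move: (\sum_r y r w) => S.
  by rewrite !dotE (dotC S A); lra.
have i1 : rint P (fun w => \sum_r dot A (y r w)).
  by apply: rint_sum => r; exact: aebnd_rint.
have i2 r : rint P (fun w => \sum_s dot (y r w) (y s w)).
  by apply: rint_sum => s; exact: aebnd_rint.
have i3 : rint P (fun w => \sum_r \sum_s dot (y r w) (y s w)).
  by apply: rint_sum => r.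
rewrite ExD; [|by apply: rintD; [exact: rint_cst|exact: rintZ]|exact: rintZ].
rewrite ExD; [|exact: rint_cst|exact: rintZ].
rewrite Ex_cst !ExZ// !Ex_sum//; last by move=> r; exact: aebnd_rint.
rewrite -!addrA; congr (_ + _).
have -> : \sum_r Ex P (fun w => dot A (y r w)) = d%:R^-1 * \sum_r dot A (z r).
  rewrite mulr_sumr; apply: eq_bigr => r _.
  under [X in Ex _ X]eq_fun do rewrite dotZr.
  by rewrite Ex_isotropic// (dotC (z r)) mulrC.
have -> : \sum_r Ex P (fun w => \sum_s dot (y r w) (y s w)) =
   d%:R^-1 * (\sum_r dot (z r) (z r))
   + d%:R ^- 2 * (\sum_r \sum_(s | s != r) dot (z r) (z s)).
  rewrite !mulr_sumr -big_split/=; apply: eq_bigr => r _.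
  rewrite Ex_sum; last by move=> s; exact: aebnd_rint.
  rewrite (bigD1 r)//= Ex_isotropic_self// [_ / _]mulrC; congr (_ + _).
  rewrite mulr_sumr; apply: eq_bigr => s sr.
  by rewrite Ex_isotropic_indep// 1?mulrC//; apply: indu; rewrite eq_sym.
(* [lra] does not cancel inverses, so each cancellation of d is supplied as an equation in
   multiplied form. *)
have K X : d%:R / b%:R * (d%:R^-1 * X) = b%:R^-1 * X :> R.
  by rewrite mulrACA divff// mul1r.
move: (\sum_r dot A (z r)) (\sum_r dot (z r) (z r))
  (\sum_r \sum_(s | s != r) dot (z r) (z s)) => X1 X2 X3.
rewrite !expr2 !invfM.
have H1 := K X1; have H2 := congr1 ( *%R (d%:R / b%:R)) (K X2).
have H3 := congr1 ( *%R (d%:R / b%:R)) (K (d%:R^-1 * X3)).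
have := K (b%:R^-1 * X3); lra.
Qed.

End batch_moments.

End random_directions.

Section uniform_directions.
Context {R : realType} {dT : measure_display} {T : measurableType dT}.
Variable P : probability T R.
Context {d : nat}.
Hypothesis d_gt0 : (0 < d)%N.
Variable u : T -> 'cV[R]_d.
Hypothesis mu : measurable_fun setT (u : T -> borel_mx d 1).

Let d_neq0 : (d%:R : R) != 0. Proof. by rewrite pnatr_eq0 -lt0n. Qed.

Let mcoord a b : measurable_fun setT (fun w => u w a b).
Proof. exact: measurableT_comp (measurable_coord _ _) mu. Qed.

Lemma uniform_basis_isotropic : uniform_basis P u -> isotropic P u.
Proof.
move=> ub.
have mA j : measurable [set w | u w = delta_mx j 0].
  rewrite (_ : [set w | _] = \bigcap_(a in setT)
     ((fun w => u w a 0) @^-1` [set (delta_mx j 0 : 'cV[R]_d) a 0])); last first.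
    apply/seteqP; split=> [w uw a _|w H]; first by rewrite /preimage/= uw.
    by apply/matrixP => a c; rewrite ord1 (H a I).
  apply: fin_bigcap_measurable => // a _; rewrite -[X in measurable X]setTI.
  exact: mcoord.
have dE (j i : 'I_d) : delta_mx j 0 = delta_mx i 0 :> 'cV[R]_d -> j = i.
  move=> /matrixP/(_ j 0); rewrite !mxE !eqxx andbT.
  by case: eqP => // _ /eqP; rewrite oner_eq0.
(* The hypothesis gives only the masses of the d basis vectors. G is the indicator of hitting one of
   them; its mean is 1, so 1 - G is nonnegative with zero integral and vanishes almost surely. *)
pose G w : R := \sum_j \1_[set w | u w = delta_mx j 0] w.
have iI j : rint P (\1_[set w | u w = delta_mx j 0] : T -> R).
  exact: integrable_indic.
have EI j : Ex P (\1_[set w | u w = delta_mx j 0] : T -> R) = d%:R^-1.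
  have H : P [set w | u w = delta_mx j 0] = (d%:R^-1)%:E by exact: ub.
  by rewrite /Ex integral_indic// setIT; move: H => /= ->.
have GE w : G w = `[< exists j, u w = delta_mx j 0 >]%:R.
  case: asboolP => [[j uj]|nw]; last first.
    by rewrite /G big1// => j _; rewrite indicE memNset//= => uj; apply: nw; exists j.
  rewrite /G (bigD1 j)//= indicE mem_set//= big1 ?addr0// => i ij.
  by rewrite indicE memNset//= uj => /dE ji; rewrite ji eqxx in ij.
have iG : rint P G by exact: rint_sum.
have EG : Ex P G = 1.
  by rewrite Ex_sum// (eq_bigr (fun=> d%:R^-1))// sumr_const card_ord
    -[_ *+ d]mulr_natl divff.
have ae_basis : {ae P, forall w, exists j, u w = delta_mx j 0}.
  have iH : rint P (fun w => 1 - G w) by apply: rintB => //; exact: rint_cst.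
  have := (ae_eq_integral_abs P measurableT (measurable_int P iH)).1.
  rewrite (eq_integral (fun w => (1 - G w)%:E)); last first.
    by move=> w _; rewrite /= ger0_norm// subr_ge0 GE; case: asbool.
  rewrite (Ex_EFin iH) ExB// ?Ex_cst ?EG ?subrr; last exact: rint_cst.
  move=> /(_ erefl); apply: filterS => w /(_ I)/= [] /eqP.
  by rewrite subr_eq0 GE; case: asboolP => // _; rewrite oner_eq0.
split=> //.
- apply: filterS ae_basis => w [j ->].
  rewrite dot_cV (bigD1 j)//= !mxE !eqxx mulr1 big1 ?addr0// => i ij.
  by rewrite mxE (negbTE ij) mul0r.
move=> a c.
rewrite (Ex_ae_eq (Y := fun w => \sum_j ((a == j)%:R * (c == j)%:R) *
   \1_[set w | u w = delta_mx j 0] w)).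
- rewrite Ex_sum => [|j]; last exact: rintZ.
  under eq_bigr => j _.
    rewrite ExZ// EI; over.
  rewrite (bigD1 a)//= eqxx mul1r big1 ?addr0 1?eq_sym// => j ja.
  by rewrite eq_sym (negbTE ja) !mul0r.
- exact: measurable_funM.
- apply: measurable_sum => j; apply: measurable_funM => //.
- apply: filterS ae_basis => w [j uj].
  rewrite (bigD1 j)//= indicE mem_set//= big1 ?addr0 ?mulr1.
    by rewrite uj !mxE eqxx !andbT.
  move=> i ij; rewrite indicE memNset ?mulr0//= uj => /dE ji.
  by rewrite ji eqxx in ij.
Qed.

(** Three orthogonal-invariance facts suffice: flipping the sign of coordinate a kills the mixed
    moments, transposing two coordinates equates the diagonal ones, and |u| = 1 fixes their sum. *)
Lemma uniform_sphere_isotropic : uniform_sphere P u -> isotropic P u.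
Proof.
move=> [P1 inv].
have mQ (Q : 'M[R]_d) : measurable_fun setT ((fun w => Q *m u w) : T -> borel_mx d 1).
  apply: measurable_fun_mx => i j; under eq_fun do rewrite mxE.
  by apply: measurable_sum => k; exact: measurable_funM.
have Einv (Q : 'M[R]_d) a c : Q^T *m Q = 1%:M ->
    Ex P (fun w => (Q *m u w) a 0 * (Q *m u w) c 0)
    = Ex P (fun w => u w a 0 * u w c 0).
  move=> QQ; apply: (@Ex_eq_law _ _ _ P _ (borel_mx d 1) (fun w => Q *m u w) u
    (fun x => x a 0 * x c 0)) => //.
  - by apply: measurable_funM; exact: measurable_coord.
  - by move=> B mB; exact: inv.
have mdot : measurable_fun setT (fun w => dot (u w) (u w)).
  exact: measurable_fun_dot.
have u1 : {ae P, forall w, dot (u w) (u w) = 1}.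
  have mS : measurable [set w | dot (u w) (u w) = 1].
    rewrite (_ : [set w | _] = (fun w => dot (u w) (u w)) @^-1` [set 1])//.
    by rewrite -[X in measurable X]setTI; exact: mdot.
  exists (~` [set w | dot (u w) (u w) = 1]); split=> //.
  - exact: measurableC.
  - rewrite probability_setC// (_ : [set w | _] = [set w | fnorm (u w) = 1]).
      by rewrite P1 subee.
    apply/seteqP; split=> w /= uw.
      by rewrite -[LHS]ger0_norm ?fnorm_ge0// -sqrtr_sqr fnorm2 uw sqrtr1.
    by rewrite -fnorm2 uw expr1n.
have iu2 a c : rint P (fun w => u w a 0 * u w c 0).
  apply: aebnd_rint; split; first exact: measurable_funM.
  exists 1; apply: filterS u1 => w u1; rewrite normrM.
  have H i : `|u w i 0| <= 1.
    by rewrite -(ler_pXn2r (n := 2))// ?nnegrE// expr1n real_normK ?num_real//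
      -u1 coord_le_dot.
  by rewrite -[leRHS]mulr1 ler_pM.
have off a c : a != c -> Ex P (fun w => u w a 0 * u w c 0) = 0.
  move=> ac; pose q : 'rV[R]_d := \row_j (if j == a then -1 else 1).
  have := Einv (diag_mx q) a c.
  rewrite tr_diag_mx mulmx_diag => /(_ _).
  have -> : (fun w => (diag_mx q *m u w) a 0 * (diag_mx q *m u w) c 0) =
     (fun w => -1 * (u w a 0 * u w c 0)).
    apply/funext => w; rewrite mul_diag_mx !mxE eqxx eq_sym (negbTE ac); lra.
  rewrite ExZ// => H; suff : -1 * Ex P (fun w => u w a 0 * u w c 0) =
     Ex P (fun w => u w a 0 * u w c 0) by lra.
  apply: H; rewrite -[RHS]diag_const_mx; congr diag_mx; apply/rowP => j.
  by rewrite !mxE; case: eqP => _; rewrite ?mulrNN mulr1.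
have diag a c : Ex P (fun w => u w a 0 * u w a 0) = Ex P (fun w => u w c 0 * u w c 0).
  rewrite -(Einv (perm_mx (tperm a c)) c c).
    by congr (Ex P); apply/funext => w; rewrite -row_permE !mxE tpermR.
  by rewrite tr_perm_mx -perm_mxM mulVg perm_mx1.
split=> // a c; have [->|ac] := eqVneq a c; last by rewrite off// mul0r.
have : Ex P (fun w => dot (u w) (u w)) = 1.
  by rewrite (Ex_ae_eq (Y := fun=> 1)) ?Ex_cst.
under [X in Ex P X]eq_fun do rewrite dot_cV.
rewrite Ex_sum// (eq_bigr (fun=> Ex P (fun w => u w c 0 * u w c 0))) => [|i _]; last exact: diag.
rewrite sumr_const card_ord => H.
by apply: (mulIf d_neq0); rewrite mulr_natr H divfK.
Qed.

End uniform_directions.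

(** * Averages over tuples of distinct indices *)

Section injective_tuples.
Context {R : realType} {n b : nat}.
Implicit Types (t : b.-tuple 'I_n) (g : {perm 'I_n}).

Let N : R := (n ^_ b)%:R.

Lemma sum_uniq_tuples : \sum_(t : b.-tuple 'I_n | uniq t) (1 : R) = N.
Proof.
rewrite sumr_const /N; congr _%:R.
rewrite -[n in RHS]card_ord -(card_uniq_tuples b 'I_n); apply: eq_card => t.
rewrite inE/= (_ : all _ t); last exact/allP.
by rewrite unfold_in.
Qed.

(** Relabelling preserves distinctness of entries; the symmetries of the sampling used below all
    come from this. *)
Lemma sum_uniq_perm (F : b.-tuple 'I_n -> R) g :
  \sum_(t : b.-tuple 'I_n | uniq t) F (map_tuple g t)
  = \sum_(t : b.-tuple 'I_n | uniq t) F t.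
Proof.
rewrite [RHS](reindex_inj (h := fun t => map_tuple g t)) => [|t1 t2 /(congr1 val)/=].
  by apply: eq_bigl => t; rewrite /= map_inj_uniq//; exact: perm_inj.
by move=> /(inj_map (@perm_inj _ g)) /val_inj.
Qed.

Lemma sum_uniq_tnth (F : 'I_n -> R) r :
  n%:R * \sum_(t : b.-tuple 'I_n | uniq t) F (tnth t r) = N * \sum_i F i.
Proof.
(* The number of tuples with r-th entry i, the same for all i by transposition; the claim follows by
   grouping tuples by that entry. *)
pose c i : R := \sum_(t : b.-tuple 'I_n | uniq t) (tnth t r == i)%:R.
have E (G : 'I_n -> R) : \sum_(t : b.-tuple 'I_n | uniq t) G (tnth t r)
    = \sum_i c i * G i.
  under [RHS]eq_bigr do rewrite mulr_suml.
  rewrite exchange_big/=; apply: eq_bigr => t _.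
  by rewrite (bigD1 (tnth t r))//= eqxx mul1r big1 ?addr0// => i /negbTE;
    rewrite eq_sym => ->; rewrite mul0r.
have cc i j : c i = c j.
  rewrite /c -(sum_uniq_perm _ (tperm i j)); apply: eq_bigr => t _.
  by rewrite tnth_map -{2}(tpermR i j) (inj_eq perm_inj).
case: (posnP n) => [n0|n_gt0].
  rewrite [X in X%:R]n0 mul0r big1 ?mulr0// => i _.
  by case: i => i ilt; exfalso; rewrite n0 in ilt.
pose i0 := Ordinal n_gt0.
have NE : N = n%:R * c i0.
  rewrite -sum_uniq_tuples (E (fun=> 1)) (eq_bigr (fun=> c i0)).
    by rewrite sumr_const card_ord mulr_natl.
  by move=> i _; rewrite mulr1.
rewrite E NE -mulrA; congr (_ * _); rewrite mulr_sumr.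
by apply: eq_bigr => i _; rewrite (cc i i0).
Qed.

(** The difference of the two sides is half of the sum of |z_i - z_j|^2 over all pairs. *)
Lemma dot_sum_CS m p (z : 'I_n -> 'M[R]_(m, p)) :
  dot (\sum_i z i) (\sum_i z i) <= n%:R * \sum_i dot (z i) (z i).
Proof.
have : 0 <= \sum_i \sum_j dot (z i - z j) (z i - z j).
  by apply: sumr_ge0 => i _; apply: sumr_ge0 => j _; exact: dot_ge0.
have -> : \sum_i \sum_j dot (z i - z j) (z i - z j) =
    2 * (n%:R * \sum_i dot (z i) (z i)) - 2 * dot (\sum_i z i) (\sum_i z i).
  have key i j : dot (z i - z j) (z i - z j) =
      dot (z i) (z i) + dot (z j) (z j) - 2 * dot (z i) (z j).
    by rewrite !dotE (dotC (z j) (z i)); lra.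
  under eq_bigr => i _.
    under eq_bigr => j _ do rewrite key.
    rewrite sumrB big_split/= sumr_const card_ord -mulr_sumr -dot_sumr.
    over.
  rewrite sumrB big_split/= -!mulr_sumr -dot_suml sumr_const card_ord sumrMnl.
  by rewrite -[_ *+ n]mulr_natl; lra.
lra.
Qed.

(* Sampling without replacement makes distinct draws negatively correlated. *)
Lemma sum_uniq_tnth2 m p (z : 'I_n -> 'M[R]_(m, p)) r s : r != s ->
  n%:R ^+ 2 * \sum_(t : b.-tuple 'I_n | uniq t) dot (z (tnth t r)) (z (tnth t s))
  <= N * dot (\sum_i z i) (\sum_i z i).
Proof.
move=> rs.
pose c i j : R :=
  \sum_(t : b.-tuple 'I_n | uniq t) ((tnth t r == i) && (tnth t s == j))%:R.
have E (G : 'I_n -> 'I_n -> R) :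
    \sum_(t : b.-tuple 'I_n | uniq t) G (tnth t r) (tnth t s)
    = \sum_i \sum_j c i j * G i j.
  under [RHS]eq_bigr => i _.
    under eq_bigr do rewrite mulr_suml.
    rewrite exchange_big/=; over.
  rewrite exchange_big/=; apply: eq_bigr => t _.
  rewrite (bigD1 (tnth t r))//= (bigD1 (tnth t s))//= !eqxx mul1r.
  rewrite big1 ?addr0 ?big1 ?addr0// => [i /negbTE ir|j /negbTE js].
    by apply: big1 => j _; rewrite eq_sym ir mul0r.
  by rewrite [_ == j]eq_sym js andbF mul0r.
have cd i : c i i = 0.
  rewrite /c big1// => t ut; case: eqP => // <-; case: eqP => //= ts.
  by have /tuple_uniqP/(_ _ _ ts) sr := ut; rewrite sr eqxx in rs.
have cp (g : {perm 'I_n}) i j : c (g i) (g j) = c i j.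
  rewrite /c -(sum_uniq_perm _ g); apply: eq_bigr => t _.
  by rewrite !tnth_map !(inj_eq perm_inj).
(* Two transpositions carry one off-diagonal pair to any other: the first sends i to i', the second
   sends the image of j to j' and fixes i'. *)
have cc i j i' j' : i != j -> i' != j' -> c i j = c i' j'.
  move=> ij ij'; rewrite -(cp (tperm i i') i j) tpermL.
  set j1 := tperm i i' j.
  have j1i : i' != j1 by rewrite -[i'](tpermL i i') (inj_eq perm_inj).
  by rewrite -(cp (tperm j1 j') i' j1) tpermL tpermD// eq_sym.
have c0 i j : 0 <= c i j by apply: sumr_ge0 => t _; rewrite ler0n.
(* So c is a constant q off the diagonal and 0 on it; if no two indices differ, q = 0 serves. *)
have [q q0 cq] : exists2 q, 0 <= q & forall i j, c i j = q * (i != j)%:R.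
  case: (pickP (fun ij : 'I_n * 'I_n => ij.1 != ij.2)) => [[i0 j0] /= ij0|H].
    exists (c i0 j0) => // i j; case: eqVneq => [->|ij]; first by rewrite cd mulr0.
    by rewrite mulr1; exact: cc.
  exists 0 => // i j; have := H (i, j) => /= /negbFE/eqP ->; rewrite cd mul0r//.
have EE (G : 'I_n -> 'I_n -> R) :
    \sum_(t : b.-tuple 'I_n | uniq t) G (tnth t r) (tnth t s)
    = q * (\sum_i \sum_j G i j - \sum_i G i i).
  rewrite E -sumrB mulr_sumr; apply: eq_bigr => i _.
  rewrite [in RHS](bigD1 i)//= addrAC subrr add0r mulr_sumr.
  rewrite (bigD1 i)//= cd mul0r add0r; apply: eq_bigr => j ji.
  by rewrite cq eq_sym ji mulr1.
rewrite -sum_uniq_tuples (EE (fun _ _ => 1)) (EE (fun i j => dot (z i) (z j))).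
have -> : \sum_(i < n) \sum_(j < n) (1 : R) = n%:R ^+ 2.
  by rewrite !sumr_const !card_ord expr2 -natrM -mulrnA.
have -> : \sum_(i < n) (1 : R) = n%:R by rewrite sumr_const card_ord.
have -> : \sum_i \sum_j dot (z i) (z j) = dot (\sum_i z i) (\sum_i z i).
  by rewrite dot_suml; apply: eq_bigr => i _; rewrite dot_sumr.
(* Since N = q (n^2 - n), the claim reduces to q n times the inequality |sum z|^2 <= n sum |z|^2. *)
have := ler_wpM2l (mulr_ge0 q0 (ler0n R n)) (dot_sum_CS z).
rewrite expr2; lra.
Qed.

End injective_tuples.

(** * Pathwise bounds *)

Section zeroth_order.
Context {R : realType} {n d : nat}.
Variables (f : 'I_n -> 'cV[R]_d -> R) (L : R).
Hypotheses (f_diff : forall i x, differentiable (f i) x) (L_gt0 : 0 < L)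
  (f_smooth : forall i, smooth L (f i))
  (f_convex : forall i, strongly_convex 0 (f i)).

Definition zo_error (x u : 'cV[R]_d) (be : R) (i : 'I_n) : R :=
  (f i (x + be *: u) - f i x) / be - dot (grad (f i) x) u.

Lemma zo_error_bounds x u be i : 0 < be -> dot u u = 1 ->
  0 <= zo_error x u be i <= L * be / 2.
Proof.
move=> be0 u1.
have lo := strongly_convex_lower (be *: u)
  (fun v => smooth_lower_weak x v (ltW L_gt0) (f_diff i) (f_smooth i)) (f_convex i).
have hi := smooth_upper x (be *: u) (ltW L_gt0) (f_diff i) (f_smooth i).
move: lo hi; rewrite /zo_error !dotE u1 => lo hi.
have K X : be * (X / be) = X by rewrite mulrCA divff ?mulr1// gt_eqF.
rewrite -(ler_pM2l be0) -[_ <= L * be / 2](ler_pM2l be0) mulrBr K.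
by apply/andP; split; lra.
Qed.

Lemma correctionE x (J : 'M[R]_(d, n)) be i u :
  correction f x J be (i, u) =
  (dot (grad (f i) x - col i J) u + zo_error x u be i) *: u.
Proof.
rewrite /correction /zo_grad/= mulmx_outer -scalerBl /zo_error dotDl dotNl (dotC u).
by congr (_ *: _); lra.
Qed.

(** The quadratic form of [Pop s], as [dot_Pop] confirms; assumption (iii) makes its average sigma
    |A|^2. *)
Definition Qop (s : {fset 'I_n * 'cV[R]_d}) (A : 'M[R]_(d, n)) : R :=
  \sum_(q <- s) dot q.2 (col q.1 A) ^+ 2.

Lemma colE_mul m (A : 'M[R]_(m, n)) i : A *m (delta_mx i 0 : 'cV[R]_n) = col i A.
Proof. by rewrite colE. Qed.

Lemma dot_outer m (a : 'cV[R]_m) (A : 'M[R]_(m, n)) i :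
  dot (a *m (delta_mx 0 i : 'rV[R]_n)) A = dot a (col i A).
Proof.
rewrite dot_cols (bigD1 i)//= big1 ?addr0 => [|j ji].
  by congr dot; apply/matrixP => k l; rewrite [l]ord1 mxE !mxE big_ord1 !mxE !eqxx mulr1.
rewrite [X in dot X _](_ : _ = 0) ?dot0l//.
by apply/matrixP => k l; rewrite !mxE big_ord1 !mxE (negbTE ji) andbF mulr0.
Qed.

Lemma dot_Pop s (A : 'M[R]_(d, n)) : dot (Pop s A) A = Qop s A.
Proof.
rewrite /Pop dot_suml; apply: eq_bigr => q _.
by rewrite dot_outer -mulmxA colE_mul mulmx_outer dotZl expr2.
Qed.

Lemma Qop_slices s A : Qop s A = \sum_i \sum_(u <- slice i s) dot u (col i A) ^+ 2.
Proof. exact: (big_slices (fun i u => dot u (col i A) ^+ 2)). Qed.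

Lemma orthonormal_slice (s : {fset 'I_n * 'cV[R]_d}) i : orthonormal_slices s ->
  uniq (slice i s) /\
  {in slice i s &, forall u v, dot u v = (u == v)%:R}.
Proof.
move=> os; split.
  rewrite map_inj_in_uniq; first by rewrite filter_uniq// fset_uniq.
  move=> [i1 u1] [i2 u2]; rewrite !mem_filter /=.
  by move=> /andP[/eqP -> _] /andP[/eqP -> _] ->.
move=> u v /mapP[[i1 u1]]; rewrite mem_filter/= => /andP[/eqP -> iu] ->.
move=> /mapP[[i2 u2]]; rewrite mem_filter/= => /andP[/eqP -> iv] ->.
by rewrite -(os i)// mulmxTcV !mxE.
Qed.

(** The update overwrites the coordinate <u, B> by [a u] for each u in r and leaves the orthogonal
    complement alone, so Pythagoras applies. *)
Lemma orthonormal_update (r : seq 'cV[R]_d) (a : 'cV[R]_d -> R) (B : 'cV[R]_d) :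
  uniq r -> {in r &, forall u v, dot u v = (u == v)%:R} ->
  let X := B + \sum_(u <- r) (a u - dot u B) *: u in
  dot X X = dot B B + \sum_(u <- r) (a u ^+ 2 - dot u B ^+ 2).
Proof.
move=> ur ro /=; set S := \sum_(u <- r) _ *: _.
have SB : dot S B = \sum_(u <- r) (a u - dot u B) * dot u B.
  by rewrite dot_suml; apply: eq_bigr => u _; rewrite dotZl.
have SS : dot S S = \sum_(u <- r) (a u - dot u B) ^+ 2.
  rewrite dot_suml !big_seq; apply: eq_bigr => u ru.
  rewrite dotZl dot_sumr (bigD1_seq u)//= dotZr [dot u u]ro// eqxx mulr1.
  rewrite big_seq_cond big1 ?addr0 ?expr2// => v /andP[rv vu].
  by rewrite dotZr [dot u v]ro// eq_sym (negbTE vu) mulr0.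
rewrite dotDl !dotDr (dotC B S) SB SS -addrA; congr (_ + _).
by rewrite -!big_split/=; apply: eq_bigr => u _; lra.
Qed.

Lemma col_Jstep x (J : 'M[R]_(d, n)) be s i :
  col i (Jstep f x J be true s) =
  col i J + \sum_(u <- slice i s)
    (dot (grad (f i) x - col i J) u + zo_error x u be i) *: u.
Proof.
rewrite /Jstep scale1r linearD/=; congr (_ + _).
rewrite linear_sum/=.
transitivity (\sum_(q <- s) (if q.1 == i then correction f x J be q else 0)).
  apply: eq_bigr => q _; apply/matrixP => k l; rewrite [l]ord1 mxE [LHS]mxE big_ord1.
  rewrite [delta_mx _ _ _ _]mxE eqxx eq_sym; case: eqP => _; first by rewrite mulr1.
  by rewrite mulr0 mxE.
rewrite -big_mkcond/= /slice big_map big_filter; apply: eq_bigr => -[j u] /= /eqP ->.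
exact: correctionE.
Qed.

(** Along each sampled u the column of J - grad F(y) gets the new coordinate <u, H> + e, whose
    square is at most 2 <u, H>^2 + 2 e^2, with 2 e^2 <= L^2 beta^2 / 2. *)
Lemma Jstep_bound x y (J : 'M[R]_(d, n)) be (om : bool) s : 0 < be ->
  orthonormal_slices s ->
  let B := J - gradF f y in let H := gradF f x - gradF f y in
  let X := Jstep f x J be om s - gradF f y in
  dot X X <= dot B B - om%:R * Qop s B + 2 * (om%:R * Qop s H)
    + L ^+ 2 * be ^+ 2 / 2 * (om%:R * (#|` s|)%:R).
Proof.
move=> be0 os /=; set B := J - _; set H := gradF f x - _; case: om; last first.
  by rewrite /Jstep scale0r addr0 -/B !mul0r !mulr0 subr0 !addr0.
set X := Jstep f x J be true s - _; rewrite !mul1r.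
have -> : (#|` s|)%:R = \sum_i \sum_(u <- slice i s) (1 : R).
  rewrite -(big_slices (fun _ _ => 1)) big_const_seq count_predT iter_addr_0.
  by [].
rewrite !Qop_slices dot_cols [dot B B]dot_cols -sumrB !mulr_sumr -!big_split/=.
apply: ler_sum => i _.
have [us os'] := orthonormal_slice i os.
have -> : col i X = col i B + \sum_(u <- slice i s)
   ((dot u (col i H) + zo_error x u be i) - dot u (col i B)) *: u.
  rewrite /X linearB/= col_Jstep /B linearB/= addrAC; congr (_ + _).
  apply: eq_bigr => u _; congr (_ *: _).
  rewrite /H linearB/= (dotC u) (dotC u (_ - _)) -!dotE.
  have -> : grad (f i) x = col i (gradF f x).
    by apply/matrixP => a c; rewrite [c]ord1 !mxE.
  by rewrite !dotE; lra.
rewrite orthonormal_update//= -!addrA lerD2l -sumrN !mulr_sumr -!big_split/=.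
rewrite !big_seq; apply: ler_sum => u us'.
have u1 : dot u u = 1 by rewrite os'// eqxx.
have /andP[e0 e1] := zo_error_bounds x i be0 u1.
move: (zo_error x u be i) e0 e1 => e e0 e1.
have e2 : e ^+ 2 <= (L * be / 2) ^+ 2.
  by rewrite ler_pXn2r// nnegrE// (le_trans e0).
have := sqr_ge0 (dot u (col i H) - e); move: e2; rewrite !expr2 mulr1; lra.
Qed.

End zeroth_order.

Section x_step.
Context {R : realType} {d b : nat}.
Hypothesis b_gt0 : (0 < b)%N.

(** [Z] is the linear part of the estimator and [e] its finite-difference errors. The bound is
    pathwise, as e_r depends on u_r. The cross term is kept as a sum of <v, u_r>^2, which averages
    to b |v|^2 / d and thus costs only al mu/2 |v|^2. *)
Lemma x_step_bound (al mu ep : R) (v Z : 'cV[R]_d) (e : 'I_b -> R)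
    (u : 'I_b -> 'cV[R]_d) : 0 < al -> 0 < mu ->
  (forall r, 0 <= e r <= ep) -> (forall r, dot (u r) (u r) = 1) ->
  let X := v - al *: (Z + (d%:R / b%:R) *: \sum_r e r *: u r) in
  dot X X <= dot v v - 2 * al * dot v Z
   + al * (mu / 2) * (d%:R / b%:R) * (\sum_r dot v (u r) ^+ 2)
   + 2 * al / mu * d%:R * ep ^+ 2
   + 2 * al ^+ 2 * dot Z Z + 2 * al ^+ 2 * d%:R ^+ 2 * ep ^+ 2.
Proof.
move=> al0 mu0 eb u1 /=; set X := v - _.
have b0 : (b%:R : R) != 0 by rewrite pnatr_eq0 -lt0n.
have bb : d%:R / b%:R * b%:R = d%:R :> R by rewrite divfK.
have db0 : 0 <= d%:R / b%:R :> R by rewrite divr_ge0.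
set S := \sum_r e r *: u r in X *.
have e2 r : e r ^+ 2 <= ep ^+ 2.
  have /andP[e0 e1] := eb r.
  by rewrite ler_pXn2r// nnegrE// (le_trans e0).
have SS : dot S S <= b%:R ^+ 2 * ep ^+ 2.
  apply: le_trans (dot_sum_CS _) _; rewrite expr2 -mulrA ler_wpM2l//.
  apply: (@le_trans _ _ (\sum_(r < b) ep ^+ 2)).
    by apply: ler_sum => r _; rewrite dotZl dotZr u1 mulr1 -expr2.
  by rewrite sumr_const card_ord mulr_natl.
have vS : - 2 * dot v S <= mu / 2 * (\sum_r dot v (u r) ^+ 2)
    + b%:R * (2 / mu * ep ^+ 2).
  rewrite dot_sumr !mulr_sumr -[X in _ <= _ + X](_ : \sum_(r < b) (2 / mu * ep ^+ 2) = _).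
    rewrite -big_split/=; apply: ler_sum => r _; rewrite dotZr.
    (* Young's inequality with weight mu: this square divided by 2 mu is mu/2 <v, u>^2 + 2 <v, u> e
       + 2 e^2 / mu. *)
    have := sqr_ge0 (mu * dot v (u r) + 2 * e r) => H.
    have i0 : 0 <= (2 * mu)^-1 by rewrite invr_ge0 mulr_ge0// ltW.
    have := ler_wpM2l i0 H; rewrite mulr0 => {}H.
    have K Y : mu^-1 * (mu * Y) = Y by rewrite mulKf// gt_eqF.
    have H1 := K (mu * dot v (u r) ^+ 2); have H2 := K (dot v (u r) * e r).
    have H3 := ler_wpM2l (_ : 0 <= 2 / mu) (e2 r).
    have {}H3 := H3 (divr_ge0 (ler0n _ 2) (ltW mu0)).
    by move: H; rewrite invfM; move: H3; rewrite !expr2 in H1 *; lra.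
  by rewrite sumr_const card_ord [RHS]mulr_natl.
have ZS := dotD2_le Z ((d%:R / b%:R) *: S).
have -> : dot X X = dot v v - 2 * al * dot v Z
    + al * (d%:R / b%:R) * (- 2 * dot v S)
    + al ^+ 2 * dot (Z + (d%:R / b%:R) *: S) (Z + (d%:R / b%:R) *: S).
  have := dotDr v Z ((d%:R / b%:R) *: S); rewrite dotZr /X.
  by move: (Z + _) => G vG; rewrite !dotE (dotC G v) vG; lra.
have {vS} := ler_wpM2l (mulr_ge0 (ltW al0) db0) vS.
have {ZS} := ler_wpM2l (sqr_ge0 al) ZS.
have := ler_wpM2l (sqr_ge0 (al * (d%:R / b%:R))) SS.
rewrite [dot (_ *: S) _]dotZl dotZr.
have B1 := congr1 (fun t => al * (2 / mu * ep ^+ 2) * t) bb.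
have B2 := congr1 (fun t => al ^+ 2 * ep ^+ 2 * (t * t)) bb.
move: B1 B2 => /=; rewrite !expr2; lra.
Qed.

End x_step.

(** * Expectation over the batch *)

Section batch_expectation.
Context {R : realType} {dT : measure_display} {T : measurableType dT}.
Variable P : probability T R.
Context {n b : nat}.
Hypotheses (n_gt0 : (0 < n)%N) (b_le_n : (b <= n)%N).
Variable I : T -> b.-tuple 'I_n.
Hypotheses (mI : forall t, measurable [set w | I w = t])
  (unifI : without_replacement P I).

Let N : R := (n ^_ b)%:R.
Let N_gt0 : 0 < N. Proof. by rewrite ltr0n ffact_gt0. Qed.
Let n_neq0 : (n%:R : R) != 0. Proof. by rewrite pnatr_eq0 -lt0n. Qed.

Let Ex_batch (phi : b.-tuple 'I_n -> R) : rint P (fun w => phi (I w)) /\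
  Ex P (fun w => phi (I w)) = N^-1 * \sum_(t : b.-tuple 'I_n | uniq t) phi t.
Proof.
have [iphi ->] := Ex_finite_valued P phi mI; split=> //.
rewrite mulr_sumr [RHS]big_mkcond; apply: eq_bigr => t _.
by rewrite unifI; case: ifP => _; rewrite /= ?mulr0// mulrC.
Qed.

Lemma rint_batch phi : rint P (fun w => phi (I w)).
Proof. by have [] := Ex_batch phi. Qed.

Lemma Ex_batch_tnth (phi : 'I_n -> R) r :
  Ex P (fun w => phi (tnth (I w) r)) = n%:R^-1 * \sum_i phi i.
Proof.
have [_ ->] := Ex_batch (fun t => phi (tnth t r)).
apply: (mulfI n_neq0); rewrite mulrCA sum_uniq_tnth mulKf ?gt_eqF//.
by rewrite mulVKf.
Qed.

Lemma Ex_batch_tnth2 m p (z : 'I_n -> 'M[R]_(m, p)) r s : r != s ->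
  Ex P (fun w => dot (z (tnth (I w) r)) (z (tnth (I w) s))) <=
  n%:R ^- 2 * dot (\sum_i z i) (\sum_i z i).
Proof.
move=> rs.
have [_ ->] := Ex_batch (fun t => dot (z (tnth t r)) (z (tnth t s))).
have n2 : 0 < (n%:R : R) ^+ 2 by rewrite exprn_gt0// ltr0n.
rewrite -(ler_pM2l n2) mulVKf ?gt_eqF// mulrCA ler_pdivrMl//.
exact: sum_uniq_tnth2.
Qed.

Hypothesis b_gt0 : (0 < b)%N.

(** The integrand is the second moment of [sketch] for given indices, with [k] in place of d.
    Negative correlation bounds each of the b (b - 1) off-diagonal terms by |zb|^2; counting them as
    b^2 completes the square |A + zb|^2. *)
Lemma Ex_batch_sketch m (z : 'I_n -> 'cV[R]_m) (A : 'cV[R]_m) (k : R) :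
  let zb := n%:R^-1 *: \sum_i z i in
  Ex P (fun w => dot A A + 2 / b%:R * \sum_r dot A (z (tnth (I w) r))
  + k / b%:R ^+ 2 * \sum_r dot (z (tnth (I w) r)) (z (tnth (I w) r))
  + b%:R ^- 2 * \sum_r \sum_(s | s != r)
      dot (z (tnth (I w) r)) (z (tnth (I w) s)))
  <= dot (A + zb) (A + zb) + k / b%:R * (n%:R^-1 * \sum_i dot (z i) (z i)).
Proof.
move=> /=; set zb := _ *: _.
have b0 : (b%:R : R) != 0 by rewrite pnatr_eq0 -lt0n.
have i1 r : rint P (fun w => dot A (z (tnth (I w) r))).
  exact: (rint_batch (fun t => dot A (z (tnth t r)))).
have i2 r s : rint P (fun w => dot (z (tnth (I w) r)) (z (tnth (I w) s))).
  exact: (rint_batch (fun t => dot (z (tnth t r)) (z (tnth t s)))).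
have i3 : rint P (fun w => \sum_r dot A (z (tnth (I w) r))) by exact: rint_sum.
have i4 : rint P (fun w => \sum_r dot (z (tnth (I w) r)) (z (tnth (I w) r))).
  exact: rint_sum.
have i5 r : rint P (fun w => \sum_(s | s != r)
    dot (z (tnth (I w) r)) (z (tnth (I w) s))) by exact: rint_sum.
have i6 : rint P (fun w => \sum_r \sum_(s | s != r)
    dot (z (tnth (I w) r)) (z (tnth (I w) s))) by exact: rint_sum.
have ic := rint_cst P (dot A A).
rewrite ExD; [|by apply: rintD; [apply: rintD|]; rewrite //; apply: rintZ|exact: rintZ].
rewrite ExD; [|by apply: rintD => //; apply: rintZ|exact: rintZ].
rewrite ExD//; last exact: rintZ.
rewrite Ex_cst !ExZ// !Ex_sum//.
have E1 r : Ex P (fun w => dot A (z (tnth (I w) r))) =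
    n%:R^-1 * \sum_i dot A (z i).
  exact: (Ex_batch_tnth (fun i => dot A (z i))).
have E2 r : Ex P (fun w => dot (z (tnth (I w) r)) (z (tnth (I w) r))) =
    n%:R^-1 * \sum_i dot (z i) (z i).
  exact: (Ex_batch_tnth (fun i => dot (z i) (z i))).
rewrite (eq_bigr _ (fun r _ => E1 r)) (eq_bigr _ (fun r _ => E2 r)).
rewrite !sumr_const card_ord -dot_sumr -[dot A _ in X in X <= _]mulr1.
have -> : n%:R^-1 * dot A (\sum_i z i) = dot A zb by rewrite dotZr.
have last : \sum_r Ex P (fun w => \sum_(s | s != r)
      dot (z (tnth (I w) r)) (z (tnth (I w) s))) <= b%:R ^+ 2 * dot zb zb.
  have zz : n%:R ^- 2 * dot (\sum_i z i) (\sum_i z i) = dot zb zb.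
    by rewrite /zb dotZl dotZr expr2 invfM mulrA.
  rewrite expr2 -mulrA mulr_natl -[in leRHS](card_ord b) -sumr_const.
  apply: ler_sum => r _; rewrite Ex_sum//.
  apply: (@le_trans _ _ (\sum_(s | s != r) dot zb zb)).
    by apply: ler_sum => s sr; rewrite -zz; apply: Ex_batch_tnth2; rewrite eq_sym.
  rewrite sumr_const -[_ *+ _]mulr_natl ler_wpM2r ?dot_ge0// ler_nat.
  exact: max_card.
have b2 : 0 <= b%:R ^- 2 :> R by rewrite invr_ge0 exprn_ge0.
have {b2 last} := ler_wpM2l b2 last.
rewrite mulKf ?expf_neq0//.
rewrite -[dot A zb *+ b]mulr_natl -[(n%:R^-1 * _) *+ b]mulr_natl => last.
have K (X Y : R) : X / b%:R * (b%:R * Y) = X * Y by rewrite mulrA divfK.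
have K2 (X Y : R) : X / b%:R ^+ 2 * (b%:R * Y) = X / b%:R * Y.
  by rewrite expr2 invfM !mulrA divfK.
rewrite mulr1 K K2 dotDl !dotDr (dotC zb A); lra.
Qed.

End batch_expectation.

Section x_expectation.
Context {R : realType} {dT : measure_display} {T : measurableType dT}.
Variable P : probability T R.
Context {n d b : nat}.
Hypotheses (n_gt0 : (0 < n)%N) (d_gt0 : (0 < d)%N) (b_gt0 : (0 < b)%N)
  (b_le_n : (b <= n)%N).
Variables (f : 'I_n -> 'cV[R]_d -> R) (L : R).
Hypotheses (f_diff : forall i x, differentiable (f i) x) (L_gt0 : 0 < L)
  (f_smooth : forall i, smooth L (f i))
  (f_convex : forall i, strongly_convex 0 (f i)).
Variables (I : T -> b.-tuple 'I_n) (U : T -> b.-tuple 'cV[R]_d).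
Hypotheses (mI : forall t, measurable [set w | I w = t])
  (unifI : without_replacement P I)
  (isoU : forall r, isotropic P (fun w => tnth (U w) r))
  (indU : forall r s, r != s ->
     @independent _ _ _ P _ _ (borel_mx d 1) (borel_mx d 1)
       (fun w => tnth (U w) r) (fun w => tnth (U w) s)).
Variables (x y : 'cV[R]_d) (J : 'M[R]_(d, n)) (al mu be : R).
Hypotheses (al0 : 0 < al) (mu0 : 0 < mu) (be0 : 0 < be).

(** The gradient of [favg f]. *)
Definition gmean (x : 'cV[R]_d) : 'cV[R]_d := n%:R^-1 *: \sum_i grad (f i) x.

Let v := x - y.
Let gy := gmean y.
Let A := n%:R^-1 *: (J *m const_mx 1) - gy.
Let z i := grad (f i) x - col i J.
Let zsum := \sum_i dot (z i) (z i).

(** With y the minimizer, the bound that nonexpansiveness gives on the squared distance after the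
    prox step. *)
Definition xgap (t : b.-tuple 'I_n) (u : b.-tuple 'cV[R]_d) : R :=
  let X := x - al *: gstep f x J be t u - (y - al *: gy) in dot X X.

(** An upper bound for the mean of [xgap] over the directions, the indices being frozen. The error
    terms are those of [x_step_bound] for e <= L be / 2. *)
Definition xgap_mean (t : b.-tuple 'I_n) : R :=
  (1 + al * mu / 2) * dot v v
  - 2 * al * dot v (A + b%:R^-1 *: \sum_r z (tnth t r))
  + al * d%:R * L ^+ 2 * be ^+ 2 / (2 * mu)
  + 2 * al ^+ 2 * (dot A A + 2 / b%:R * \sum_r dot A (z (tnth t r))
     + d%:R / b%:R ^+ 2 * \sum_r dot (z (tnth t r)) (z (tnth t r))
     + b%:R ^- 2 * \sum_r \sum_(s | s != r) dot (z (tnth t r)) (z (tnth t s)))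
  + al ^+ 2 * d%:R ^+ 2 * L ^+ 2 * be ^+ 2 / 2.

Lemma integral_xgap t : measurable_fun setT (fun w => xgap t (U w)) ->
  (\int[P]_w (xgap t (U w))%:E <= (xgap_mean t)%:E)%E.
Proof.
move=> mx.
pose u r w := tnth (U w) r.
pose Z := sketch u (fun r => z (tnth t r)) A.
have d0 : (d%:R : R) != 0 by rewrite pnatr_eq0 -lt0n.
have b0 : (b%:R : R) != 0 by rewrite pnatr_eq0 -lt0n.
have bZ := aebnd_dot_sketch (fun r => z (tnth t r)) A isoU v.
have bZ2 := aebnd_sketch2 (fun r => z (tnth t r)) A isoU.
have bu r : aebnd P (fun w => dot v (u r w) ^+ 2).
  by under [X in aebnd _ X]eq_fun do rewrite expr2;
    apply: aebndM; exact: (isotropic_dot v (isoU r)).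
have iS : rint P (fun w => \sum_r dot v (u r w) ^+ 2).
  by apply: rint_sum => r; exact: aebnd_rint.
pose ep := L * be / 2.
pose c0 := dot v v + 2 * al / mu * d%:R * ep ^+ 2
  + 2 * al ^+ 2 * d%:R ^+ 2 * ep ^+ 2.
pose Y w := c0 + ((- (2 * al)) * dot v (Z w)
  + (al * (mu / 2) * (d%:R / b%:R) * (\sum_r dot v (u r w) ^+ 2)
  + 2 * al ^+ 2 * dot (Z w) (Z w))).
have i1 := rintZ (- (2 * al)) (aebnd_rint bZ).
have i2 := rintZ (al * (mu / 2) * (d%:R / b%:R)) iS.
have i3 := rintZ (2 * al ^+ 2) (aebnd_rint bZ2).
have i23 := rintD i2 i3; have i123 := rintD i1 i23.
have iY : rint P Y by apply: rintD => //; exact: rint_cst.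
have -> : xgap_mean t = Ex P Y.
  rewrite /Y (ExD (rint_cst P c0) i123) Ex_cst (ExD i1 i23) (ExD i2 i3).
  rewrite !ExZ//; [|exact: aebnd_rint|exact: aebnd_rint].
  rewrite Ex_dot_sketch// Ex_sketch2//.
  have -> : Ex P (fun w => \sum_r dot v (u r w) ^+ 2) = b%:R * (dot v v / d%:R).
    rewrite Ex_sum => [|r]; last exact: aebnd_rint.
    rewrite (eq_bigr (fun=> dot v v / d%:R)) => [|r _]; last first.
      by rewrite -(Ex_isotropic v v (isoU r)).
    by rewrite sumr_const card_ord -[_ *+ b]mulr_natl.
  have -> : al * (mu / 2) * (d%:R / b%:R) * (b%:R * (dot v v / d%:R))
      = al * (mu / 2) * dot v v.
    by rewrite -mulrA; congr (_ * _); rewrite mulrA divfK// mulrC divfK.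
  rewrite /xgap_mean /c0 /ep.
  rewrite invfM; move: (\sum_r dot A _) (\sum_r dot (z _) _)
    (\sum_r \sum_(s | s != r) _) (dot v (A + _)) => X1 X2 X3 X4.
  lra.
apply: integral_le_Ex => //.
  by move=> w; exact: dot_ge0.
have u1 : {ae P, forall w, forall r, dot (u r w) (u r w) = 1}.
  by apply: filter_forall => r; case: (isoU r).
apply: filterS u1 => w u1.
have eb r : 0 <= zo_error f x (u r w) be (tnth t r) <= ep.
  exact: zo_error_bounds.
have := x_step_bound b_gt0 v (Z w) al0 mu0 eb u1.
have <- : x - al *: gstep f x J be t (U w) - (y - al *: gy) =
   v - al *: (Z w + (d%:R / b%:R) *:
     \sum_r zo_error f x (u r w) be (tnth t r) *: u r w).
  rewrite opprB [al *: gy - y]addrC addrACA -/v; congr (_ + _).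
  rewrite -scalerN -scalerDr -scalerN; congr (_ *: _).
  rewrite /Z /sketch -addrA -scalerDr -big_split/= /gstep.
  rewrite /A [in RHS]addrAC [RHS]opprB [RHS]addrC.
  by congr (- (_ + _ *: _) + _); apply: eq_bigr => r _;
    rewrite correctionE scalerDl.
move=> /le_trans; apply; rewrite /Y /c0; lra.
Qed.

(** Averaging over the indices makes J cancel: its column mean enters [A] with a plus sign and the
    mean of the [z i] with a minus sign, which leaves grad f(x) - grad f(y). *)
Lemma Ex_xgap_mean :
  Ex P (fun w => xgap_mean (I w)) <=
  (1 + al * mu / 2) * dot v v - 2 * al * dot v (gmean x - gy)
  + al * d%:R * L ^+ 2 * be ^+ 2 / (2 * mu)
  + 2 * al ^+ 2 * (dot (gmean x - gy) (gmean x - gy)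
      + d%:R / b%:R * (n%:R^-1 * zsum))
  + al ^+ 2 * d%:R ^+ 2 * L ^+ 2 * be ^+ 2 / 2.
Proof.
have b0 : (b%:R : R) != 0 by rewrite pnatr_eq0 -lt0n.
pose zb := n%:R^-1 *: \sum_i z i.
have -> : gmean x - gy = A + zb.
  rewrite /A addrAC; congr (_ - _); rewrite /zb -scalerDr; congr (_ *: _).
  rewrite sumrB addrC [X in _ - X](_ : _ = J *m const_mx 1) ?subrK//.
  apply/matrixP => k l; rewrite summxE !mxE; apply: eq_bigr => i _.
  by rewrite !mxE mulr1.
pose q (t : b.-tuple 'I_n) := dot A A + 2 / b%:R * \sum_r dot A (z (tnth t r))
     + d%:R / b%:R ^+ 2 * \sum_r dot (z (tnth t r)) (z (tnth t r))
     + b%:R ^- 2 * \sum_r \sum_(s | s != r) dot (z (tnth t r)) (z (tnth t s)).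
pose l (t : b.-tuple 'I_n) := dot v (A + b%:R^-1 *: \sum_r z (tnth t r)).
pose c0 := (1 + al * mu / 2) * dot v v + al * d%:R * L ^+ 2 * be ^+ 2 / (2 * mu)
  + al ^+ 2 * d%:R ^+ 2 * L ^+ 2 * be ^+ 2 / 2.
have -> : (fun w => xgap_mean (I w)) =
    (fun w => c0 + ((- (2 * al)) * l (I w) + 2 * al ^+ 2 * q (I w))).
  by apply/funext => w; rewrite /xgap_mean -/(l (I w)) -/(q (I w)) /c0; lra.
have il : rint P (fun w => l (I w)) by exact: rint_batch.
have iq : rint P (fun w => q (I w)) by exact: rint_batch.
have i1 := rintZ (- (2 * al)) il; have i2 := rintZ (2 * al ^+ 2) iq.
rewrite (ExD (rint_cst P c0) (rintD i1 i2)) Ex_cst (ExD i1 i2) !ExZ//.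
have El : Ex P (fun w => l (I w)) = dot v (A + zb).
  have ir r : rint P (fun w => dot v (z (tnth (I w) r))).
    exact: (rint_batch mI unifI (fun t => dot v (z (tnth t r)))).
  rewrite /l; under [X in Ex _ X]eq_fun do rewrite dotDr dotZr dot_sumr.
  rewrite (ExD (rint_cst _ _)) ?Ex_cst; last by apply: rintZ; exact: rint_sum.
  rewrite ExZ; last exact: rint_sum.
  rewrite Ex_sum// (dotDr v A zb); congr (_ + _).
  have E1 r : Ex P (fun w => dot v (z (tnth (I w) r))) =
      n%:R^-1 * \sum_i dot v (z i).
    exact: (Ex_batch_tnth n_gt0 b_le_n mI unifI (fun i => dot v (z i))).
  rewrite (eq_bigr _ (fun r _ => E1 r)).
  have avg (k : R) : b%:R^-1 * \sum_(i < b) k = k.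
    by rewrite sumr_const card_ord -[k *+ b]mulr_natl mulKf.
  by rewrite avg [RHS]dotZr dot_sumr.
have := Ex_batch_sketch n_gt0 b_le_n mI unifI b_gt0 z A d%:R.
rewrite /= -/zb -/zsum El => H.
have {}H : Ex P (fun w => q (I w)) <=
   dot (A + zb) (A + zb) + d%:R / b%:R * (n%:R^-1 * zsum) by exact: H.
have := ler_wpM2l (sqr_ge0 al) H; rewrite /c0; lra.
Qed.

End x_expectation.

(** * The objective and the Lyapunov recursion *)

Section objective.
Context {R : realType} {n d : nat}.
Hypothesis n_gt0 : (0 < n)%N.
Variables (f : 'I_n -> 'cV[R]_d -> R) (L mu : R).
Hypotheses (f_diff : forall i x, differentiable (f i) x) (L_gt0 : 0 < L)
  (f_smooth : forall i, smooth L (f i))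
  (f_convex : forall i, strongly_convex 0 (f i))
  (f_strong : strongly_convex mu (favg f)).
Implicit Types x y v : 'cV[R]_d.

Let n_neq0 : (n%:R : R) != 0. Proof. by rewrite pnatr_eq0 -lt0n. Qed.
Let ni_ge0 : 0 <= n%:R^-1 :> R. Proof. by rewrite invr_ge0. Qed.

Let avg_cst (k : R) : n%:R^-1 * \sum_(i < n) k = k.
Proof. by rewrite sumr_const card_ord -[k *+ n]mulr_natl mulKf. Qed.

Definition bregman x y := favg f x - favg f y - dot (gmean f y) (x - y).

Lemma favg_upper x v :
  favg f (x + v) <= favg f x + dot (gmean f x) v + L / 2 * dot v v.
Proof.
rewrite /favg /gmean dotZl dot_suml -[L / 2 * dot v v]avg_cst.
rewrite -!mulrDr -!big_split/= ler_wpM2l//; apply: ler_sum => i _.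
exact: smooth_upper (ltW L_gt0) (f_diff i) (f_smooth i).
Qed.

Lemma favg_lower_weak x v :
  favg f x + dot (gmean f x) v - 3 / 2 * L * dot v v <= favg f (x + v).
Proof.
rewrite /favg /gmean dotZl dot_suml -[X in _ - X](avg_cst (3 / 2 * L * dot v v)).
rewrite -mulrN -!mulrDr -sumrN -!big_split/= ler_wpM2l//; apply: ler_sum => i _.
exact: smooth_lower_weak (ltW L_gt0) (f_diff i) (f_smooth i).
Qed.

(** Strong convexity is used with base point x and evaluated at y, so that the divergence based at y
    stays available beside the quadratic term. *)
Lemma bregman_strong x y :
  bregman x y + mu / 2 * dot (x - y) (x - y)
  <= dot (x - y) (gmean f x - gmean f y).
Proof.
have := strongly_convex_lower (y - x) (favg_lower_weak x) f_strong.
rewrite /bregman subrKC -[y - x]opprB; move: (x - y) => e.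
rewrite dotNl !dotNr opprK dotDr dotNr.
rewrite (dotC (gmean f x)) (dotC (gmean f y)); lra.
Qed.

Lemma sum_grad_diff_le x y :
  \sum_i dot (grad (f i) x - grad (f i) y) (grad (f i) x - grad (f i) y)
  <= 2 * L * (n%:R * bregman x y).
Proof.
have -> : n%:R * bregman x y =
    \sum_i (f i x - f i y - dot (grad (f i) y) (x - y)).
  rewrite /bregman /favg /gmean dotZl dot_suml !mulrBr !mulVKf//.
  by rewrite -!sumrB.
rewrite mulr_sumr; apply: ler_sum => i _.
exact: cocoercive.
Qed.

Lemma bregman_ge0 x y : 0 <= bregman x y.
Proof.
have : 0 <= 2 * L * (n%:R * bregman x y).
  by apply: le_trans (sum_grad_diff_le x y); apply: sumr_ge0 => i _; exact: dot_ge0.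
by rewrite !pmulr_rge0// ?ltr0n// mulr_gt0.
Qed.

Lemma gmean_diff_le x y :
  dot (gmean f x - gmean f y) (gmean f x - gmean f y) <= 2 * L * bregman x y.
Proof.
rewrite /gmean -scalerBr -sumrB dotZl dotZr.
have n0 : 0 < (n%:R : R) by rewrite ltr0n.
rewrite ler_pdivrMl// ler_pdivrMl//.
apply: le_trans (dot_sum_CS _) _; rewrite ler_wpM2l//.
by apply: le_trans (sum_grad_diff_le x y) _; lra.
Qed.

Lemma gradF_diff_le x y :
  dot (gradF f x - gradF f y) (gradF f x - gradF f y)
  <= 2 * L * (n%:R * bregman x y).
Proof.
apply: le_trans (sum_grad_diff_le x y); rewrite dot_cols le_eqVlt; apply/orP; left.
apply/eqP; apply: eq_bigr => i _; congr (dot _ _);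
  by apply/matrixP => a c; rewrite [c]ord1 !mxE.
Qed.

Variables (psi : 'cV[R]_d -> \bar R) (al : R) (xstar : 'cV[R]_d).
Hypotheses (al_gt0 : 0 < al) (psi_proper : eproper psi) (psi_convex : econvex psi)
  (xstar_min : argmin (fun x => (favg f x)%:E + psi x)%E xstar).

(** -grad f(xs) is a subgradient of psi at xs: compare xs with xs + t (v - xs), where f grows by its
    linear part up to O(t^2). *)
Lemma argmin_subgradient : exists2 p, psi xstar = p%:E &
  forall v q, psi v = q%:E -> p - dot (gmean f xstar) (v - xstar) <= q.
Proof.
have [p Ep] : exists p, psi xstar = p%:E.
  have [y0 y0oo] := psi_proper.2.
  move: y0oo (psi_proper.1 y0) (psi_proper.1 xstar) (xstar_min y0).
  case: (psi y0) => [p0| |]// _ _.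
  by case: (psi xstar) => [p| |]// _ _; exists p.
exists p => // v q Ev; rewrite -subr_ge0.
apply: (@ge0_of_linear_lower _ (L / 2 * dot (v - xstar) (v - xstar))) => t /andP[t0 t1].
have t01 : 0 <= t <= 1 by rewrite ltW.
have := psi_convex v xstar t01; rewrite Ev Ep -!EFinM -EFinD.
have := xstar_min (t *: v + (1 - t) *: xstar); rewrite Ep -EFinD.
have -> : t *: v + (1 - t) *: xstar = xstar + t *: (v - xstar).
  by rewrite scalerBl scale1r scalerBr addrCA.
have := favg_upper xstar (t *: (v - xstar)); move: (v - xstar) => w.
case: (psi _) => [r| |]//; rewrite -EFinD !lee_fin !dotE => H1 H2 H3.
rewrite -(ler_pM2l t0); lra.
Qed.

Lemma argmin_prox_vi : prox_vi al psi (xstar - al *: gmean f xstar) xstar.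
Proof.
have [p Ep H] := argmin_subgradient; exists p => // v q Ev.
have := H v q Ev; rewrite addrAC subrr add0r dotNl dotZl mulrN mulKf ?gt_eqF//.
Qed.

(** Provides the affine minorant on which existence of the prox rests; the minimizer of h yields it
    without a separation theorem. *)
Lemma argmin_minorant : exists c, forall y,
  ((c + dot (- gmean f xstar) y)%:E <= psi y)%E.
Proof.
have [p Ep H] := argmin_subgradient.
exists (p + dot (gmean f xstar) xstar) => y.
move: (psi_proper.1 y) (H y); case: (psi y) => [q| |]// _; last by rewrite leey.
by move=> /(_ q erefl); rewrite lee_fin !dotE; lra.
Qed.

End objective.

(** * Arithmetic of the Lyapunov recursion and of the noise *)

Section recursion.
Context {R : realType}.
Variables (d b n L mu sg i a c ka : R).

(** Reading: q = |x - xs|^2, E = <x - xs, grad f(x) - grad f(xs)>, G2 and H2 the squared gradient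
    differences of f and F, B2 = |J - grad F(xs)|^2, W the sum of |grad f_i(x) - J^(i)|^2, Dg the
    Bregman divergence, i = 1 / (36d + b). *)
Lemma lyapunov_recursion (q E G2 W H2 B2 Dg be2 nu : R) :
  1 <= d -> 1 <= b -> 1 <= n -> 0 < L -> 0 < sg -> 0 < i ->
  0 < a -> 0 <= c -> a * L = b * i / 2 -> 36 * d * i + b * i = 1 ->
  c * sg = 32 * a ^+ 2 * (d / b * n^-1) ->
  ka <= a * mu / 2 -> ka <= sg / 4 -> 0 <= q -> 0 <= B2 -> 0 <= Dg ->
  Dg + mu / 2 * q <= E -> G2 <= 2 * L * Dg -> H2 <= 2 * L * (n * Dg) ->
  W <= 2 * B2 + 2 * H2 ->
  (1 + a * mu / 2) * q - 2 * a * E + a * d * L ^+ 2 * be2 / (2 * mu)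
  + 2 * a ^+ 2 * (G2 + d / b * (n^-1 * W)) + a ^+ 2 * d ^+ 2 * L ^+ 2 * be2 / 2
  + c * ((1 - sg) * B2 + 2 * sg * H2 + L ^+ 2 * be2 / 2 * nu)
  <= (1 - ka) * (q + c * B2) +
   (a * d * L ^+ 2 * be2 / (2 * mu) + a ^+ 2 * d ^+ 2 * L ^+ 2 * be2 / 2
    + c * (L ^+ 2 * be2 / 2 * nu)).
Proof.
move=> d1 b1 n1 L0 sg0 i0 a0 c0 aL Di csg ka1 ka2 q0 B0 D0 HE HG HH HW.
have b0 : 0 < b := lt_le_trans ltr01 b1.
have n0 : 0 < n := lt_le_trans ltr01 n1.
have d0 : 0 < d := lt_le_trans ltr01 d1.
set k := d / b * n^-1 in csg *.
have k0 : 0 <= k by rewrite /k !mulr_ge0 ?invr_ge0 ?ltW.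
have kn : k * n = d / b by rewrite /k divfK// gt_eqF.
have a2 : 0 <= a ^+ 2 by rewrite exprn_ge0// ltW.
(* The products of hypotheses that [lra] needs, prepared before d / b and k become opaque. *)
have T1 := ler_wpM2l a2 HG.
have T2 := ler_wpM2l (mulr_ge0 a2 k0) HW.
have T3 := ler_wpM2l (mulr_ge0 a2 k0) HH.
have T4 := congr1 (fun t => a ^+ 2 * L * Dg * t) kn.
have dbb : d / b * b = d by rewrite divfK// gt_eqF.
have T5 := congr1 (fun t => a * t * Dg) aL.
have T6 := congr1 (fun t => a * t * (d / b) * Dg) aL.
have T7 := congr1 (fun t => a * i / 2 * Dg * t) dbb.
have T8 := congr1 (fun t => a * t * Dg) Di.
have di0 : 0 <= a * (d * i) * Dg by rewrite !mulr_ge0// ltW.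
have T9 := ler_wpM2l (ltW a0) HE.
have T10 := ler_wpM2l q0 ka1.
have T11 := ler_wpM2l (mulr_ge0 c0 B0) ka2.
have T12 := congr1 (fun t => t * B2) csg.
have T13 := congr1 (fun t => t * H2) csg.
have T14 := mulr_ge0 (mulr_ge0 a2 k0) B0.
rewrite /= in T4 T5 T6 T7 T8 T12 T13.
have -> : d / b * (n^-1 * W) = k * W by rewrite mulrA.
move: (d / b) k T1 T2 T3 T4 T5 T6 T7 T8 T9 T10 T11 T12 T13 T14 di0 {kn dbb k0 csg} => db k.
rewrite !expr2; move=> *.
move: (_ / (2 * mu)) => noise1.
lra.
Qed.

(** The L / mu part of the noise is reproduced exactly, the variance part has a factor 2 to spare,
    and the J-part uses 1/n <= 1 <= d / sigma. *)
Lemma noise_bound (be2 nu D : R) :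
  1 <= d -> 1 <= b -> 1 <= n -> 0 < L -> 0 < mu -> 0 < sg -> sg <= 1 ->
  D = 36 * d + b -> 0 <= be2 -> 0 <= nu ->
  a = b / (2 * L * D) -> c = 8 * d * b / (L ^+ 2 * n * sg * D ^+ 2) ->
  a * d * L ^+ 2 * be2 / (2 * mu) + a ^+ 2 * d ^+ 2 * L ^+ 2 * be2 / 2
    + c * (L ^+ 2 * be2 / 2 * nu) <=
  be2 * d * b * (d * (32 * mu * nu + 36 * L * sg ^+ 2 + mu * b * sg ^+ 2)
     + L * b * sg ^+ 2) / (4 * mu * sg ^+ 2 * D ^+ 2).
Proof.
move=> d1 b1 n1 L0 mu0 sg0 sg1 DE be0 nu0.
have D0 : 0 < D by lra.
move=> aE cE.
have nz x : 0 < x -> x != 0 :> R by move=> x0; rewrite gt_eqF.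
have VL := mulfV (nz _ L0); have Vm := mulfV (nz _ mu0).
have Vs := mulfV (nz _ sg0); have VD := mulfV (nz _ D0).
pose l := L^-1; pose m := mu^-1; pose s := sg^-1; pose ii := D^-1; pose ni := n^-1.
have a_E : a = b / 2 * (l * ii) by rewrite aE !invfM -/l -/ii; clear aE cE; lra.
clear aE; rewrite !expr2 !invfM -/l -/ii -/ni -/s in cE.
have aLE : a * L = b / 2 * ii.
  rewrite a_E; have := congr1 (fun t => b / 2 * ii * t) VL; rewrite /= -/l; clear cE; lra.
have cLE : c * L ^+ 2 = 8 * d * b * (ni * s * ii ^+ 2).
  rewrite cE expr2.
  have := congr1 (fun t => 8 * d * b * ni * s * ii * ii * (t * t)) VL.
  rewrite /= -/l; lra.
have N1 : a * d * L ^+ 2 * be2 / (2 * mu) = b / 4 * ii * d * L * be2 * m.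
  by rewrite invfM -/m; have := congr1 (fun t => t * d * L * be2 * m / 2) aLE;
    rewrite /= expr2; lra.
have N2 : a ^+ 2 * d ^+ 2 * L ^+ 2 * be2 / 2 = b ^+ 2 * ii ^+ 2 * d ^+ 2 * be2 / 8.
  by have := congr1 (fun t => t * t * d ^+ 2 * be2 / 2) aLE; rewrite /= !expr2; lra.
have N3 : c * (L ^+ 2 * be2 / 2 * nu) = 4 * d * b * ni * s * ii ^+ 2 * be2 * nu.
  by have := congr1 (fun t => t * be2 / 2 * nu) cLE; rewrite /=; lra.
have C1E : be2 * d * b * (d * (32 * mu * nu + 36 * L * sg ^+ 2 + mu * b * sg ^+ 2)
     + L * b * sg ^+ 2) / (4 * mu * sg ^+ 2 * D ^+ 2) =
  8 * nu * d ^+ 2 * b * be2 * s ^+ 2 * ii ^+ 2 + b / 4 * ii * d * L * be2 * m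
  + b ^+ 2 * d ^+ 2 * be2 / 4 * ii ^+ 2.
  rewrite !expr2 !invfM -/m -/s -/ii.
  have mm : mu * m = 1 by []. have ss : sg * s = 1 by []. have DD : D * ii = 1 by [].
  (* The two L-terms of the numerator add up to L sigma^2 (36d + b), so one factor D cancels. *)
  transitivity (8 * nu * d * d * b * be2 * s * s * ii * ii * (mu * m)
    + b / 4 * d * L * be2 * m * ii * (D * ii) * (sg * s) * (sg * s)
    + b * b * d * d * be2 / 4 * ii * ii * (mu * m) * (sg * s) * (sg * s)).
    by rewrite DE; lra.
  by rewrite mm ss DD; lra.
rewrite N1 N2 N3 C1E.
have M2 : 0 <= b ^+ 2 * ii ^+ 2 * d ^+ 2 * be2.
  exact: mulr_ge0 (mulr_ge0 (mulr_ge0 (sqr_ge0 _) (sqr_ge0 _)) (sqr_ge0 _)) be0.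
have ii2 : 0 <= ii ^+ 2 by exact: sqr_ge0.
have s1 : 1 <= s by rewrite /s invf_ge1.
have s0 : 0 <= s := le_trans ler01 s1.
have d0 : 0 <= d := le_trans ler01 d1.
have b0 : 0 <= b := le_trans ler01 b1.
have ni1 : ni <= 1 by rewrite /ni invf_le1//; lra.
have ni0 : 0 <= ni by rewrite /ni invr_ge0; lra.
have M3 : 4 * d * b * ni * s * ii ^+ 2 * be2 * nu <= 8 * nu * d ^+ 2 * b * be2 * s ^+ 2 * ii ^+ 2.
  have H : ni * 1 <= 1 * (d * s) by apply: ler_pM => //; nra.
  have P : 0 <= d * b * s * ii ^+ 2 * be2 * nu.
    exact: mulr_ge0 (mulr_ge0 (mulr_ge0 (mulr_ge0 (mulr_ge0 d0 b0) s0) ii2) be0) nu0.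
  have P2 : 0 <= d * b * s * ii ^+ 2 * be2 * nu * (d * s) by exact: mulr_ge0 P (mulr_ge0 d0 s0).
  have := ler_wpM2l P H; rewrite !expr2 in P2 *; lra.
move: M2 M3; rewrite !expr2; lra.
Qed.

End recursion.

(** * Expectation over the sampled slices *)

Section fset_sums.
Context {R : realType} {n d : nat} {dX : measure_display} {X : measurableType dX}.
Local Notation fs := (@random_fset R n d).

Lemma measurable_sum_fset (F : 'I_n -> X * @borel_mx R d 1 -> R) :
  (forall i, measurable_fun setT (F i)) ->
  measurable_fun setT
    (fun xs : X * fs => \sum_(q <- xs.2) F q.1 (xs.1, q.2)).
Proof.
move=> mF.
rewrite (_ : (fun _ => _) = fun xs : X * fs =>
    \sum_i \sum_(u <- slice i xs.2) F i (xs.1, u)); last first.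
  by apply/funext => xs; rewrite (big_slices (fun i u => F i (xs.1, u))).
by apply: measurable_sum => i; exact: measurable_sum_slice.
Qed.

End fset_sums.

Section sampling_expectation.
Context {R : realType} {n d : nat}.
Local Notation fs := (@random_fset R n d).

Lemma measurable_sum_fset1 (F : 'I_n -> @borel_mx R d 1 -> R) :
  (forall i, measurable_fun setT (F i)) ->
  measurable_fun setT (fun s : fs => \sum_(q <- s) F q.1 q.2).
Proof.
move=> mF.
have mG : forall i, measurable_fun setT (fun xu : fs * @borel_mx R d 1 => F i xu.2).
  by move=> i; exact: measurableT_comp (mF i) measurable_snd.
have := measurable_sum_fset mG => mH.
(* The parameter space is taken to be that of the finite sets and is fed through the diagonal. *)
have mss : measurable_fun setT (fun s : fs => (s, s)).
  exact: measurable_fun_pair.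
exact: measurableT_comp mH mss.
Qed.

Lemma measurable_dotc (c : 'cV[R]_d) :
  measurable_fun setT (fun u : @borel_mx R d 1 => dot u c).
Proof. by apply: measurable_fun_dot => i j //; exact: measurable_coord. Qed.

Lemma measurable_Pop (A : 'M[R]_(d, n)) a j :
  measurable_fun setT (fun s : fs => Pop s A a j).
Proof.
rewrite (_ : (fun _ => _) = fun s : fs =>
    \sum_(q <- s) (dot q.2 (col q.1 A) * q.2 a 0 * (j == q.1)%:R)).
  apply: (measurable_sum_fset1 (F := fun i u => dot u (col i A) * u a 0 * (j == i)%:R)) => i.
  apply: measurable_funM => //; apply: measurable_funM; first exact: measurable_dotc.
  exact: measurable_coord.
apply/funext => s; rewrite /Pop summxE; apply: eq_bigr => q _.
by rewrite -(mulmxA _ A) colE_mul mulmx_outer mxE big_ord1 !mxE eqxx.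
Qed.

Lemma measurable_card_fset : measurable_fun setT (fun s : fs => (#|` s|)%:R : R).
Proof.
rewrite (_ : (fun _ => _) = fun s : fs => \sum_(q <- s) 1).
  exact: (measurable_sum_fset1 (F := fun _ _ => 1)).
by apply/funext => s; rewrite big_const_seq count_predT iter_addr_0.
Qed.

(** Summing the quadratic form over the basis matrices gives the trace of a projection, hence its
    rank; each pair (i, u) contributes |u|^2 = 1. *)
Lemma card_Qop (s : {fset 'I_n * 'cV[R]_d}) : orthonormal_slices s ->
  (#|` s|)%:R = \sum_a \sum_j Qop s (delta_mx a j) :> R.
Proof.
move=> os; rewrite /Qop.
under eq_bigr do rewrite exchange_big/=.
rewrite exchange_big/= [RHS]big_seq.
rewrite (eq_bigr (fun=> 1)) => [|q qs].
  by rewrite -big_seq big_const_seq count_predT iter_addr_0.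
have <- : dot q.2 q.2 = 1.
  have := os q.1 q.2 q.2; rewrite -surjective_pairing eqxx mulmxTcV mxE eqxx mulr1n.
  exact.
rewrite dot_cV; apply: eq_bigr => a _.
rewrite (bigD1 q.1)//= big1 ?addr0 => [|j jq].
  rewrite (_ : col _ _ = delta_mx a 0) ?dot_delta ?expr2//.
  by apply/matrixP => k l; rewrite [l]ord1 !mxE !eqxx andbT.
rewrite (_ : col _ _ = 0) ?dot0r ?expr0n//.
by apply/matrixP => k l; rewrite !mxE [q.1 == j]eq_sym (negPf jq) andbF.
Qed.

Context {dT : measure_display} {T : measurableType dT}.
Variables (P : probability T R) (om : T -> bool) (S : T -> {fset 'I_n * 'cV[R]_d}).
Variable sg : R.
Hypotheses (mom : measurable_fun setT om) (mS : measurable_fun setT (S : T -> fs))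
  (orthS : {ae P, forall w, orthonormal_slices (S w)})
  (momS : forall (A : 'M[R]_(d, n)) a i,
     ('E_P[fun w => ((om w)%:R *: Pop (S w) A)%R a i] = (sg * A a i)%:E)%E).

Lemma measurable_om : measurable_fun setT (fun w => (om w)%:R : R).
Proof.
rewrite (_ : (fun _ => _) = (fun x : bool => x%:R : R) \o om)//.
exact: measurableT_comp.
Qed.

Let Ex_Pop A a i : rint P (fun w => (om w)%:R * Pop (S w) A a i) /\
  Ex P (fun w => (om w)%:R * Pop (S w) A a i) = sg * A a i.
Proof.
have := momS A a i; rewrite expectation.unlock.
under eq_integral do rewrite mxE.
move=> H; split; last by rewrite /Ex H.
(* Assumption (iii) gives a finite value of the integral, and that already forces integrability. *)
apply: rint_fin_num; last by rewrite H.
apply: measurable_funM; first exact: measurable_om.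
exact: measurableT_comp (measurable_Pop A a i) mS.
Qed.

Lemma Ex_Qop A : rint P (fun w => (om w)%:R * Qop (S w) A) /\
  Ex P (fun w => (om w)%:R * Qop (S w) A) = sg * dot A A.
Proof.
have -> : (fun w => (om w)%:R * Qop (S w) A) =
    (fun w => \sum_a \sum_i A a i * ((om w)%:R * Pop (S w) A a i)).
  apply/funext => w; rewrite -dot_Pop mulr_sumr; apply: eq_bigr => a _.
  by rewrite mulr_sumr; apply: eq_bigr => i _; rewrite mulrA mulrC.
have i1 a i : rint P (fun w => A a i * ((om w)%:R * Pop (S w) A a i)).
  by apply: rintZ; have [] := Ex_Pop A a i.
have i2 a : rint P (fun w => \sum_i A a i * ((om w)%:R * Pop (S w) A a i)).
  exact: rint_sum.
split; first exact: rint_sum.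
rewrite Ex_sum// /dot mulr_sumr; apply: eq_bigr => a _.
rewrite Ex_sum// mulr_sumr; apply: eq_bigr => i _.
by have [iP EP] := Ex_Pop A a i; rewrite ExZ// EP mulrCA.
Qed.

(* Assumption (iii) on the basis matrices determines nu = sigma n d. *)
Lemma Ex_card : rint P (fun w => (om w)%:R * (#|` S w|)%:R) /\
  Ex P (fun w => (om w)%:R * (#|` S w|)%:R) = sg * n%:R * d%:R.
Proof.
pose Y w := \sum_a \sum_j (om w)%:R * Qop (S w) (delta_mx a j).
have i1 a j : rint P (fun w => (om w)%:R * Qop (S w) (delta_mx a j)).
  by have [] := Ex_Qop (delta_mx a j).
have i2 a : rint P (fun w => \sum_j (om w)%:R * Qop (S w) (delta_mx a j)).
  exact: rint_sum.
have iY : rint P Y by exact: rint_sum.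
have mC : measurable_fun setT (fun w => (om w)%:R * (#|` S w|)%:R : R).
  apply: measurable_funM; first exact: measurable_om.
  exact: measurableT_comp measurable_card_fset mS.
have ae : {ae P, forall w, (om w)%:R * (#|` S w|)%:R = Y w}.
  apply: filterS orthS => w os; rewrite card_Qop// mulr_sumr.
  by apply: eq_bigr => a _; rewrite mulr_sumr.
split; first exact: rint_ae_eq iY ae.
rewrite (Ex_ae_eq mC (rint_meas iY) ae) Ex_sum//.
transitivity (\sum_(a < d) \sum_(j < n) sg); last first.
  by rewrite !sumr_const !card_ord -[sg *+ n]mulr_natr -[_ *+ d]mulr_natr.
apply: eq_bigr => a _; rewrite Ex_sum//; apply: eq_bigr => j _.
have [_ ->] := Ex_Qop (delta_mx a j); rewrite [X in _ * X](_ : _ = 1) ?mulr1//.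
rewrite /dot (bigD1 a)//= [X in X + _](bigD1 j)//= !mxE !eqxx mulr1.
rewrite big1 => [|k kj]; last by rewrite !mxE (negPf kj) andbF mulr0.
rewrite big1 ?addr0// => k ka; apply: big1 => l _.
by rewrite !mxE (negPf ka) mulr0.
Qed.

Variables (f : 'I_n -> 'cV[R]_d -> R) (L : R).
Hypotheses (f_diff : forall i x, differentiable (f i) x) (L_gt0 : 0 < L)
  (f_smooth : forall i, smooth L (f i))
  (f_convex : forall i, strongly_convex 0 (f i)).

Lemma integral_Jgap x y (J : 'M[R]_(d, n)) be : 0 < be ->
  let B := J - gradF f y in let H := gradF f x - gradF f y in
  let X w := Jstep f x J be (om w) (S w) - gradF f y in
  measurable_fun setT (fun w => dot (X w) (X w)) ->
  (\int[P]_w (dot (X w) (X w))%:E <=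
    ((1 - sg) * dot B B + 2 * sg * dot H H
     + L ^+ 2 * be ^+ 2 / 2 * (sg * n%:R * d%:R))%:E)%E.
Proof.
move=> be0 /=; set B := J - _; set H := gradF f x - gradF f y => mX.
have [iB EB] := Ex_Qop B; have [iH EH] := Ex_Qop H; have [iC EC] := Ex_card.
pose k := L ^+ 2 * be ^+ 2 / 2.
pose Y w := dot B B + ((-1) * ((om w)%:R * Qop (S w) B)
  + (2 * ((om w)%:R * Qop (S w) H) + k * ((om w)%:R * (#|` S w|)%:R))).
have i1 := rintZ (-1) iB; have i2 := rintZ 2 iH; have i3 := rintZ k iC.
have i23 := rintD i2 i3; have i123 := rintD i1 i23.
have iY : rint P Y by apply: rintD => //; exact: rint_cst.
have <- : Ex P Y = (1 - sg) * dot B B + 2 * sg * dot H H + k * (sg * n%:R * d%:R).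
  rewrite /Y (ExD (rint_cst P _) i123) Ex_cst (ExD i1 i23) (ExD i2 i3) !ExZ//.
  by rewrite EB EH EC; lra.
apply: integral_le_Ex => //; first by move=> w; exact: dot_ge0.
apply: filterS orthS => w os; rewrite /Y.
have := Jstep_bound f_diff L_gt0 f_smooth f_convex x y J (om w) be0 os.
by move=> /= /le_trans; apply; rewrite -/B -/H /k; lra.
Qed.

End sampling_expectation.

Section iteration_map.
Context {R : realType} {n d b : nat}.
Variables (f : 'I_n -> 'cV[R]_d -> R) (psi : 'cV[R]_d -> \bar R) (al c : R)
  (a0 : 'cV[R]_d) (i0 : 'I_n).
Hypotheses (f_diff : forall i x, differentiable (f i) x)
  (al0 : 0 < al) (psi_proper : eproper psi) (psi_convex : econvex psi)
  (psi_lsc : lower_semicontinuous psi)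
  (psi_minorant : forall y, ((c + dot a0 y)%:E <= psi y)%E).

Definition draw_space :=
  (bool * @random_fset R n d * b.-tuple nat * b.-tuple (@borel_cV R d))%type.

(** Draws record the indices as natural numbers; this reads them back, with the arbitrary default
    [i0] outside the range. *)
Definition to_indices (m : b.-tuple nat) : b.-tuple 'I_n := map_tuple (insubd i0) m.

Definition step (be : R) (x : 'cV[R]_d * 'M[R]_(d, n)) (dr : draw_space) :
    'cV[R]_d * 'M[R]_(d, n) :=
  (prox al psi (x.1 - al *: gstep f x.1 x.2 be (to_indices dr.1.2) dr.2),
   Jstep f x.1 x.2 be dr.1.1.1 dr.1.1.2).

(** Nonexpansiveness makes each coordinate of the prox continuous, hence Borel. *)
Lemma measurable_prox a j :
  measurable_fun setT (fun z : @borel_mx R d 1 => prox al psi z a j).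
Proof.
apply: (@continuous_borel_measurable _ _ _ (fun z => prox al psi z a j)) => z.
apply/(@cvgrPdist_le _ R _ _ (@nbhs_filter 'cV[R]_d z)) => e e0.
have H := prox_nonexpansive al0 psi_proper psi_convex psi_lsc psi_minorant.
have : (fun t : 'cV[R]_d => dot (z - t) (z - t)) @ z --> dot (z - z) (z - z).
  have C i j' : (fun t : 'cV[R]_d => (z - t) i j') @ z --> (z - z) i j'.
    apply: (@cvg_coord _ _ _ (@nbhs_filter 'cV[R]_d z) _ _ (fun t => z - t)).
    by apply: cvgB; [exact: cvg_cst|exact: cvg_id].
  exact: (@cvg_dot _ _ _ (@nbhs_filter 'cV[R]_d z)).
rewrite subrr dot0l => /(@cvgrPdist_le _ R) /(_ (e ^+ 2)); rewrite exprn_gt0// => /(_ isT).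
apply: filterS => t; rewrite sub0r normrN ger0_norm ?dot_ge0// => zt.
rewrite -ler_sqr ?nnegrE ?(ltW e0)//.
apply: le_trans zt; apply: le_trans (H z t).
have := coord_le_dot (prox al psi z - prox al psi t) a j.
by rewrite !mxE real_normK ?num_real.
Qed.

Context {dX : measure_display} {X : measurableType dX}.

Lemma measurable_correction (x : X -> 'cV[R]_d) (J : X -> 'M[R]_(d, n))
    (u : X -> 'cV[R]_d) be i a :
  measurable_fun setT (x : X -> @borel_mx R d 1) ->
  measurable_fun setT (J : X -> @borel_mx R d n) ->
  measurable_fun setT (u : X -> @borel_mx R d 1) ->
  measurable_fun setT (fun t => correction f (x t) (J t) be (i, u t) a 0).
Proof.
move=> mx mJ mu.
have mf : measurable_fun setT (f i : @borel_mx R d 1 -> R).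
  by apply: continuous_borel_measurable => z; exact: differentiable_continuous.
have mux k : measurable_fun setT (fun t => u t k 0).
  exact: measurableT_comp (measurable_coord _ _) mu.
have mxu : measurable_fun setT (fun t => x t + be *: u t : @borel_mx R d 1).
  apply: measurable_fun_mx => k j; rewrite [j]ord1.
  under eq_fun do rewrite !mxE.
  apply: measurable_funD; first exact: measurableT_comp (measurable_coord _ _) mx.
  by apply: measurable_funM.
rewrite (_ : (fun _ => _) = fun t => (f i (x t + be *: u t) - f i (x t)) / be * u t a 0
    - dot (u t) (col i (J t)) * u t a 0); last first.
  by apply/funext => t; rewrite /correction /zo_grad/= mulmx_outer !mxE.
apply: measurable_funB.
  apply: measurable_funM => //; apply: measurable_funM => //.
  apply: measurable_funB; first exact: measurableT_comp mf mxu.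
  exact: measurableT_comp mf mx.
apply: measurable_funM => //; apply: measurable_fun_dot => k j.
  by rewrite [j]ord1.
under eq_fun do rewrite mxE.
exact: measurableT_comp (measurable_coord _ _) mJ.
Qed.

End iteration_map.

Section iteration_map_measurable.
Context {R : realType} {n d b : nat}.
Variables (f : 'I_n -> 'cV[R]_d -> R) (psi : 'cV[R]_d -> \bar R) (al c : R)
  (a0 : 'cV[R]_d) (i0 : 'I_n).
Hypotheses (f_diff : forall i x, differentiable (f i) x)
  (al0 : 0 < al) (psi_proper : eproper psi) (psi_convex : econvex psi)
  (psi_lsc : lower_semicontinuous psi)
  (psi_minorant : forall y, ((c + dot a0 y)%:E <= psi y)%E).
Local Notation state := (@borel_mx R d 1 * @borel_mx R d n)%type.
Local Notation draw_space := (@draw_space R n d b).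

Lemma to_indicesK (t : b.-tuple 'I_n) : to_indices i0 (map_tuple val t) = t.
Proof. by apply: eq_from_tnth => r; rewrite !tnth_map valKd. Qed.

Context {dX : measure_display} {X : measurableType dX}.

Lemma measurable_index (m : X -> b.-tuple nat) (g : 'I_n -> R) r :
  measurable_fun setT m ->
  measurable_fun setT (fun t => g (tnth (to_indices i0 (m t)) r)).
Proof.
move=> mm; under eq_fun do rewrite tnth_map.
have mk : measurable_fun setT (fun k : nat => g (insubd i0 k)) by [].
apply: (measurableT_comp mk).
exact: measurableT_comp (measurable_tnth r) mm.
Qed.

Lemma measurable_indices (m : X -> b.-tuple nat) (g : b.-tuple 'I_n -> R) :
  measurable_fun setT m -> measurable_fun setT (fun t => g (to_indices i0 (m t))).
Proof.
move=> mm.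
rewrite (_ : (fun _ => _) = fun s => \sum_t
    (\prod_r (tnth (to_indices i0 (m s)) r == tnth t r)%:R) * g t); last first.
  apply/funext => s; rewrite (bigD1 (to_indices i0 (m s)))//=.
  rewrite big1 ?mul1r => [|r _]; last by rewrite eqxx.
  rewrite big1 ?addr0// => t tm.
  suff [r rt] : exists r, tnth (to_indices i0 (m s)) r != tnth t r.
    by rewrite (bigD1 r)//= (negPf rt) !mul0r.
  apply/existsP; rewrite -negb_forall; apply: contra tm => /forallP H.
  by apply/eqP/eq_from_tnth => r; rewrite (eqP (H r)).
apply: measurable_sum => t; apply: measurable_funM => //.
apply: measurable_prod => r _.
exact: (measurable_index (fun i => (i == tnth t r)%:R)).
Qed.

Lemma measurable_gstep (x : X -> 'cV[R]_d) (J : X -> 'M[R]_(d, n)) be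
    (m : X -> b.-tuple nat) (u : X -> b.-tuple (@borel_cV R d)) :
  measurable_fun setT (x : X -> @borel_mx R d 1) ->
  measurable_fun setT (J : X -> @borel_mx R d n) ->
  measurable_fun setT m -> measurable_fun setT u ->
  measurable_fun setT (fun t =>
    gstep f (x t) (J t) be (to_indices i0 (m t)) (u t) : @borel_mx R d 1).
Proof.
move=> mx mJ mm mu; apply: measurable_fun_mx => a j; rewrite [j]ord1 {j}.
(* The random index selects the function f_i; summing over all i against the indicator of i removes
   this dependence. *)
rewrite (_ : (fun _ => _) = fun t => n%:R^-1 * (\sum_k J t a k) + (d%:R / b%:R) *
    \sum_r \sum_i (tnth (to_indices i0 (m t)) r == i)%:R *
      correction f (x t) (J t) be (i, tnth (u t) r) a 0); last first.
  apply/funext => t; rewrite /gstep 3!mxE; congr (_ * _ + _).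
    by apply: eq_bigr => k _; rewrite !mxE mulr1.
  rewrite mxE summxE; congr (_ * _); apply: eq_bigr => r _.
  rewrite (bigD1 (tnth (to_indices i0 (m t)) r))//= eqxx mul1r.
  by rewrite big1 ?addr0// => i ir; rewrite eq_sym (negPf ir) mul0r.
have mu' r : measurable_fun setT (fun t => tnth (u t) r : @borel_mx R d 1).
  exact: measurableT_comp (measurable_tnth r) mu.
apply: measurable_funD; apply: measurable_funM => //.
  apply: measurable_sum => k.
  exact: measurableT_comp (measurable_coord _ _) mJ.
apply: measurable_sum => r; apply: measurable_sum => i; apply: measurable_funM.
  exact: (measurable_index (fun j => (j == i)%:R)).
exact: measurable_correction.
Qed.

Lemma measurable_Jstep (x : X -> 'cV[R]_d) (J : X -> 'M[R]_(d, n)) be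
    (om : X -> bool) (S : X -> {fset 'I_n * 'cV[R]_d}) :
  measurable_fun setT (x : X -> @borel_mx R d 1) ->
  measurable_fun setT (J : X -> @borel_mx R d n) ->
  measurable_fun setT om -> measurable_fun setT (S : X -> @random_fset R n d) ->
  measurable_fun setT (fun t =>
    Jstep f (x t) (J t) be (om t) (S t) : @borel_mx R d n).
Proof.
move=> mx mJ mom mS; apply: measurable_fun_mx => a j.
(* The state is carried as a parameter, so the summand is jointly measurable in state and
   direction. *)
pose F i (z : state * @borel_mx R d 1) :=
  correction f z.1.1 z.1.2 be (i, z.2) a 0 * (i == j)%:R.
rewrite (_ : (fun _ => _) = fun t => J t a j + (om t)%:R *
    \sum_(q <- S t) F q.1 ((x t, J t), q.2)); last first.
  apply/funext => t; rewrite /Jstep 2!mxE summxE; congr (_ + _ * _).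
  apply: eq_bigr => q _; rewrite mxE big_ord1 /F/= -surjective_pairing.
  by rewrite [X in _ * X]mxE eqxx /= eq_sym; congr (correction _ _ _ _ _ _ _ * _).
have mF i : measurable_fun setT (F i).
  apply: measurable_funM => //; apply: measurable_correction => //.
  - exact: measurableT_comp measurable_fst measurable_fst.
  - exact: measurableT_comp measurable_snd measurable_fst.
apply: measurable_funD; first exact: measurableT_comp (measurable_coord _ _) mJ.
apply: measurable_funM; first exact: measurable_om.
have mH := measurable_sum_fset mF.
have mp : measurable_fun setT
    (fun t => ((x t, J t), S t) : state * @random_fset R n d).
  by apply: measurable_fun_pair => //; exact: measurable_fun_pair.
exact: measurableT_comp mH mp.
Qed.

Lemma measurable_step be (z : X -> 'cV[R]_d * 'M[R]_(d, n)) (D : X -> draw_space) :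
  measurable_fun setT (z : X -> state) -> measurable_fun setT D ->
  measurable_fun setT (fun t => step f psi al i0 be (z t) (D t) : state).
Proof.
move=> mz mD.
have mx : measurable_fun setT (fun t => (z t).1 : @borel_mx R d 1).
  exact: measurableT_comp measurable_fst mz.
have mJ : measurable_fun setT (fun t => (z t).2 : @borel_mx R d n).
  exact: measurableT_comp measurable_snd mz.
have mD1 : measurable_fun setT (fun t => (D t).1).
  exact: measurableT_comp measurable_fst mD.
have mD11 : measurable_fun setT (fun t => (D t).1.1).
  exact: measurableT_comp measurable_fst mD1.
apply: measurable_fun_pair.
  have : measurable_fun setT (fun t => gstep f (z t).1 (z t).2 be
      (to_indices i0 (D t).1.2) (D t).2 : @borel_mx R d 1).
    apply: measurable_gstep => //; first exact: measurableT_comp measurable_snd mD1.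
    exact: measurableT_comp measurable_snd mD.
  have mB (g : X -> 'cV[R]_d) : measurable_fun setT (g : X -> @borel_mx R d 1) ->
      measurable_fun setT (fun t => (z t).1 - al *: g t : @borel_mx R d 1).
    move=> mg; apply: measurable_fun_mx => a j; under eq_fun do rewrite !mxE.
    apply: measurable_funB; first exact: measurableT_comp (measurable_coord _ _) mx.
    apply: measurable_funM => //.
    exact: measurableT_comp (measurable_coord _ _) mg.
  move=> /mB mg.
  apply: measurable_fun_mx => a j.
  exact: measurableT_comp (measurable_prox al0 psi_proper psi_convex psi_lsc
    psi_minorant a j) mg.
apply: measurable_Jstep => //.
  exact: measurableT_comp measurable_fst mD11.
exact: measurableT_comp measurable_snd mD11.
Qed.

End iteration_map_measurable.

(** * One iteration *)

Lemma step_constants (R : realType) (d b n L sg mu D a c : R) :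
  0 < d -> 0 < b -> 0 < n -> 0 < L -> 0 < sg -> D = 36 * d + b ->
  a = b / (2 * L * D) -> c = 8 * d * b / (L ^+ 2 * n * sg * D ^+ 2) ->
  [/\ 0 < D^-1, 0 < a, 0 < c, a * L = b * D^-1 / 2 &
    [/\ 36 * d * D^-1 + b * D^-1 = 1, c * sg = 32 * a ^+ 2 * (d / b * n^-1)
      & mu * b / (4 * L * D) = a * mu / 2]].
Proof.
move=> d0 b0 n0 L0 sg0 DE.
have D0 : 0 < D by lra.
move=> -> ->.
have nz x : 0 < x -> x != 0 :> R by move=> x0; rewrite gt_eqF.
have VL := mulfV (nz _ L0); have Vb := mulfV (nz _ b0).
have Vs := mulfV (nz _ sg0); have VD := mulfV (nz _ D0).
split.
- by rewrite invr_gt0.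
- by rewrite !(mulr_gt0, invr_gt0).
- by rewrite !(mulr_gt0, invr_gt0, exprn_gt0).
- rewrite !invfM; have := congr1 (fun t => b / 2 * D^-1 * t) VL.
  by rewrite /=; move: (L^-1) (D^-1) => l i; lra.
split.
- by rewrite -mulrDl -DE.
- rewrite !expr2 !invfM.
  have := congr1 (fun t => 8 * d * b / L / L / n / D / D * t) Vs.
  have := congr1 (fun t => 8 * d * b / L / L / n / D / D * t) Vb.
  by rewrite /=; move: (L^-1) (D^-1) (b^-1) (n^-1) (sg^-1) => *; lra.
- by rewrite !invfM; move: (L^-1) (D^-1) => *; lra.
Qed.

Section one_step.
Context {R : realType} {n d b : nat}.
Hypotheses (n_gt0 : (0 < n)%N) (d_gt0 : (0 < d)%N) (b_gt0 : (0 < b)%N)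
  (b_le_n : (b <= n)%N).
Variables (f : 'I_n -> 'cV[R]_d -> R) (psi : 'cV[R]_d -> \bar R) (L mu : R).
Hypotheses (f_diff : forall i x, differentiable (f i) x) (L_gt0 : 0 < L)
  (f_smooth : forall i, smooth L (f i))
  (f_convex : forall i, strongly_convex 0 (f i))
  (mu_gt0 : 0 < mu) (f_strong : strongly_convex mu (favg f))
  (psi_proper : eproper psi) (psi_convex : econvex psi)
  (psi_lsc : lower_semicontinuous psi).
Variable xstar : 'cV[R]_d.
Hypothesis xstar_min : argmin (fun x => (favg f x)%:E + psi x)%E xstar.
Variables (al sg : R) (i0 : 'I_n).
Hypotheses (al_gt0 : 0 < al) (sg01 : 0 < sg < 1).
Local Notation state := (@borel_mx R d 1 * @borel_mx R d n)%type.
Local Notation draw_space := (@draw_space R n d b).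

Definition lyapunov (c : R) (z : 'cV[R]_d * 'M[R]_(d, n)) : R :=
  dot (z.1 - xstar) (z.1 - xstar)
  + c * dot (z.2 - gradF f xstar) (z.2 - gradF f xstar).

Lemma lyapunov_ge0 c z : 0 <= c -> 0 <= lyapunov c z.
Proof. by move=> c0; rewrite addr_ge0 ?mulr_ge0 ?dot_ge0. Qed.

Section measurable_gaps.
Context {dX : measure_display} {X : measurableType dX}.

Lemma measurable_fun_sqgap m p (A : X -> 'M[R]_(m, p)) (A0 : 'M[R]_(m, p)) :
  measurable_fun setT (A : X -> @borel_mx R m p) ->
  measurable_fun setT (fun t => dot (A t - A0) (A t - A0)).
Proof.
move=> mA.
have mij i j : measurable_fun setT (fun t => (A t - A0) i j).
  under eq_fun do rewrite !mxE; apply: measurable_funB => //.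
  exact: measurableT_comp (measurable_coord _ _) mA.
exact: measurable_fun_dot.
Qed.

Lemma measurable_lyapunov c (z : X -> 'cV[R]_d * 'M[R]_(d, n)) :
  measurable_fun setT (z : X -> state) ->
  measurable_fun setT (fun t => lyapunov c (z t)).
Proof.
move=> mz; apply: measurable_funD; last apply: measurable_funM => //.
  apply: measurable_fun_sqgap; exact: measurableT_comp measurable_fst mz.
apply: measurable_fun_sqgap; exact: measurableT_comp measurable_snd mz.
Qed.

Lemma measurable_xgap (x y : 'cV[R]_d) (J : 'M[R]_(d, n)) be
    (m : X -> b.-tuple nat) (u : X -> b.-tuple (@borel_cV R d)) :
  measurable_fun setT m -> measurable_fun setT u ->
  measurable_fun setT (fun t => xgap f x y J al be (to_indices i0 (m t)) (u t)).
Proof.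
move=> mm mu'.
have mg : measurable_fun setT
    (fun t => gstep f x J be (to_indices i0 (m t)) (u t) : @borel_mx R d 1).
  exact: (measurable_gstep i0 f_diff be (x := fun=> x) (J := fun=> J)).
have mB (g : X -> 'cV[R]_d) : measurable_fun setT (g : X -> @borel_mx R d 1) ->
    measurable_fun setT (fun t => x - al *: g t : @borel_mx R d 1).
  move=> mg'; apply: measurable_fun_mx => a j; under eq_fun do rewrite !mxE.
  apply: measurable_funB => //; apply: measurable_funM => //.
  exact: measurableT_comp (measurable_coord _ _) mg'.
exact: measurable_fun_sqgap (mB _ mg).
Qed.

End measurable_gaps.

Context {dT : measure_display} {T : measurableType dT}.
Variables (P : probability T R) (om : T -> bool) (S : T -> {fset 'I_n * 'cV[R]_d})
  (I : T -> b.-tuple 'I_n) (U : T -> b.-tuple 'cV[R]_d).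
Let D (w : T) : draw_space := (om w, S w, map_tuple val (I w), U w).
Hypotheses (mD : measurable_fun setT D)
  (unifI : without_replacement P I)
  (indIU : independent P (fun w => (D w).1.2) (fun w => (D w).2))
  (indU : mutually_independent P (fun r w => tnth (U w) r : @borel_cV R d))
  (unifU : (forall r, uniform_basis P (fun w => tnth (U w) r)) \/
     (forall r, uniform_sphere P (fun w => tnth (U w) r)))
  (orthS : {ae P, forall w, orthonormal_slices (S w)})
  (momS : forall (A : 'M[R]_(d, n)) a i,
     ('E_P[fun w => ((om w)%:R *: Pop (S w) A)%R a i] = (sg * A a i)%:E)%E).

Let mU : measurable_fun setT (U : T -> b.-tuple (@borel_cV R d)).
Proof. exact: measurableT_comp measurable_snd mD. Qed.
Let mD1 : measurable_fun setT (fun w => (D w).1).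
Proof. exact: measurableT_comp measurable_fst mD. Qed.
Let mD11 : measurable_fun setT (fun w => (D w).1.1).
Proof. exact: measurableT_comp measurable_fst mD1. Qed.
Let mM : measurable_fun setT (fun w => map_tuple val (I w) : b.-tuple nat).
Proof. exact: measurableT_comp measurable_snd mD1. Qed.
Let mom : measurable_fun setT om.
Proof. exact: measurableT_comp measurable_fst mD11. Qed.
Let mS : measurable_fun setT (S : T -> @random_fset R n d).
Proof. exact: measurableT_comp measurable_snd mD11. Qed.

Let mI t : measurable [set w | I w = t].
Proof.
have := measurable_indices i0 (fun s => (s == t)%:R : R) mM.
under eq_fun do rewrite to_indicesK.
move=> /(_ measurableT [set 1] (measurable_set1 _)); rewrite setTI.
congr measurable; apply/seteqP; split=> w /=.
  by case: eqP => // _ /esym /eqP; rewrite oner_eq0.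
by move=> ->; rewrite eqxx.
Qed.

Let isoU r : isotropic P (fun w => tnth (U w) r).
Proof.
have mUr : measurable_fun setT (fun w => tnth (U w) r : @borel_mx R d 1).
  exact: measurableT_comp (measurable_tnth r) mU.
case: unifU => H; first exact: uniform_basis_isotropic.
exact: uniform_sphere_isotropic.
Qed.

Variables (x : 'cV[R]_d) (J : 'M[R]_(d, n)) (be : R).
Hypothesis be_gt0 : 0 < be.

(** The prox is removed path by path; then, as indices and directions are independent, the
    directions are averaged for each frozen index tuple. *)
Lemma integral_prox_gap :
  (\int[P]_w (dot ((step f psi al i0 be (x, J) (D w)).1 - xstar)
                 ((step f psi al i0 be (x, J) (D w)).1 - xstar))%:E <=
   (Ex P (fun w => xgap_mean f L x xstar J al mu be (I w)))%:E)%E.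
Proof.
pose X w := (step f psi al i0 be (x, J) (D w)).1 - xstar.
have [c0 minor] := argmin_minorant n_gt0 f_diff L_gt0 f_smooth psi_proper psi_convex xstar_min.
have mstep : measurable_fun setT (fun w => step f psi al i0 be (x, J) (D w) : state).
  exact: (measurable_step i0 f_diff al_gt0 psi_proper psi_convex psi_lsc minor be
    (z := fun=> (x, J))).
have mX : measurable_fun setT (fun w => dot (X w) (X w)).
  exact: measurable_fun_sqgap (measurableT_comp measurable_fst mstep).
have mG := measurable_xgap x xstar J be mM mU.
apply: (@le_trans _ _
  (\int[P]_w (xgap f x xstar J al be (to_indices i0 (D w).1.2) (D w).2)%:E)%E).
  apply: ge0_le_integral => //.
  - by move=> w _; rewrite lee_fin dot_ge0.
  - exact/measurable_EFinP.
  - exact/measurable_EFinP.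
  move=> w _; rewrite lee_fin.
  apply: (prox_vi_nonexpansive al_gt0 (proxP al_gt0 psi_proper psi_convex psi_lsc minor _)).
  refine (argmin_prox_vi n_gt0 f_diff L_gt0 f_smooth al_gt0 psi_proper psi_convex xstar_min).
have -> : (Ex P (fun w => xgap_mean f L x xstar J al mu be (I w)))%:E =
    (\int[P]_w (xgap_mean f L x xstar J al mu be (to_indices i0 (D w).1.2))%:E)%E.
  rewrite -Ex_EFin; last exact: rint_batch.
  by apply: eq_integral => w _; rewrite to_indicesK.
pose h (z : b.-tuple nat * b.-tuple (@borel_cV R d)) :=
  xgap f x xstar J al be (to_indices i0 z.1) z.2.
pose g (m : b.-tuple nat) := xgap_mean f L x xstar J al mu be (to_indices i0 m).
have mh : measurable_fun setT h.
  have m1 : measurable_fun setT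
      (fun z : b.-tuple nat * b.-tuple (@borel_cV R d) => z.1) := measurable_fst.
  have m2 : measurable_fun setT
      (fun z : b.-tuple nat * b.-tuple (@borel_cV R d) => z.2) := measurable_snd.
  exact: measurable_xgap m1 m2.
have {}mh : measurable_fun setT (EFin \o h) by exact/measurable_EFinP.
have h0 z : (0 <= (EFin \o h) z)%E by rewrite lee_fin dot_ge0.
have mg : measurable_fun setT g.
  have mid : measurable_fun setT (fun m : b.-tuple nat => m) by exact: measurable_id.
  exact: (measurable_indices i0 (xgap_mean f L x xstar J al mu be) mid).
have {}mg : measurable_fun setT (EFin \o g) by exact/measurable_EFinP.
have hg m : (\int[P]_w (EFin \o h) (m, (D w).2) <= (EFin \o g) m)%E.
  have indU2 r s : r != s -> @independent _ _ _ P _ _ (@borel_mx R d 1) (@borel_mx R d 1)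
      (fun w => tnth (U w) r) (fun w => tnth (U w) s).
    by move=> rs; exact: mutually_independent_pair rs indU.
  have mcst : measurable_fun setT (fun _ : T => m) by exact: measurable_cst.
  have mt := measurable_xgap x xstar J be mcst mU.
  exact: (integral_xgap d_gt0 b_gt0 f_diff L_gt0 f_smooth f_convex isoU indU2
    al_gt0 mu_gt0 be_gt0 mt).
have indIU' : independent P (fun w => map_tuple val (I w) : b.-tuple nat)
    (U : T -> b.-tuple (@borel_cV R d)) by exact: indIU.
exact: (@integral_indep_le R dT T P _ _ _ _ _ _ mM mU indIU' (EFin \o h) (EFin \o g) mh h0 mg hg).
Qed.

(** The state (x, J) is fixed here, and the mean sample size appears as its value sigma n d. *)
Lemma one_step (c ka : R) :
  let Dn : R := 36 * d%:R + b%:R in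
  al = b%:R / (2 * L * Dn) ->
  c = 8 * d%:R * b%:R / (L ^+ 2 * n%:R * sg * Dn ^+ 2) ->
  ka <= mu * b%:R / (4 * L * Dn) -> ka <= sg / 4 ->
  (\int[P]_w (lyapunov c (step f psi al i0 be (x, J) (D w)))%:E <=
   ((1 - ka) * lyapunov c (x, J) +
   be ^+ 2 * d%:R * b%:R *
    (d%:R * (32 * mu * (sg * n%:R * d%:R) + 36 * L * sg ^+ 2 + mu * b%:R * sg ^+ 2)
     + L * b%:R * sg ^+ 2)
    / (4 * mu * sg ^+ 2 * Dn ^+ 2))%:E)%E.
Proof.
move=> Dn alE cE ka1 ka2.
have /andP[sg0 sg1] := sg01.
have d1 : 1 <= d%:R :> R by rewrite ler1n.
have b1 : 1 <= b%:R :> R by rewrite ler1n.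
have n1 : 1 <= n%:R :> R by rewrite ler1n.
have d0 : 0 < d%:R :> R by rewrite ltr0n.
have b0 : 0 < b%:R :> R by rewrite ltr0n.
have n0 : 0 < n%:R :> R by rewrite ltr0n.
have [i_gt0 _ c_gt0 aL [Di csg kaE]] := step_constants mu d0 b0 n0 L_gt0 sg0 erefl alE cE.
rewrite kaE in ka1.
have [c0 minor] := argmin_minorant n_gt0 f_diff L_gt0 f_smooth psi_proper psi_convex xstar_min.
have mstep : measurable_fun setT (fun w => step f psi al i0 be (x, J) (D w) : state).
  exact: (measurable_step i0 f_diff al_gt0 psi_proper psi_convex psi_lsc minor be
    (z := fun=> (x, J))).
pose X w := (step f psi al i0 be (x, J) (D w)).1 - xstar.
pose Y w := Jstep f x J be (om w) (S w) - gradF f xstar.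
have mX : measurable_fun setT (fun w => dot (X w) (X w)).
  exact: measurable_fun_sqgap (measurableT_comp measurable_fst mstep).
have mY : measurable_fun setT (fun w => dot (Y w) (Y w)).
  exact: measurable_fun_sqgap (measurableT_comp measurable_snd mstep).
have HX := integral_prox_gap.
have HY := integral_Jgap mom mS orthS momS f_diff L_gt0 f_smooth f_convex be_gt0 mY.
have -> : (\int[P]_w (lyapunov c (step f psi al i0 be (x, J) (D w)))%:E =
    \int[P]_w (dot (X w) (X w))%:E + c%:E * \int[P]_w (dot (Y w) (Y w))%:E)%E.
  rewrite -ge0_integralZl ?lee_fin ?(ltW c_gt0)//; last first.
  - by move=> w _; rewrite lee_fin dot_ge0.
  - exact/measurable_EFinP.
  rewrite -ge0_integralD//.
  - by move=> w _; rewrite lee_fin dot_ge0.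
  - exact/measurable_EFinP.
  - by move=> w _; rewrite mule_ge0 ?lee_fin ?dot_ge0 ?ltW.
  - by apply/measurable_EFinP; apply: measurable_funM.
have HE := Ex_xgap_mean n_gt0 b_gt0 b_le_n f L mI unifI x xstar J al mu be.
have cY := lee_wpmul2l (_ : (0 <= c%:E)%E) HY.
apply: le_trans (leeD HX (cY _)) _; first by rewrite lee_fin ltW.
rewrite -EFinM -EFinD lee_fin.
apply: (le_trans (lerD HE (lexx _))).
have HD := bregman_strong n_gt0 f_diff L_gt0 f_smooth f_strong x xstar.
have HG := gmean_diff_le n_gt0 f_diff L_gt0 f_smooth f_convex x xstar.
have HH := gradF_diff_le n_gt0 f_diff L_gt0 f_smooth f_convex x xstar.
have D0 := bregman_ge0 n_gt0 f_diff L_gt0 f_smooth f_convex x xstar.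
pose B := J - gradF f xstar; pose H := gradF f x - gradF f xstar.
have HW : \sum_i dot (grad (f i) x - col i J) (grad (f i) x - col i J)
    <= 2 * dot B B + 2 * dot H H.
  have -> : \sum_i dot (grad (f i) x - col i J) (grad (f i) x - col i J) =
      dot (H - B) (H - B).
    rewrite dot_cols; apply: eq_bigr => i _.
    suff -> : col i (H - B) = grad (f i) x - col i J by [].
    by apply/matrixP => k l; rewrite [l]ord1 !mxE; lra.
  by apply: le_trans (dotD2_le _ _) _; rewrite dotNl dotNr opprK addrC.
have nu0 : 0 <= sg * n%:R * d%:R by rewrite !mulr_ge0// ltW.
have := noise_bound d1 b1 n1 L_gt0 mu_gt0 sg0 (ltW sg1) erefl (sqr_ge0 be) nu0 alE cE.
have := lyapunov_recursion (be ^+ 2) (sg * n%:R * d%:R) d1 b1 n1 L_gt0 sg0 i_gt0 al_gt0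
  (ltW c_gt0) aL Di csg ka1 ka2 (dot_ge0 (x - xstar)) (dot_ge0 B) D0 HD HG HH HW.
by move=> H1 H2; apply: le_trans H1 _; rewrite lerD2l.
Qed.

End one_step.

(** * The iteration *)

Section iteration.
Context {R : realType} {n d b : nat}.
Variables (f : 'I_n -> 'cV[R]_d -> R) (psi : 'cV[R]_d -> \bar R) (al : R)
  (i0 : 'I_n) (beta : nat -> R) (x0 : 'cV[R]_d) (J0 : 'M[R]_(d, n)).
Local Notation state := (@borel_mx R d 1 * @borel_mx R d n)%type.
Local Notation draw_space := (@draw_space R n d b).

(* The state as a measurable function of the past draws, to which the
   independence of the next draw applies. *)
Fixpoint flow (k : nat) : k.-tuple draw_space -> 'cV[R]_d * 'M[R]_(d, n) :=
  if k is j.+1 then fun t =>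
    step f psi al i0 (beta j)
      (flow [tuple tnth t (widen_ord (leqnSn j) r) | r < j]) (tnth t ord_max)
  else fun=> (x0, J0).

Lemma measurable_flow c a0 k :
  (forall i x, differentiable (f i) x) -> 0 < al -> eproper psi ->
  econvex psi -> lower_semicontinuous psi ->
  (forall y, ((c + dot a0 y)%:E <= psi y)%E) ->
  measurable_fun setT (@flow k : k.-tuple draw_space -> state).
Proof.
move=> f_diff al0 pp pc pl pm; elim: k => [|k IH]; first exact: measurable_cst.
have mt : measurable_fun setT (fun t : k.+1.-tuple draw_space =>
    [tuple tnth t (widen_ord (leqnSn k) r) | r < k]).
  apply/measurable_fun_tnthP => r /=.
  rewrite (_ : _ \o _ = fun t => tnth t (widen_ord (leqnSn k) r)); last first.
    by apply/funext => t /=; rewrite tnth_mktuple.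
  exact: measurable_tnth.
have mz : measurable_fun setT (fun t : k.+1.-tuple draw_space =>
    flow [tuple tnth t (widen_ord (leqnSn k) r) | r < k] : state).
  exact: measurableT_comp IH mt.
have ml : measurable_fun setT (fun t : k.+1.-tuple draw_space => tnth t ord_max).
  exact: measurable_tnth.
exact: (measurable_step i0 f_diff al0 pp pc pl pm (beta k) mz ml).
Qed.

Context {dT : measure_display} {T : measurableType dT}.
Variables (om : nat -> T -> bool) (S : nat -> T -> {fset 'I_n * 'cV[R]_d})
  (I : nat -> T -> b.-tuple 'I_n) (U : nat -> T -> b.-tuple 'cV[R]_d).

Lemma iterateS k w : iterate f psi al beta x0 J0 om S I U k.+1 w =
  step f psi al i0 (beta k) (iterate f psi al beta x0 J0 om S I U k w)
    (draw om S I U k w).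
Proof. by rewrite /=; case: iterate => x J; rewrite /step/= to_indicesK. Qed.

Lemma iterate_flow k w : iterate f psi al beta x0 J0 om S I U k w =
  flow (past_draws om S I U k w).
Proof.
elim: k => [//|k IH]; rewrite iterateS IH.
pose p := past_draws om S I U k.+1 w.
have E1 : past_draws om S I U k w = [tuple tnth p (widen_ord (leqnSn k) r) | r < k].
  by apply: eq_from_tnth => r; rewrite !tnth_mktuple.
have E2 : draw om S I U k w = tnth p ord_max by rewrite tnth_mktuple.
by rewrite E1 E2.
Qed.

End iteration.

Theorem theorem1 (R : realType) (n d b : nat)
  (n_gt0 : (0 < n)%N) (d_gt0 : (0 < d)%N) (b_gt0 : (0 < b)%N) (b_le_n : (b <= n)%N)
  (f : 'I_n -> 'cV[R]_d -> R) (psi : 'cV[R]_d -> \bar R) (L mu : R)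
  (f_diff : forall i x, differentiable (f i) x)
  (psi_proper : eproper psi) (psi_convex : econvex psi)
  (psi_lsc : lower_semicontinuous psi)
  (L_gt0 : 0 < L) (f_smooth : forall i, smooth L (f i))
  (f_convex : forall i, convex_function setT (f i))
  (mu_gt0 : 0 < mu) (f_strong : strongly_convex mu (favg f))
  (xstar : 'cV[R]_d)
  (xstar_min : argmin (fun x => (favg f x)%:E + psi x)%E xstar)
  (dT : measure_display) (T : measurableType dT) (P : probability T R)
  (omega : nat -> T -> bool) (S : nat -> T -> {fset 'I_n * 'cV[R]_d})
  (I : nat -> T -> b.-tuple 'I_n) (U : nat -> T -> b.-tuple 'cV[R]_d)
  (draw_meas : forall k, measurable_fun setT (draw omega S I U k))
  (draw_indep : draws_independent P omega S I U)
  (batch : batch_sampling P omega S I U)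
  (sigma : R) (sampling : sampling_assumption P omega S sigma)
  (alpha : R) (beta : nat -> R) (beta_gt0 : forall k, 0 < beta k)
  (x0 : 'cV[R]_d) (J0 : 'M[R]_(d, n))
  (alphaE : alpha = b%:R / (2 * L * (36 * d%:R + b%:R)))
  (K : nat) (K_gt0 : (0 < K)%N) :
  let nu := mean_size P omega S in
  let kappa :=
    Num.min (mu * b%:R / (4 * L * (36 * d%:R + b%:R))) (sigma / 4) in
  let C1 (be : R) :=
    be ^+ 2 * d%:R * b%:R *
    (d%:R * (32 * mu * nu + 36 * L * sigma ^+ 2 + mu * b%:R * sigma ^+ 2)
     + L * b%:R * sigma ^+ 2)
    / (4 * mu * sigma ^+ 2 * (36 * d%:R + b%:R) ^+ 2) in
  ('E_P[fun w =>
      (fnorm (xiter f psi alpha beta x0 J0 omega S I U K w - xstar) ^+ 2)%R]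
   <= ((1 - kappa) ^+ K *
         (fnorm (x0 - xstar) ^+ 2
          + 8 * d%:R * b%:R / (L ^+ 2 * n%:R * sigma * (36 * d%:R + b%:R) ^+ 2)
            * fnorm (J0 - gradF f xstar) ^+ 2)
       + \sum_(1 <= k < K.+1) (1 - kappa) ^+ (K - k) * C1 (beta k.-1))%:E)%E.
Proof.
cbv zeta; set nu := mean_size P omega S; set kappa := Num.min _ _.
pose C1 (be : R) := be ^+ 2 * d%:R * b%:R *
    (d%:R * (32 * mu * nu + 36 * L * sigma ^+ 2 + mu * b%:R * sigma ^+ 2)
     + L * b%:R * sigma ^+ 2)
    / (4 * mu * sigma ^+ 2 * (36 * d%:R + b%:R) ^+ 2).
pose i0 := Ordinal n_gt0.
have f_cvx i := convex_strongly_convex0 (f_convex i).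
case: batch => unifI indIU indU unifU; case: sampling => iidS orthS sg01 momS.
have /andP[sg0 sg1] := sg01.
have d0 : 0 < d%:R :> R by rewrite ltr0n.
have b0 : 0 < b%:R :> R by rewrite ltr0n.
have n0 : 0 < n%:R :> R by rewrite ltr0n.
pose D : R := 36 * d%:R + b%:R.
pose c := 8 * d%:R * b%:R / (L ^+ 2 * n%:R * sigma * D ^+ 2).
have [_ al0 c0 _ [_ _ kaE]] := step_constants mu d0 b0 n0 L_gt0 sg0 erefl alphaE
  (erefl : c = _).
have ka1 : kappa <= mu * b%:R / (4 * L * D) by rewrite /kappa ge_min lexx.
have ka2 : kappa <= sigma / 4 by rewrite /kappa ge_min lexx orbT.
have ka_lt1 : 0 <= 1 - kappa by lra.
have mD1 k : measurable_fun setT (fun w => (draw omega S I U k w).1.1).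
  exact: measurableT_comp measurable_fst (measurableT_comp measurable_fst (draw_meas k)).
(* Identifies nu with the expression in which [one_step] states the noise, for every k. *)
have nuE : nu = sigma * n%:R * d%:R.
  have [_ <-] := Ex_card (measurableT_comp measurable_fst (mD1 0%N))
    (measurableT_comp measurable_snd (mD1 0%N)) (orthS 0%N) (momS 0%N).
  by rewrite /nu /mean_size expectation.unlock.
have [cm minor] := argmin_minorant n_gt0 f_diff L_gt0 f_smooth psi_proper psi_convex xstar_min.
pose Z k w := iterate f psi alpha beta x0 J0 omega S I U k w.
pose V := lyapunov f xstar c.
pose Phi k := @flow R n d b f psi alpha i0 beta x0 J0 k.
have mPhi k : measurable_fun setT (Phi k : k.-tuple (@draw_space R n d b) ->
    @borel_mx R d 1 * @borel_mx R d n).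
  by apply: measurable_flow => //; exact: minor.
have mpast k : measurable_fun setT (past_draws omega S I U k).
  apply/measurable_fun_tnthP => r /=.
  rewrite (_ : _ \o _ = draw omega S I U r) //.
  by apply/funext => w /=; rewrite tnth_mktuple.
have V0 z : 0 <= V z by exact: lyapunov_ge0 (ltW c0).
have mZ k : measurable_fun setT (Z k : T -> @borel_mx R d 1 * @borel_mx R d n).
  rewrite (_ : Z k = fun w => Phi k (past_draws omega S I U k w)).
    exact: measurableT_comp (mPhi k) (mpast k).
  by apply/funext => w; exact: iterate_flow.
have mVZ k : measurable_fun setT (fun w => V (Z k w)).
  exact: (measurable_lyapunov f xstar c (mZ k)).
have stepV k : (\int[P]_w (V (Z k.+1 w))%:E <=
    (1 - kappa)%:E * \int[P]_w (V (Z k w))%:E + (C1 (beta k))%:E)%E.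
  (* Past draws and the next draw are separated as the two arguments, so that [one_step] applies for
     each frozen past. *)
  pose h (z : k.-tuple (@draw_space R n d b) * @draw_space R n d b) : R :=
    V (step f psi alpha i0 (beta k) (Phi k z.1) z.2).
  pose g t : R := (1 - kappa) * V (Phi k t) + C1 (beta k).
  have mg0 : measurable_fun setT (fun t => V (Phi k t)).
    exact: (measurable_lyapunov f xstar c (mPhi k)).
  have mg : measurable_fun setT (EFin \o g).
    apply/measurable_EFinP; apply: measurable_funD => //.
    exact: measurable_funM.
  have mh : measurable_fun setT (EFin \o h).
    have m1 : measurable_fun setT (fun z : k.-tuple (@draw_space R n d b) *
        @draw_space R n d b => z.1) by exact: measurable_fst.
    have m2 : measurable_fun setT (fun z : k.-tuple (@draw_space R n d b) *
        @draw_space R n d b => z.2) by exact: measurable_snd.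
    have m3 := measurableT_comp (mPhi k) m1.
    apply/measurable_EFinP; apply: (measurable_lyapunov f xstar c).
    exact: (measurable_step i0 f_diff al0 psi_proper psi_convex psi_lsc minor
      (beta k) m3 m2).
  have h0 z : (0 <= (EFin \o h) z)%E by rewrite lee_fin; exact: V0.
  have hg t : (\int[P]_w (EFin \o h) (t, draw omega S I U k w) <= (EFin \o g) t)%E.
    rewrite /h /g /=; case: (Phi k t) => x J.
    have := one_step n_gt0 d_gt0 b_gt0 b_le_n f_diff L_gt0 f_smooth f_cvx mu_gt0
      f_strong psi_proper psi_convex psi_lsc xstar_min i0 al0 sg01 (draw_meas k)
      (unifI k) (indIU k) (indU k) _ (orthS k) (momS k) x J (beta_gt0 k) alphaE
      (erefl : c = _) ka1 ka2.
    rewrite -nuE; apply.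
    by case: unifU => H; [left|right] => r; exact: H.
  have ind : independent P (past_draws omega S I U k) (draw omega S I U k).
    by move=> A B mA mB; rewrite setIC draw_indep// muleC.
  have H := integral_indep_le (mpast k) (draw_meas k) ind mh h0 mg hg.
  have -> : (\int[P]_w (V (Z k.+1 w))%:E =
      \int[P]_w (EFin \o h) (past_draws omega S I U k w, draw omega S I U k w))%E.
    by apply: eq_integral => w _; rewrite /Z (iterateS _ _ _ i0) (iterate_flow _ _ _ i0).
  apply: le_trans H _.
  (* Nonnegativity lets the integral of the bound split without knowing that V(Z k) is
     integrable. *)
  have C0 : 0 <= C1 (beta k).
    rewrite /C1 nuE !(mulr_ge0, invr_ge0, addr_ge0, exprn_ge0)// ?ltW//.
  rewrite -ge0_integralZl//; last first.
  - by move=> w _; rewrite lee_fin.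
  - exact/measurable_EFinP.
  have -> : (C1 (beta k))%:E = (\int[P]_w (C1 (beta k))%:E)%E.
    by rewrite integral_cst//= probability_setT mule1.
  rewrite -ge0_integralD//.
  - rewrite le_eqVlt; apply/orP; left; apply/eqP/eq_integral => w _.
    by rewrite -EFinM -EFinD /Z (iterate_flow _ _ _ i0).
  - by move=> w _; rewrite -EFinM lee_fin mulr_ge0.
  - by apply/measurable_EFinP; apply: measurable_funM.
have bound k : (\int[P]_w (V (Z k w))%:E <= ((1 - kappa) ^+ k * V (x0, J0) +
    \sum_(1 <= j < k.+1) (1 - kappa) ^+ (k - j) * C1 (beta j.-1))%:E)%E.
  elim: k => [|k IH].
    rewrite (_ : (\int[P]_w (V (Z 0%N w))%:E)%E = (\int[P]_w (V (x0, J0))%:E)%E)//.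
    by rewrite integral_cst//= probability_setT mule1 big_geq// addr0 mul1r.
  apply: le_trans (stepV k) _.
  (* The induction hypothesis may be multiplied by 1 - kappa, because kappa <= sigma / 4 < 1. *)
  apply: le_trans (leeD (lee_wpmul2l _ IH) (lexx _)) _; first by rewrite lee_fin.
  rewrite -EFinM -EFinD lee_fin [in leRHS]big_nat_recr//= subnn mul1r [in leRHS]exprS.
  rewrite mulrDr mulrA addrA.
  rewrite lerD2r lerD2l mulr_sumr le_eqVlt; apply/orP; left.
  apply/eqP/eq_big_nat => j /andP[_ jk].
  by rewrite subSn// exprS mulrA.
rewrite expectation.unlock fnorm2 fnorm2.
(* The Jacobian part of V is nonnegative, so V dominates the squared distance to the minimizer. *)
apply: le_trans _ (bound K); apply: ge0_le_integral => //.
- by move=> w _; rewrite lee_fin sqr_ge0.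
- apply/measurable_EFinP; under eq_fun do rewrite fnorm2.
  exact: measurable_fun_sqgap (measurableT_comp measurable_fst (mZ K)).
- exact/measurable_EFinP.
by move=> w _; rewrite lee_fin fnorm2 /V /lyapunov lerDl mulr_ge0 ?dot_ge0 ?ltW.
Qed.
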